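(* Let $(\Omega^{(\bullet,\bullet)},\wedge,\partial,\overline\partial)$ be an $A$-covariant complex structure on a left $A$-comodule $*$-algebra $B$, where $A$ is a Hopf $*$-algebra, and let $\gamma$ be a unitary $2$-cocycle on $A$. Put $\Omega^{(p,q)}_\gamma=\Gamma(\Omega^{(p,q)})$, $\partial_\gamma=\Gamma(\partial)$, $(\overline\partial)_\gamma=\Gamma(\overline\partial)$. Then $(\Omega^{(\bullet,\bullet)}_\gamma,\wedge_\gamma,\partial_\gamma,(\overline\partial)_\gamma)$ is an $A_\gamma$-covariant complex structure for the $*$-differential calculus $(\Omega^\bullet_\gamma,\wedge_\gamma,d_\gamma)$ on $B_\gamma$.
   Context: Hopf algebras and modules. Algebras are unital over $\mathbb C$, $\otimes=\otimes_{\mathbb C}$, Hopf algebras $(A,\Delta,\epsilon,S)$ have bijective antipode. A Hopf $*$-algebra is a Hopf algebra that is a $*$-algebra with $\Delta$ a $*$-homomorphism. Sweedler notation: $\Delta(a)=a_{(1)}\otimes a_{(2)}$; left coactions are $v\mapsto v_{(-1)}\otimes v_{(0)}$. A left $A$-comodule $*$-algebra is a left $A$-comodule algebra $B$ that is a $*$-algebra whose coaction is a $*$-homomorphism. ${}^A_B\mathsf{Mod}_B$ is the category of $B$-bimodules with a left $A$-coaction satisfying $\delta(aeb)=\delta(a)\delta(e)\delta(b)$; morphisms are $A$-colinear $B$-bilinear maps. Cocycles. A $2$-cocycle on $A$ is a convolution-invertible linear $\gamma:A\otimes A\to\mathbb C$ (inverse $\bar\gamma$) with $\gamma(g_{(1)}\otimes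 h_{(1)})\gamma(g_{(2)}h_{(2)}\otimes k)=\gamma(h_{(1)}\otimes k_{(1)})\gamma(g\otimes h_{(2)}k_{(2)})$, always assumed unital: $\gamma(h\otimes1)=\epsilon(h)=\gamma(1\otimes h)$. It is unitary if $\overline{\gamma(a\otimes b)}=\bar\gamma(S(a)^*\otimes S(b)^* )$. Put $U(k)=\gamma(k_{(1)}\otimes S(k_{(2)}))$, $\bar U(k)=\bar\gamma(S(k_{(1)})\otimes k_{(2)})$, $V=U\circ S^{-1}$, $\bar V=\bar U\circ S^{-1}$, so $\bar V(k)=\bar\gamma(k_{(2)}\otimes S^{-1}(k_{(1)}))$. For unitary $\gamma$, $A_\gamma$ is the Hopf $*$-algebra with the coalgebra $A$, product $h\cdot_\gamma k=\gamma(h_{(1)}\otimes k_{(1)})h_{(2)}k_{(2)}\bar\gamma(h_{(3)}\otimes k_{(3)})$, antipode $S_\gamma(h)=U(h_{(1)})S(h_{(2)})\bar U(h_{(3)})$, involution $h^{*_\gamma}=\bar V(h_{(1)}^* )h_{(2)}^*V(h_{(3)}^* )$. $B_\gamma$ is the left $A_\gamma$-comodule $*$-algebra with underlying comodule $B$, $a\cdot_\gamma b=\gamma(a_{(-1)}\otimes b_{(-1)})a_{(0)}b_{(0)}$, $b^{*_\gamma}=\bar V(b_{(-1)}^* )b_{(0)}^*$. The functor $\Gamma:{}^A_B\mathsf{Mod}_B\to{}^{A_\gamma}_{B_\gamma}\mathsf{Mod}_{B_\gamma}$ is the identity on underlying comodules and maps, with actions $b\cdot_\gamma m=\gamma(b_{(-1)}\otimes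 m_{(-1)})b_{(0)}m_{(0)}$, $m\cdot_\gamma b=\gamma(m_{(-1)}\otimes b_{(-1)})m_{(0)}b_{(0)}$; it is also applied (as the identity on underlying maps) to $A$-colinear linear maps. Calculi. An $A$-covariant differential calculus over $B$ is a differential graded algebra $(\Omega^\bullet=\bigoplus_{k\ge0}\Omega^k,\wedge,d)$ with $\Omega^0=B$, generated as an algebra by $B$ and $dB$, such that the coaction of $B$ extends to a comodule algebra structure on $\Omega^\bullet$ with each $\Omega^k$ in ${}^A_B\mathsf{Mod}_B$ and $d$ $A$-colinear. It is an $A$-covariant $*$-differential calculus if the involution of $B$ extends to a conjugate-linear involution of $\Omega^\bullet$ preserving each $\Omega^k$, with $(d\omega)^*=d(\omega^* )$, $(\omega\wedge\nu)^*=(-1)^{kl}\nu^*\wedge\omega^*$ for $\omega\in\Omega^k,\nu\in\Omega^l$, compatible with the coaction. Its deformation $\Omega^k_\gamma=\Gamma(\Omega^k)$, $d_\gamma=\Gamma(d)$, $\omega\wedge_\gamma\eta=\gamma(\omega_{(-1)}\otimes\eta_{(-1)})\omega_{(0)}\wedge\eta_{(0)}$, $\omega^{*_\gamma}=\bar V(\omega_{(-1)}^* )\omega_{(0)}^*$ is an $A_\gamma$-covariant $*$-differential calculus on $B_\gamma$. Complex structures. A complex structure on a $*$-calculus is an $\mathbb N_0^2$-algebra grading $\Omega^\bullet=\bigoplus_{(p,q)\in\mathbb N_0^2}\Omega^{(p,q)}$ with $\Omega^k=\bigoplus_{p+q=k}\Omega^{(p,q)}$, $(\Omega^{(p,q)})^*=\Omega^{(q,p)}$,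 $d\Omega^{(p,q)}\subseteq\Omega^{(p+1,q)}\oplus\Omega^{(p,q+1)}$; with projections $\pi^{p,q}:\Omega^{p+q}\to\Omega^{(p,q)}$, one sets $\partial=\pi^{p+1,q}\circ d$ and $\overline\partial=\pi^{p,q+1}\circ d$ on $\Omega^{(p,q)}$. It is $A$-covariant if the calculus is an $A$-covariant $*$-calculus and each $\Omega^{(p,q)}$ is a left $A$-(sub)comodule. *)

(* Defs.v *)
From HB Require Import structures.
From mathcomp Require Import all_boot all_order all_algebra.
From mathcomp Require Import boolp classical_sets functions cardinality fsbigop.
From mathcomp Require Import reals complex.

Set Implicit Arguments.
Unset Strict Implicit.
Unset Printing Implicit Defensive.

Import Order.TTheory GRing.Theory Num.Theory.
Local Open Scope ring_scope.
Local Open Scope classical_set_scope.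
Local Open Scope quotient_scope.

(* The algebraic tensor product over C: formal finite sums of pairs (v, w),
   identified when every balanced map into every abelian group takes the same
   value on them.  Balanced (rather than bilinear) maps are used so that maps
   conjugate-linear in both arguments, such as x, y |-> x^* (x) y^*, also
   descend to the quotient. *)
Section Tensor.
Variables (C : numClosedFieldType) (V W : lmodType C).

Definition balanced (U : zmodType) (f : V -> W -> U) : Prop :=
  [/\ forall v v' w, f (v + v') w = f v w + f v' w,
      forall v w w', f v (w + w') = f v w + f v w'
    & forall (c : C) v w, f (c *: v) w = f v (c *: w)].

Definition sum_pairs (U : zmodType) (f : V -> W -> U) (s : seq (V * W)) : U :=
  \sum_(x <- s) f x.1 x.2.

Definition tensor_eq (s t : seq (V * W)) : bool :=
  `[< forall (U : zmodType) (f : V -> W -> U),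
        balanced f -> sum_pairs f s = sum_pairs f t >].

Lemma tensor_eq_refl : reflexive tensor_eq.
Proof. by move=> s; apply/asboolP. Qed.

Lemma tensor_eq_sym : symmetric tensor_eq.
Proof.
by move=> s t; apply/asboolP/asboolP => h U f bf; rewrite (h U f bf).
Qed.

Lemma tensor_eq_trans : transitive tensor_eq.
Proof.
move=> t s r /asboolP h1 /asboolP h2; apply/asboolP => U f bf.
by rewrite (h1 U f bf) (h2 U f bf).
Qed.

Canonical tensor_equiv :=
  EquivRel tensor_eq tensor_eq_refl tensor_eq_sym tensor_eq_trans.

Definition tensor : Type := {eq_quot tensor_equiv}.
HB.instance Definition _ : EqQuotient _ tensor_equiv tensor :=
  EqQuotient.on tensor.
HB.instance Definition _ := Choice.on tensor.

Definition tensor_of (s : seq (V * W)) : tensor := \pi_tensor s.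

Lemma tensor_ofP (s t : seq (V * W)) :
  (forall (U : zmodType) (f : V -> W -> U),
      balanced f -> sum_pairs f s = sum_pairs f t) <->
  tensor_of s = tensor_of t.
Proof.
rewrite /tensor_of; split => [h|].
  by apply/eqmodP => /=; apply/asboolP.
by move/eqmodP => /= /asboolP.
Qed.

Definition tlift (U : zmodType) (f : V -> W -> U) (t : tensor) : U :=
  sum_pairs f (repr t).

Lemma tlift_of (U : zmodType) (f : V -> W -> U) s :
  balanced f -> tlift f (tensor_of s) = sum_pairs f s.
Proof.
move=> bf; have /tensor_ofP h : tensor_of (repr (tensor_of s)) = tensor_of s.
  by rewrite /tensor_of reprK.
exact: h.
Qed.

Lemma tensor_of_repr t : tensor_of (repr t) = t.
Proof. by rewrite /tensor_of reprK. Qed.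

Lemma tensor_ind_of (P : tensor -> Prop) :
  (forall s, P (tensor_of s)) -> forall t, P t.
Proof. by move=> h t; rewrite -(tensor_of_repr t). Qed.

Lemma tensor_ext (s t : tensor) :
  (forall (U : zmodType) (f : V -> W -> U),
      balanced f -> tlift f s = tlift f t) -> s = t.
Proof.
move=> h; rewrite -(tensor_of_repr s) -(tensor_of_repr t).
by apply/tensor_ofP => U f bf; exact: h.
Qed.

Definition tadd (s t : tensor) : tensor := tensor_of (repr s ++ repr t).
Definition tscale (c : C) (t : tensor) : tensor :=
  tensor_of [seq (c *: x.1, x.2) | x <- repr t].
Definition tzero : tensor := tensor_of [::].
Definition topp (t : tensor) : tensor := tscale (-1) t.

Lemma tlift_add (U : zmodType) (f : V -> W -> U) s t :
  balanced f -> tlift f (tadd s t) = tlift f s + tlift f t.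
Proof. by move=> bf; rewrite tlift_of // /sum_pairs big_cat. Qed.

Lemma tlift_zero (U : zmodType) (f : V -> W -> U) :
  balanced f -> tlift f tzero = 0.
Proof. by move=> bf; rewrite tlift_of // /sum_pairs big_nil. Qed.

Lemma balanced_scale (U : zmodType) (f : V -> W -> U) (c : C) :
  balanced f -> balanced (fun v => f (c *: v)).
Proof.
move=> [h1 h2 h3]; split=> [v v' w|v w w'|d v w].
- by rewrite scalerDr h1.
- by rewrite h2.
- by rewrite scalerA mulrC -scalerA h3.
Qed.

Lemma tlift_scale (U : zmodType) (f : V -> W -> U) c t :
  balanced f -> tlift f (tscale c t) = tlift (fun v => f (c *: v)) t.
Proof. by move=> bf; rewrite tlift_of // /sum_pairs big_map. Qed.

Lemma balanced0 (U : zmodType) (f : V -> W -> U) w : balanced f -> f 0 w = 0.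
Proof. by case=> h _ _; apply: (addrI (f 0 w)); rewrite -h !addr0. Qed.

Lemma balancedN (U : zmodType) (f : V -> W -> U) v w :
  balanced f -> f (- v) w = - f v w.
Proof.
move=> bf; have [h _ _] := bf.
by apply: (addrI (f v w)); rewrite -h !subrr balanced0.
Qed.

Lemma taddA : associative tadd.
Proof. by move=> x y z; apply: tensor_ext => U f bf; rewrite !tlift_add // addrA. Qed.
Lemma taddC : commutative tadd.
Proof. by move=> x y; apply: tensor_ext => U f bf; rewrite !tlift_add // addrC. Qed.
Lemma tadd0 : left_id tzero tadd.
Proof.
by move=> x; apply: tensor_ext => U f bf; rewrite tlift_add // tlift_zero // add0r.
Qed.
Lemma taddN : left_inverse tzero topp tadd.
Proof.
move=> x; apply: tensor_ext => U f bf.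
rewrite tlift_add // tlift_zero // tlift_scale // /tlift /sum_pairs -big_split /=.
by rewrite big1 // => i _; rewrite scaleN1r balancedN // addNr.
Qed.

HB.instance Definition _ := GRing.isZmodule.Build tensor taddA taddC tadd0 taddN.

Lemma tscaleA (a b : C) t : tscale a (tscale b t) = tscale (a * b) t.
Proof.
apply: tensor_ext => U f bf.
rewrite !tlift_scale //; last exact: balanced_scale.
by apply: eq_bigr => i _; rewrite scalerA.
Qed.
Lemma tscale1 : left_id 1 tscale.
Proof.
move=> t; apply: tensor_ext => U f bf; rewrite tlift_scale //.
by apply: eq_bigr => i _; rewrite scale1r.
Qed.
Lemma tscaleDr : right_distributive tscale +%R.
Proof.
move=> c s t; apply: tensor_ext => U f bf.
by rewrite tlift_add // !tlift_scale // tlift_add //; exact: balanced_scale.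
Qed.
Lemma tscaleDl t : {morph tscale^~ t : a b / a + b}.
Proof.
move=> a b; apply: tensor_ext => U f bf.
rewrite tlift_add // !tlift_scale // /tlift /sum_pairs -big_split /=.
by apply: eq_bigr => i _; case: bf => h _ _; rewrite scalerDl h.
Qed.

HB.instance Definition _ :=
  GRing.Zmodule_isLmodule.Build C tensor tscaleA tscale1 tscaleDr tscaleDl.

Definition tpure (v : V) (w : W) : tensor := tensor_of [:: (v, w)].

(* The universal property: a balanced map f factors as [tlift f \o tpure], and
   [tlift f] is additive, linear as soon as f is; pure tensors generate. *)
Lemma tlift_pure (U : zmodType) (f : V -> W -> U) v w :
  balanced f -> tlift f (tpure v w) = f v w.
Proof. by move=> bf; rewrite tlift_of // /sum_pairs big_seq1. Qed.

Lemma tliftD (U : zmodType) (f : V -> W -> U) s t :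
  balanced f -> tlift f (s + t) = tlift f s + tlift f t.
Proof. exact: tlift_add. Qed.

Lemma linear_scale (V' U : lmodType C) (f : V' -> U) (c : C) v :
  linear f -> f (c *: v) = c *: f v.
Proof.
move=> h; have f0 : f 0 = 0.
  by apply: (addrI (f 0)); have := h 1 0 0; rewrite !scale1r !addr0 => <-.
by have := h c v 0; rewrite f0 !addr0.
Qed.

Lemma balanced_bilinear (U : lmodType C) (f : V -> W -> U) :
  (forall v, linear (f v)) -> (forall w, linear (f^~ w)) -> balanced f.
Proof.
move=> h1 h2; split=> [v v' w|v w w'|c v w].
- by have := h2 w 1 v v'; rewrite !scale1r.
- by have := h1 v 1 w w'; rewrite !scale1r.
- by rewrite (linear_scale c v (h2 w)) (linear_scale c w (h1 v)).
Qed.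

Lemma tlift_linear (U : lmodType C) (f : V -> W -> U) :
  (forall v, linear (f v)) -> (forall w, linear (f^~ w)) -> linear (tlift f).
Proof.
move=> h1 h2 c s t; have bf := balanced_bilinear h1 h2.
rewrite tlift_add // tlift_scale //; congr (_ + _).
rewrite /tlift /sum_pairs scaler_sumr; apply: eq_bigr => i _.
exact: (linear_scale c i.1 (h2 i.2)).
Qed.

Lemma tpure_balanced : balanced tpure.
Proof.
split=> [v v' w|v w w'|c v w]; apply: tensor_ext => U f bf;
  rewrite ?tlift_add // !tlift_pure //; by case: bf.
Qed.

Lemma tensor_sum (t : tensor) : t = \sum_(x <- repr t) tpure x.1 x.2.
Proof.
apply: tensor_ext => U f bf; rewrite {1}/tlift.
elim: (repr t) => [|x s IH]; first by rewrite /sum_pairs !big_nil tlift_zero.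
rewrite big_cons tliftD // tlift_pure // -IH /sum_pairs big_cons //.
Qed.

End Tensor.

Arguments tpure {C V W} v w.
Arguments tlift {C V W U} f t.

Notation "v ⊗ w" := (tpure v w) (at level 38, left associativity) : ring_scope.

(* Sweedler notation: if t = \sum_i v_i ⊗ w_i then
   [\sw_(v, w <- t) F] is \sum_i F v_i w_i. *)
Notation "\sw_ ( v , w <- t ) F" := (tlift (fun v w => F) t)
  (at level 41, v binder, w binder, t at level 60, F at level 41,
   format "\sw_ ( v ,  w  <-  t )  F") : ring_scope.

(* All structures below are predicates on bare operations over a fixed vector
   space, because a cocycle deformation changes the operations but not the
   space. *)
Section Structures.
Variable C : numClosedFieldType.

Definition subspace (V : lmodType C) (P : set V) : Prop :=
  P 0 /\ forall (c : C) u v, P u -> P v -> P (c *: u + v).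

Definition conj_linear (V : lmodType C) (f : V -> V) : Prop :=
  forall (c : C) u v, f (c *: u + v) = Num.conj c *: f u + f v.

Definition is_decomposition (I : choiceType) (V : lmodType C) (P : I -> set V)
    (v : V) (x : I -> V) : Prop :=
  [/\ forall i, P i (x i), finite_set [set i | x i != 0]
    & v = \sum_(i \in [set: I]) x i].

Definition direct_sum (I : choiceType) (V : lmodType C) (P : I -> set V) :=
  (forall i, subspace (P i)) /\
  forall v, exists! x : I -> V, is_decomposition P v x.

(* The projection onto the i-th summand (when [direct_sum P] holds). *)
Definition component (I : choiceType) (V : lmodType C) (P : I -> set V)
    (i : I) (v : V) : V :=
  xget (fun=> 0) [set x : I -> V | is_decomposition P v x] i.

Record alg_data (V : lmodType C) := AlgData {
  aone : V;
  amul : V -> V -> V }.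

Definition is_algebra (V : lmodType C) (M : alg_data V) : Prop :=
  [/\ (forall v, linear (amul M v)) /\ (forall w, linear ((amul M)^~ w)),
      associative (amul M),
      left_id (aone M) (amul M)
    & right_id (aone M) (amul M)].

Record hopf_data (A : lmodType C) := HopfData {
  halg :> alg_data A;
  coprod : A -> tensor A A;
  counit : A -> C;
  antipode : A -> A;
  hstar : A -> A }.

Definition is_coalgebra (A : lmodType C) (H : hopf_data A) : Prop :=
  [/\ linear (coprod H),
      scalar (counit H),
      forall a, \sw_(x, a3 <- coprod H a) \sw_(a1, a2 <- coprod H x)
                   a1 ⊗ (a2 ⊗ a3)
                = \sw_(a1, y <- coprod H a) a1 ⊗ coprod H y,
      forall a, \sw_(a1, a2 <- coprod H a) counit H a1 *: a2 = a
    & forall a, \sw_(a1, a2 <- coprod H a) counit H a2 *: a1 = a].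

Definition is_bialgebra (A : lmodType C) (H : hopf_data A) : Prop :=
  [/\ is_algebra H,
      is_coalgebra H,
      coprod H (aone H) = aone H ⊗ aone H
        /\ forall a b, coprod H (amul H a b) =
             \sw_(a1, a2 <- coprod H a) \sw_(b1, b2 <- coprod H b)
               amul H a1 b1 ⊗ amul H a2 b2
    & counit H (aone H) = 1
        /\ forall a b, counit H (amul H a b) = counit H a * counit H b].

Definition is_hopf_algebra (A : lmodType C) (H : hopf_data A) : Prop :=
  [/\ is_bialgebra H,
      linear (antipode H) /\ bijective (antipode H),
      forall a, \sw_(a1, a2 <- coprod H a) amul H (antipode H a1) a2
                = counit H a *: aone H
    & forall a, \sw_(a1, a2 <- coprod H a) amul H a1 (antipode H a2)
                = counit H a *: aone H].

Definition is_hopf_star_algebra (A : lmodType C) (H : hopf_data A) : Prop :=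
  [/\ is_hopf_algebra H,
      conj_linear (hstar H) /\ involutive (hstar H),
      forall a b, hstar H (amul H a b) = amul H (hstar H b) (hstar H a)
    & forall a, coprod H (hstar H a) =
        \sw_(a1, a2 <- coprod H a) hstar H a1 ⊗ hstar H a2].

Definition antipode_inv (A : lmodType C) (H : hopf_data A) (a : A) : A :=
  xget 0 [set x | antipode H x = a].

Definition is_comodule (A V : lmodType C) (H : hopf_data A)
    (delta : V -> tensor A V) : Prop :=
  [/\ linear delta,
      forall v, \sw_(x, v0 <- delta v) \sw_(a1, a2 <- coprod H x)
                   a1 ⊗ (a2 ⊗ v0)
                = \sw_(a1, y <- delta v) a1 ⊗ delta y
    & forall v, \sw_(a, v0 <- delta v) counit H a *: v0 = v].

(* [delta P] is contained in the image of A ⊗ P in A ⊗ V. *)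
Definition coaction_stable (A V : lmodType C) (delta : V -> tensor A V)
    (P : set V) : Prop :=
  forall v, P v -> exists s : seq (A * V),
    (forall x, x \in s -> P x.2) /\ delta v = \sum_(x <- s) x.1 ⊗ x.2.

Definition is_subcomodule (A V : lmodType C) (delta : V -> tensor A V)
    (P : set V) : Prop := subspace P /\ coaction_stable delta P.

Definition is_comodule_algebra (A V : lmodType C) (H : hopf_data A)
    (M : alg_data V) (delta : V -> tensor A V) : Prop :=
  [/\ is_algebra M,
      is_comodule H delta,
      delta (aone M) = aone H ⊗ aone M
    & forall v w, delta (amul M v w) =
        \sw_(a, v0 <- delta v) \sw_(b, w0 <- delta w)
          amul H a b ⊗ amul M v0 w0].

Record comod_alg_data (A B : lmodType C) := ComodAlgData {
  balg :> alg_data B;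
  bcoact : B -> tensor A B;
  bstar : B -> B }.

Definition is_comodule_star_algebra (A B : lmodType C) (H : hopf_data A)
    (X : comod_alg_data A B) : Prop :=
  [/\ is_comodule_algebra H X (bcoact X),
      conj_linear (bstar X) /\ involutive (bstar X),
      forall a b, bstar X (amul X a b) = amul X (bstar X b) (bstar X a)
    & forall b, bcoact X (bstar X b) =
        \sw_(a, b0 <- bcoact X b) hstar H a ⊗ bstar X b0].

Record bimod_data (A B M : lmodType C) := BimodData {
  lact : B -> M -> M;
  ract : M -> B -> M;
  mcoact : M -> tensor A M }.

(* The subspace P of M, with the operations E, is an object of the category of
   B-bimodules with compatible left A-coaction. *)
Definition is_hopf_bimodule (A B M : lmodType C) (H : hopf_data A)
    (X : comod_alg_data A B) (E : bimod_data A B M) (P : set M) : Prop :=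
  [/\ is_comodule H (mcoact E) /\ is_subcomodule (mcoact E) P,
      [/\ (forall b, linear (lact E b)) /\ (forall m, linear ((lact E)^~ m)),
          forall b m, P m -> P (lact E b m),
          forall m, P m -> lact E (aone X) m = m
        & forall a b m, P m -> lact E (amul X a b) m = lact E a (lact E b m)],
      [/\ (forall m, linear (ract E m)) /\ (forall b, linear ((ract E)^~ b)),
          forall m b, P m -> P (ract E m b),
          forall m, P m -> ract E m (aone X) = m
        & forall m a b, P m -> ract E m (amul X a b) = ract E (ract E m a) b],
      forall a m b, P m -> ract E (lact E a m) b = lact E a (ract E m b)
    & [/\ forall b m, P m -> mcoact E (lact E b m) =
            \sw_(x, b0 <- bcoact X b) \sw_(y, m0 <- mcoact E m)
              amul H x y ⊗ lact E b0 m0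
        & forall m b, P m -> mcoact E (ract E m b) =
            \sw_(y, m0 <- mcoact E m) \sw_(x, b0 <- bcoact X b)
              amul H y x ⊗ ract E m0 b0]].

(* [oalg] carries the wedge product of the total space of forms, [oinc] is the
   identification of B with the forms of degree 0, and [omod] holds the
   B-actions and the A-coaction. *)
Record calculus_data (A B Om : lmodType C) := CalculusData {
  oalg :> alg_data Om;
  omod : bimod_data A B Om;
  odeg : nat -> set Om;
  oinc : B -> Om;
  odiff : Om -> Om;
  ostar : Om -> Om }.

Definition is_dga (A B Om : lmodType C) (O : calculus_data A B Om) : Prop :=
  [/\ is_algebra O,
      direct_sum (odeg O),
      odeg O 0 (aone O)
        /\ forall k l w h, odeg O k w -> odeg O l h ->
             odeg O (k + l)%N (amul O w h),
      linear (odiff O) /\ forall k w, odeg O k w -> odeg O k.+1 (odiff O w)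
    & (forall w, odiff O (odiff O w) = 0)
        /\ forall k w h, odeg O k w ->
             odiff O (amul O w h) = amul O (odiff O w) h
                                    + (-1) ^+ k *: amul O w (odiff O h)].

Definition is_subalgebra (V : lmodType C) (M : alg_data V) (P : set V) : Prop :=
  [/\ subspace P, P (aone M) & forall v w, P v -> P w -> P (amul M v w)].

Definition is_differential_calculus (A B Om : lmodType C)
    (X : comod_alg_data A B) (O : calculus_data A B Om) : Prop :=
  [/\ is_dga O,
      [/\ linear (oinc O), injective (oinc O), range (oinc O) = odeg O 0,
          oinc O (aone X) = aone O
        & forall a b, oinc O (amul X a b) = amul O (oinc O a) (oinc O b)]
    & forall P : set Om, is_subalgebra O P ->
        (forall b, P (oinc O b)) -> (forall b, P (odiff O (oinc O b))) ->
        forall w, P w].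

Definition is_covariant_calculus (A B Om : lmodType C) (H : hopf_data A)
    (X : comod_alg_data A B) (O : calculus_data A B Om) : Prop :=
  let delta := mcoact (omod O) in
  [/\ is_differential_calculus X O,
      is_comodule_algebra H O delta,
      forall b, delta (oinc O b) = \sw_(a, b0 <- bcoact X b) a ⊗ oinc O b0,
      [/\ forall b w, lact (omod O) b w = amul O (oinc O b) w,
          forall w b, ract (omod O) w b = amul O w (oinc O b)
        & forall k, is_hopf_bimodule H X (omod O) (odeg O k)]
    & forall w, delta (odiff O w) = \sw_(a, w0 <- delta w) a ⊗ odiff O w0].

Definition is_covariant_star_calculus (A B Om : lmodType C) (H : hopf_data A)
    (X : comod_alg_data A B) (O : calculus_data A B Om) : Prop :=
  let delta := mcoact (omod O) in
  [/\ is_covariant_calculus H X O,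
      [/\ conj_linear (ostar O), involutive (ostar O),
          forall b, ostar O (oinc O b) = oinc O (bstar X b)
        & forall k w, odeg O k w -> odeg O k (ostar O w)],
      forall w, ostar O (odiff O w) = odiff O (ostar O w),
      forall k l w h, odeg O k w -> odeg O l h ->
        ostar O (amul O w h) =
          (-1) ^+ (k * l) *: amul O (ostar O h) (ostar O w)
    & forall w, delta (ostar O w) =
        \sw_(a, w0 <- delta w) hstar H a ⊗ ostar O w0].

Record complex_data (Om : lmodType C) := ComplexData {
  bideg : nat * nat -> set Om;
  del : Om -> Om;
  delbar : Om -> Om }.

Definition is_complex_structure (A B Om : lmodType C)
    (O : calculus_data A B Om) (K : complex_data Om) : Prop :=
  [/\ direct_sum (bideg K)
        /\ (forall k w, odeg O k w <->
              exists x : nat -> Om,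
                (forall p, (p <= k)%N -> bideg K (p, (k - p)%N) (x p))
                /\ w = \sum_(p < k.+1) x p),
      bideg K (0, 0)%N (aone O)
        /\ (forall p q p' q' w h, bideg K (p, q) w -> bideg K (p', q') h ->
              bideg K (p + p', q + q')%N (amul O w h)),
      forall p q, ostar O @` bideg K (p, q) = bideg K (q, p),
      forall p q w, bideg K (p, q) w -> exists u v,
        [/\ bideg K (p.+1, q) u, bideg K (p, q.+1) v & odiff O w = u + v]
    & (linear (del K) /\ forall p q w, bideg K (p, q) w ->
         del K w = component (bideg K) (p.+1, q) (odiff O w))
      /\ (linear (delbar K) /\ forall p q w, bideg K (p, q) w ->
         delbar K w = component (bideg K) (p, q.+1) (odiff O w))].

(* A-covariant complex structure on the left A-comodule *-algebra B: everything
   that the notion presupposes is included. *)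
Definition is_covariant_complex_structure (A B Om : lmodType C)
    (H : hopf_data A) (X : comod_alg_data A B) (O : calculus_data A B Om)
    (K : complex_data Om) : Prop :=
  [/\ is_hopf_star_algebra H,
      is_comodule_star_algebra H X,
      is_covariant_star_calculus H X O,
      is_complex_structure O K
    & forall p q, is_subcomodule (mcoact (omod O)) (bideg K (p, q))].

End Structures.

Section Deformation.
Variables (C : numClosedFieldType) (A : lmodType C) (H : hopf_data A).
Variables (g gbar : tensor A A -> C).

Definition convolution_inverse : Prop :=
  (forall a b, \sw_(a1, a2 <- coprod H a) \sw_(b1, b2 <- coprod H b)
       (g (a1 ⊗ b1) * gbar (a2 ⊗ b2)) = counit H a * counit H b)
  /\ (forall a b, \sw_(a1, a2 <- coprod H a) \sw_(b1, b2 <- coprod H b)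
       (gbar (a1 ⊗ b1) * g (a2 ⊗ b2)) = counit H a * counit H b).

(* Unital 2-cocycle g with convolution inverse gbar. *)
Definition is_two_cocycle : Prop :=
  [/\ scalar g,
      scalar gbar,
      convolution_inverse,
      forall x y z,
        \sw_(x1, x2 <- coprod H x) \sw_(y1, y2 <- coprod H y)
          (g (x1 ⊗ y1) * g (amul H x2 y2 ⊗ z))
        = \sw_(y1, y2 <- coprod H y) \sw_(z1, z2 <- coprod H z)
          (g (y1 ⊗ z1) * g (x ⊗ amul H y2 z2))
    & forall x, g (x ⊗ aone H) = counit H x /\ g (aone H ⊗ x) = counit H x].

Definition is_unitary_cocycle : Prop :=
  forall a b, Num.conj (g (a ⊗ b)) =
    gbar (hstar H (antipode H a) ⊗ hstar H (antipode H b)).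

Definition Ucoc (k : A) : C :=
  \sw_(k1, k2 <- coprod H k) g (k1 ⊗ antipode H k2).
Definition Ubar (k : A) : C :=
  \sw_(k1, k2 <- coprod H k) gbar (antipode H k1 ⊗ k2).
Definition Vcoc (k : A) : C := Ucoc (antipode_inv H k).
Definition Vbar (k : A) : C := Ubar (antipode_inv H k).

Definition deform_hopf : hopf_data A := {|
  halg := {|
    aone := aone H;
    amul := fun h k =>
      \sw_(h1, h' <- coprod H h) \sw_(h2, h3 <- coprod H h')
      \sw_(k1, k' <- coprod H k) \sw_(k2, k3 <- coprod H k')
        ((g (h1 ⊗ k1) * gbar (h3 ⊗ k3)) *: amul H h2 k2) |};
  coprod := coprod H;
  counit := counit H;
  antipode := fun h =>
    \sw_(h1, h' <- coprod H h) \sw_(h2, h3 <- coprod H h')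
      ((Ucoc h1 * Ubar h3) *: antipode H h2);
  hstar := fun h =>
    \sw_(h1, h' <- coprod H h) \sw_(h2, h3 <- coprod H h')
      ((Vbar (hstar H h1) * Vcoc (hstar H h3)) *: hstar H h2) |}.

Definition deform_mul (V W U : lmodType C) (dV : V -> tensor A V)
    (dW : W -> tensor A W) (m : V -> W -> U) (v : V) (w : W) : U :=
  \sw_(a, v0 <- dV v) \sw_(b, w0 <- dW w) (g (a ⊗ b) *: m v0 w0).

Definition deform_star (V : lmodType C) (dV : V -> tensor A V)
    (star : V -> V) (v : V) : V :=
  \sw_(a, v0 <- dV v) (Vbar (hstar H a) *: star v0).

Variable B : lmodType C.

Definition deform_comod_alg (X : comod_alg_data A B) : comod_alg_data A B := {|
  balg := {| aone := aone X;
             amul := deform_mul (bcoact X) (bcoact X) (amul X) |};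
  bcoact := bcoact X;
  bstar := deform_star (bcoact X) (bstar X) |}.

(* The functor Gamma on objects; it is the identity on underlying comodules and
   on maps, so that Gamma of a subspace or of a linear map is written as that
   subspace or map itself. *)
Definition Gamma (M : lmodType C) (X : comod_alg_data A B)
    (E : bimod_data A B M) : bimod_data A B M := {|
  lact := deform_mul (bcoact X) (mcoact E) (lact E);
  ract := deform_mul (mcoact E) (bcoact X) (ract E);
  mcoact := mcoact E |}.

Variable Om : lmodType C.

Definition deform_calculus (X : comod_alg_data A B)
    (O : calculus_data A B Om) : calculus_data A B Om := {|
  oalg := {| aone := aone O;
             amul := deform_mul (mcoact (omod O)) (mcoact (omod O)) (amul O) |};
  omod := Gamma X (omod O);
  odeg := odeg O;
  oinc := oinc O;
  odiff := odiff O;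
  ostar := deform_star (mcoact (omod O)) (ostar O) |}.

Definition deform_complex (K : complex_data Om) : complex_data Om := {|
  bideg := bideg K;
  del := del K;
  delbar := delbar K |}.

End Deformation.

(* Main.v *)
Require Import Defs.
From HB Require Import structures.
From mathcomp Require Import all_boot all_order all_algebra.
From mathcomp Require Import boolp classical_sets.
From mathcomp Require Import reals complex ring.

Set Implicit Arguments.
Unset Strict Implicit.
Unset Printing Implicit Defensive.

Import GRing.Theory Num.Theory.
Local Open Scope ring_scope.

(** Deformation by a cocycle changes products and involutions only by scalars
    read off from the coaction, so every axiom of the deformed structure comes
    down to an identity between functionals on A, A ⊗ A or A ⊗ A ⊗ A.

    The dual of a coalgebra D is an algebra under convolution, and a functional
    phi acts on a left D-comodule V by phi ▷ v = phi(v_(-1)) v_(0) ([act]); on D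
    itself there is also the right action d ◁ psi = d_(1) psi(d_(2)), which is
    [act] for the opposite coproduct, and [tw] is phi ▷ d ◁ psi.  If V and W are
    A-comodules then V ⊗ W is a comodule over the coalgebra A ⊗ A, and with m
    the old product
      v ·_γ w = m (γ ▷ (v ⊗ w)),              v^{*_γ} = Vbar ▷ v^*,
      h ·_γ k = m (γ ▷ (h ⊗ k) ◁ γbar),       h^{*_γ} = Vbar ▷ h^* ◁ V,
      S_γ(h)  = S (U ▷ h ◁ Ubar).
    A map compatible with coactions along a coalgebra map f satisfies
    phi ▷ h(v) = h((phi ∘ f) ▷ v) ([act_morph]); the product of a comodule
    algebra is such a map along the product of A, and S and its inverse are
    such maps for the opposite coproduct.  This moves all functionals to one
    place, where they are multiplied in the convolution algebra:
    - associativity becomes the cocycle identity, [coclE], for which the version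
      for γbar, [coclbE], follows by uniqueness of inverses;
    - multiplicativity of the coactions is the cancellation of γ against γbar
      in the middle ([tw_coprod], [coact_deform_mul]);
    - the involution reverses deformed products because of [Vbar_hmul] and
      [Vcoc_hmul], which compare V on a product with V on the two factors, and
      it squares to the identity because by unitarity the conjugate of Vbar(a^* )
      is V(a) ([conj_Vbar]) and V is inverse to Vbar ([conv_Vcoc_Vbar]).
    Some identities that involve the antipode are not of this formal kind, since
    they evaluate functionals on neighbouring legs k1 ⊗ S(k2) of one element,
    which is no map of coalgebras in k.  They are U Ubar = Ubar U = ε
    ([conv_Ucoc_Ubar], [conv_Ubar_Ucoc]), the formula for U on a product
    ([Ucoc_hmul]) and the antipode axiom of A_γ ([antipodeg_l], [antipodeg_r]);
    they are computed with iterated coproducts [sw].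

    For the calculus, Ω is a comodule algebra and the bimodule structures come
    from the inclusion of B, so the same lemmas apply.  The Leibniz rule and the
    signs in the involution hold only for homogeneous forms; they survive since
    each Ω^k is a subcomodule, so that a deformed product of homogeneous forms is
    a combination of old products of homogeneous forms of the same degrees
    ([eq_deform_mul]).  That B and dB still generate is seen by undoing the
    deformation: the old product is the twist of the new one by γbar
    ([deform_generated]).  The bigrading, d, ∂ and the conjugate of ∂ do not
    change at all, and the summands Ω^(p,q) are closed under the new operations
    because they are subcomodules. *)

(** * Linear and bilinear maps *)

Section Multilinear.
Variable C : numClosedFieldType.

(** Linearity of a bare function; functionals take values in C^o, the field as
    a module over itself, so that they are covered too. *)
Definition lin (V U : lmodType C) (f : V -> U) : Prop :=
  forall (c : C) u v, f (c *: u + v) = c *: f u + f v.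

Definition bil (V W U : lmodType C) (f : V -> W -> U) : Prop :=
  (forall v, lin (f v)) /\ (forall w, lin (fun v => f v w)).

Definition trilin (V W Z U : lmodType C) (f : V -> W -> Z -> U) : Prop :=
  [/\ forall w z, lin (fun v => f v w z),
      forall v z, lin (fun w => f v w z)
    & forall v w, lin (fun z => f v w z)].

Section Lin.
Variables (V U : lmodType C) (f : V -> U).
Hypothesis lf : lin f.

Lemma linD u v : f (u + v) = f u + f v.
Proof. by have := lf 1 u v; rewrite !scale1r. Qed.

Lemma lin0 : f 0 = 0.
Proof. by apply: (addrI (f 0)); rewrite -linD !addr0. Qed.

Lemma linZ c u : f (c *: u) = c *: f u.
Proof. by have := lf c u 0; rewrite lin0 !addr0. Qed.

Lemma lin_sum (I : Type) (r : seq I) (h : I -> V) :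
  f (\sum_(i <- r) h i) = \sum_(i <- r) f (h i).
Proof. by elim/big_rec2: _ => [|i x y _ <-]; rewrite ?lin0 ?linD. Qed.
End Lin.

Lemma lin_id (V : lmodType C) : lin (fun x : V => x).
Proof. by []. Qed.

Lemma lin_comp (V U W : lmodType C) (h : U -> W) (f : V -> U) :
  lin h -> lin f -> lin (fun x => h (f x)).
Proof. by move=> lh lf c u v; rewrite lf lh. Qed.

Lemma lin_scalel (V : lmodType C) (v : V) : lin (fun c : C^o => (c : C) *: v).
Proof. by move=> c a b; rewrite scalerDl scalerA. Qed.

Lemma lin_scaler (V : lmodType C) (c : C) : lin (fun v : V => c *: v).
Proof. by move=> d u v; rewrite scalerDr !scalerA mulrC. Qed.

Lemma lin_mull (a : C) : @lin C^o C^o (fun c => c * a).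
Proof. by move=> c u v; rewrite mulrDl -mulrA. Qed.

Lemma lin_mulr (a : C) : @lin C^o C^o (fun c => a * c).
Proof. by move=> c u v; rewrite mulrDr /GRing.scale /= mulrCA. Qed.

Lemma bil_balanced (V W U : lmodType C) (f : V -> W -> U) :
  bil f -> balanced f.
Proof. by case=> h1 h2; apply: balanced_bilinear => [v|w] c x y; [apply: h1|apply: h2]. Qed.

Lemma lin_tpurel (V W : lmodType C) (w : W) : lin (fun v : V => v ⊗ w).
Proof.
have [h1 h2 h3] := tpure_balanced V W; move=> c u v; rewrite h1; congr (_ + _).
by apply: tensor_ext => U f bf; rewrite -[RHS]/(tlift f (tscale c _)) tlift_scale // !tlift_pure //; exact: balanced_scale.
Qed.

Lemma lin_tpurer (V W : lmodType C) (v : V) : lin (fun w : W => v ⊗ w).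
Proof.
have [h1 h2 h3] := tpure_balanced V W; move=> c u w; rewrite h2 -h3.
by rewrite -[c *: v]addr0 lin_tpurel (lin0 (@lin_tpurel _ _ _)) addr0.
Qed.

Lemma bil_tpure (V W : lmodType C) : bil (@tpure C V W).
Proof. by split=> ?; [exact: lin_tpurer | exact: lin_tpurel]. Qed.

Section Tlift.
Variables V W : lmodType C.

Lemma eq_tlift (U : zmodType) (f h : V -> W -> U) t :
  (forall v w, f v w = h v w) -> tlift f t = tlift h t.
Proof. by move=> e; apply: eq_bigr. Qed.

Lemma tliftE (U : lmodType C) (f : V -> W -> U) v w :
  bil f -> tlift f (v ⊗ w) = f v w.
Proof. by move=> bf; rewrite tlift_pure //; exact: bil_balanced. Qed.

Lemma lin_tlift (U : lmodType C) (f : V -> W -> U) : bil f -> lin (tlift f).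
Proof. by case=> h1 h2; exact: tlift_linear. Qed.

Lemma lin_tlift_body (V' U : lmodType C) (F : V' -> V -> W -> U) t :
  (forall v w, lin (fun x => F x v w)) -> lin (fun x => tlift (F x) t).
Proof.
move=> h c u v; rewrite /tlift /sum_pairs scaler_sumr -big_split.
by apply: eq_bigr => i _; exact: h.
Qed.

Lemma tlift_lin (U U' : lmodType C) (h : U -> U') (f : V -> W -> U) t :
  lin h -> h (tlift f t) = tlift (fun v w => h (f v w)) t.
Proof. by move=> lh; exact: lin_sum. Qed.

(** Sums over independent tensors commute whatever the summand is, since both
    run over chosen finite representatives. *)
Lemma tlift_swap (V' W' : lmodType C) (U : zmodType) (F : V -> W -> V' -> W' -> U) t s :
  tlift (fun v w => tlift (fun v' w' => F v w v' w') s) t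
  = tlift (fun v' w' => tlift (fun v w => F v w v' w') t) s.
Proof. exact: exchange_big. Qed.

Lemma tlift_eta (t : tensor V W) : tlift (fun v w => v ⊗ w) t = t.
Proof. by rewrite [RHS]tensor_sum. Qed.

Lemma tensor_lin_ext (U : lmodType C) (f h : tensor V W -> U) t :
  lin f -> lin h -> (forall v w, f (v ⊗ w) = h (v ⊗ w)) -> f t = h t.
Proof.
move=> lf lh e; rewrite (tensor_sum t) !lin_sum //; apply: eq_bigr => i _.
exact: e.
Qed.

End Tlift.

Lemma tlift_tlift (V W V' W' U : lmodType C) (f : V' -> W' -> U)
    (h : V -> W -> tensor V' W') t :
  bil f -> tlift f (tlift h t) = tlift (fun v w => tlift f (h v w)) t.
Proof. by move=> bf; rewrite tlift_lin //; exact: lin_tlift. Qed.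

End Multilinear.

Create HintDb lindb.
#[export] Hint Resolve lin_id lin_scalel lin_scaler lin_mull lin_mulr lin_tpurel lin_tpurer bil_tpure : lindb.

(* Linearity of x |-> e is proved by following the single place where x occurs
   in e; the base cases come from the context and from the hint database. *)
Ltac linstep :=
  first
  [ assumption
  | solve [eauto 3 with lindb nocore]
  | match goal with
    | |- forall _, _ => intro
    | |- _ /\ _ => split
    | |- bil _ => split
    | |- trilin _ => split
    | |- @lin _ _ _ (fun x => tlift (fun u v => @?F x u v) ?t) =>
        apply: (@lin_tlift_body _ _ _ _ _ F t)
    | |- @lin ?C ?V ?U (fun x => tlift ?F (@?f x)) =>
        refine (@lin_comp C V _ U (tlift F) f _ _)
    | |- lin (tlift _) => apply: lin_tlift
    | |- @lin ?C ?V ?U (fun x => ?h (@?f x)) =>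
        first [ refine (@lin_comp C V _ U h f _ _)
              | refine (@lin_comp C V C^o U h f _ _) ]
    | |- @lin ?C ?V ?U (fun x => ?b (@?f x) ?y) =>
        lazymatch f with fun x => x => fail | _ => idtac end;
        first [ refine (@lin_comp C V _ U (fun z => b z y) f _ _)
              | refine (@lin_comp C V C^o U (fun z => b z y) f _ _) ]
    | |- @lin ?C ?V ?U (fun x => ?b (@?f x) ?y ?z) =>
        lazymatch f with fun x => x => fail | _ => idtac end;
        refine (@lin_comp C V _ U (fun u => b u y z) f _ _)
    end ].
Ltac lintac := repeat linstep.

(** * Coalgebras, comodules and their dual algebras *)

Section Coalgebra.
Variable C : numClosedFieldType.

(** Coassociativity in the form in which it is used, under an arbitrary
    trilinear map. *)
Definition comod (D V : lmodType C) (dl : D -> tensor D D) (ep : D -> C^o)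
    (dV : V -> tensor D V) : Prop :=
  [/\ lin dV,
      forall (U : lmodType C) (F : D -> D -> V -> U), trilin F -> forall v,
        \sw_(x, v0 <- dV v) \sw_(a, b <- dl x) F a b v0
        = \sw_(a, y <- dV v) \sw_(b, v0 <- dV y) F a b v0
    & forall v, \sw_(a, v0 <- dV v) ((ep a : C) *: v0) = v].

Definition coalg (D : lmodType C) (dl : D -> tensor D D) (ep : D -> C^o) :=
  [/\ lin ep, comod dl ep dl
    & forall a, \sw_(a1, a2 <- dl a) ((ep a2 : C) *: a1) = a].

Definition act (D V : lmodType C) (dV : V -> tensor D V) (phi : D -> C^o)
  (v : V) : V := \sw_(a, v0 <- dV v) ((phi a : C) *: v0).

Definition conv (D : lmodType C) (dl : D -> tensor D D) (phi psi : D -> C^o) :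
  D -> C^o := fun d => \sw_(a, b <- dl d) (phi a * psi b).

(** The co-opposite coproduct.  Its left action on D is the right action of the
    dual algebra, so right-handed statements are instances of left-handed ones. *)
Definition cop (D : lmodType C) (dl : D -> tensor D D) (d : D) : tensor D D :=
  \sw_(a, b <- dl d) (b ⊗ a).

(** The functional phi ⊗ psi. *)
Definition ptensor (D E : lmodType C) (phi : D -> C^o) (psi : E -> C^o) :
  tensor D E -> C^o := tlift (fun a b => (phi a * psi b : C^o)).

(** The diagonal coaction of D ⊗ E on V ⊗ W; for V = D and W = E it is the
    coproduct of the tensor product coalgebra. *)
Definition tcoact (D E V W : lmodType C) (dV : V -> tensor D V)
    (dW : W -> tensor E W) : tensor V W -> tensor (tensor D E) (tensor V W) :=
  tlift (fun v w => \sw_(a, v0 <- dV v) \sw_(b, w0 <- dW w)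
                      ((a ⊗ b) ⊗ (v0 ⊗ w0))).

(** h is colinear along f.  Coalgebra maps are the case h = f, and colinear maps
    the case f = id. *)
Definition cmorph (D E V W : lmodType C) (f : D -> E) (h : V -> W)
    (dV : V -> tensor D V) (dW : W -> tensor E W) : Prop :=
  forall v, dW (h v) = \sw_(a, v0 <- dV v) (f a ⊗ h v0).

Lemma lin_act (D V : lmodType C) (dV : V -> tensor D V) phi :
  lin phi -> lin dV -> lin (act dV phi).
Proof. by move=> *; rewrite /act; lintac. Qed.

Lemma lin_conv (D : lmodType C) (dl : D -> tensor D D) phi psi :
  lin dl -> lin phi -> lin psi -> lin (conv dl phi psi).
Proof. by move=> *; rewrite /conv; lintac. Qed.

Lemma lin_cop (D : lmodType C) (dl : D -> tensor D D) : lin dl -> lin (cop dl).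
Proof. by move=> *; rewrite /cop; lintac. Qed.

Lemma lin_ptensor (D E : lmodType C) (phi : D -> C^o) (psi : E -> C^o) :
  lin phi -> lin psi -> lin (ptensor phi psi).
Proof. by move=> *; rewrite /ptensor; lintac. Qed.

Lemma ptensorE (D E : lmodType C) (phi : D -> C^o) (psi : E -> C^o) a b :
  lin phi -> lin psi -> ptensor phi psi (a ⊗ b) = phi a * psi b.
Proof. by move=> *; rewrite /ptensor tliftE //; lintac. Qed.

Lemma lin_tcoact (D E V W : lmodType C) (dV : V -> tensor D V)
    (dW : W -> tensor E W) : lin dV -> lin dW -> lin (tcoact dV dW).
Proof. by move=> *; rewrite /tcoact; lintac. Qed.

Lemma tcoactE (D E V W U : lmodType C) (dV : V -> tensor D V)
    (dW : W -> tensor E W) (F : tensor D E -> tensor V W -> U) v w :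
  lin dV -> lin dW -> bil F ->
  tlift F (tcoact dV dW (v ⊗ w))
  = \sw_(a, v0 <- dV v) \sw_(b, w0 <- dW w) F (a ⊗ b) (v0 ⊗ w0).
Proof.
move=> lV lW bF; rewrite /tcoact tliftE; last by lintac.
rewrite tlift_tlift //; apply: eq_tlift => a v0.
by rewrite tlift_tlift //; apply: eq_tlift => b w0; rewrite tliftE.
Qed.

Lemma copE (D U : lmodType C) (dl : D -> tensor D D) (F : D -> D -> U) d :
  bil F -> tlift F (cop dl d) = \sw_(a, b <- dl d) F b a.
Proof. by move=> bF; rewrite /cop tlift_tlift //; apply: eq_tlift => a b; rewrite tliftE. Qed.

Section Comodule.
Variables (D V : lmodType C) (dl : D -> tensor D D) (ep : D -> C^o)
  (dV : V -> tensor D V).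
Hypotheses (cD : coalg dl ep) (cV : comod dl ep dV).

Let lD : lin dl. Proof. by case: cD => _ []. Qed.
Let lV : lin dV. Proof. by case: cV. Qed.

Lemma act_counit v : act dV ep v = v.
Proof. by case: cV => _ _; apply. Qed.

(** The action is a right action for convolution: the functional applied last
    reads the coaction leg closest to the module. *)
Lemma act_act phi psi v : lin phi -> lin psi ->
  act dV phi (act dV psi v) = act dV (conv dl psi phi) v.
Proof.
move=> lp lq; rewrite {2}/act tlift_lin; last exact: lin_act lp lV.
under eq_tlift => a y do rewrite (linZ (lin_act lp lV)) /act (tlift_lin _ _ (@lin_scaler _ _ _)).
have [_ ca _] := cV; rewrite -ca; last by lintac.
apply: eq_tlift => x v0; rewrite /conv.
rewrite (tlift_lin (U:=C^o) _ _ (lin_scalel v0)).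
by apply: eq_tlift => a b; rewrite scalerA.
Qed.

(** Acting on v changes the outermost coaction leg from the left. *)
Lemma coact_actl (U : lmodType C) (F : D -> V -> U) phi v : lin phi -> bil F ->
  tlift F (dV (act dV phi v)) = \sw_(a, v0 <- dV v) F (act dl phi a) v0.
Proof.
move=> lp bF; have [_ ca _] := cV.
transitivity (\sw_(a, y <- dV v) \sw_(b, v0 <- dV y) ((phi a : C) *: F b v0)).
  rewrite {1}/act tlift_lin //; rewrite tlift_tlift //.
  apply: eq_tlift => a y; rewrite (linZ lV) (linZ (lin_tlift bF)).
  by rewrite (tlift_lin _ _ (@lin_scaler _ _ _)).
case: bF => b1 b2.
rewrite -ca; last by lintac.
apply: eq_tlift => x v0; rewrite /act (tlift_lin _ _ (b2 v0)).
by apply: eq_tlift => a b; rewrite (linZ (b2 v0)).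
Qed.

(** The middle leg of (Δ ⊗ id) δ = (id ⊗ δ) δ can be read off from either side;
    this lets two twists meet and cancel. *)
Lemma coact_actr (U : lmodType C) (F : D -> V -> U) phi v : lin phi -> bil F ->
  \sw_(a, v0 <- dV v) F (act (cop dl) phi a) v0
  = \sw_(a, v0 <- dV v) F a (act dV phi v0).
Proof.
move=> lp bF; have [_ ca _] := cV; case: bF => b1 b2.
transitivity (\sw_(x, v0 <- dV v) \sw_(a, b <- dl x) ((phi b : C) *: F a v0)).
  apply: eq_tlift => x v0; rewrite /act copE; last by lintac.
  by rewrite (tlift_lin _ _ (b2 v0)); apply: eq_tlift => a b; rewrite (linZ (b2 v0)).
rewrite ca; last by lintac.
apply: eq_tlift => a y; rewrite /act (tlift_lin _ _ (b1 a)).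
by apply: eq_tlift => b v0; rewrite (linZ (b1 a)).
Qed.

End Comodule.

Section Convolution.
Variables (D : lmodType C) (dl : D -> tensor D D) (ep : D -> C^o).
Hypotheses (cD : coalg dl ep).
Let lD : lin dl. Proof. by case: cD => _ []. Qed.
Let lep : lin ep. Proof. by case: cD. Qed.
Let ca := let: And3 _ (And3 _ h _) _ := cD in h.

Lemma convA phi psi chi : lin phi -> lin psi -> lin chi ->
  conv dl (conv dl phi psi) chi = conv dl phi (conv dl psi chi).
Proof.
move=> l1 l2 l3; apply/funext => d; rewrite /conv.
transitivity (\sw_(x, c <- dl d) \sw_(a, b <- dl x) (phi a * psi b * chi c : C^o)).
  by apply: eq_tlift => x c; rewrite (tlift_lin (U:=C^o) _ _ (lin_mull _)).
rewrite ca; last by lintac.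
apply: eq_tlift => a y; rewrite (tlift_lin (U:=C^o) _ _ (lin_mulr _)).
by apply: eq_tlift => b c; rewrite mulrA.
Qed.

Lemma conv1l phi : lin phi -> conv dl ep phi = phi.
Proof.
move=> lp; apply/funext => d; rewrite /conv -[in RHS](act_counit (let: And3 _ h _ := cD in h) d).
by rewrite (tlift_lin _ _ lp); apply: eq_tlift => a b; rewrite (linZ lp).
Qed.

Lemma conv1r phi : lin phi -> conv dl phi ep = phi.
Proof.
move=> lp; apply/funext => d; rewrite /conv; case: (cD) => _ _ /(_ d) {2}<-.
rewrite (tlift_lin _ _ lp); apply: eq_tlift => a b; rewrite (linZ lp).
by rewrite mulrC.
Qed.

(** Transports an identity between products of functionals to the identity
    between their inverses, without a second computation. *)
Lemma conv_inv_uniq phi psi phi' psi' :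
  lin phi -> lin psi -> lin phi' -> lin psi' ->
  conv dl psi phi = ep -> conv dl phi' psi' = ep -> phi = phi' -> psi = psi'.
Proof.
move=> l1 l2 l3 l4 h1 h2 e; rewrite -(conv1r l2) -h2 -convA // -e h1.
by rewrite conv1l.
Qed.

Lemma coalg_cop : coalg (cop dl) ep.
Proof.
have [_ [_ _ cl] cr] := cD; split=> //; last first.
  by move=> a; rewrite copE ?cl //; lintac.
split; first exact: lin_cop; last first.
  by move=> a; rewrite copE ?cr //; lintac.
move=> U F [h1 h2 h3] v; rewrite copE; last by split=> *; lintac; apply: lin_cop.
rewrite copE; last by split=> *; lintac; apply: lin_cop.
under eq_tlift => a b do rewrite copE //.
under [RHS]eq_tlift => a b do rewrite copE //.
by rewrite -(ca (F := fun x y z => F z y x)) //; lintac.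
Qed.

Lemma conv_cop phi psi : lin phi -> lin psi -> conv (cop dl) phi psi = conv dl psi phi.
Proof.
move=> l1 l2; apply/funext => d; rewrite /conv (copE (U:=C^o)); last by lintac.
by apply: eq_tlift => a b; rewrite mulrC.
Qed.

(** One leg is consumed on each side of d, so coassociativity suffices. *)
Lemma act_cop phi psi d : lin phi -> lin psi ->
  act (cop dl) psi (act dl phi d) = act dl phi (act (cop dl) psi d).
Proof.
move=> l1 l2; rewrite {1}/act copE; last by lintac.
rewrite (coact_actl (let: And3 _ h _ := cD in h)) //; last by lintac.
rewrite [act (cop dl) psi d]/act copE; last by lintac.
have la : lin (act dl phi) by rewrite /act; lintac.
rewrite (tlift_lin _ _ la).
by apply: eq_tlift => a b; rewrite (linZ la).
Qed.
End Convolution.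

Section Morphism.
Variables (D E V W : lmodType C) (dD : D -> tensor D D) (dE : E -> tensor E E)
  (dV : V -> tensor D V) (dW : W -> tensor E W).
Variables (f : D -> E) (h : V -> W).
Hypotheses (lf : lin f) (lh : lin h).

(** Pulls a functional back through a colinear map; this is what collects all
    functionals of an iterated deformed product in one place. *)
Lemma act_morph phi v : lin phi -> cmorph f h dV dW ->
  act dW phi (h v) = h (act dV (fun d => phi (f d)) v).
Proof.
move=> lp m; rewrite /act m tlift_tlift; last by lintac.
rewrite (tlift_lin _ _ lh); apply: eq_tlift => a v0.
by rewrite tliftE ?(linZ lh) //; lintac.
Qed.

Lemma conv_morph phi psi : lin phi -> lin psi -> cmorph f f dD dE ->
  (fun d => conv dE phi psi (f d))
  = conv dD (fun d => phi (f d)) (fun d => psi (f d)).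
Proof.
move=> lp lq m; apply/funext => d.
rewrite /conv m (tlift_tlift (U:=C^o)); last by lintac.
by apply: eq_tlift => a b; rewrite (tliftE (U:=C^o)) //; lintac.
Qed.

Lemma cmorph_cop : cmorph f f dD dE -> cmorph f f (cop dD) (cop dE).
Proof.
move=> m d; rewrite {1}/cop m tlift_tlift; last by lintac.
rewrite copE; last by lintac.
by apply: eq_tlift => a b; rewrite tliftE //; lintac.
Qed.
End Morphism.

Section Tensor.
Variables (D E V W : lmodType C) (dD : D -> tensor D D) (dE : E -> tensor E E)
  (epD : D -> C^o) (epE : E -> C^o)
  (dV : V -> tensor D V) (dW : W -> tensor E W).
Hypotheses (cD : coalg dD epD) (cE : coalg dE epE).
Hypotheses (cV : comod dD epD dV) (cW : comod dE epE dW).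

Let lD : lin dD. Proof. by case: cD => _ []. Qed.
Let lE : lin dE. Proof. by case: cE => _ []. Qed.
Let leD : lin epD. Proof. by case: cD. Qed.
Let leE : lin epE. Proof. by case: cE. Qed.
Let lV : lin dV. Proof. by case: cV. Qed.
Let lW : lin dW. Proof. by case: cW. Qed.

Lemma act_tensor phi v w : lin phi ->
  act (tcoact dV dW) phi (v ⊗ w)
  = \sw_(a, v0 <- dV v) \sw_(b, w0 <- dW w) ((phi (a ⊗ b) : C) *: (v0 ⊗ w0)).
Proof. by move=> lp; rewrite /act tcoactE //; lintac. Qed.

(** With psi the counit this extends an action on one tensor factor to the whole
    product, as in the two lemmas below. *)
Lemma act_ptensor phi psi v w : lin phi -> lin psi ->
  act (tcoact dV dW) (ptensor phi psi) (v ⊗ w) = act dV phi v ⊗ act dW psi w.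
Proof.
move=> lp lq; rewrite act_tensor; last exact: lin_ptensor.
rewrite {1}/act (tlift_lin _ _ (lin_tpurel _)); apply: eq_tlift => a v0.
rewrite /act (tlift_lin _ _ (lin_tpurer _)); apply: eq_tlift => b w0.
rewrite ptensorE // (linZ (lin_tpurer _)) (linZ (lin_tpurel _)) scalerA.
by rewrite mulrC.
Qed.

Lemma act_tensorl phi v w : lin phi ->
  act dV phi v ⊗ w = act (tcoact dV dW) (ptensor phi epE) (v ⊗ w).
Proof. by move=> lp; rewrite act_ptensor // (act_counit cW). Qed.

Lemma act_tensorr psi v w : lin psi ->
  v ⊗ act dW psi w = act (tcoact dV dW) (ptensor epD psi) (v ⊗ w).
Proof. by move=> lp; rewrite act_ptensor // (act_counit cV). Qed.

Lemma tcoact_comod : comod (tcoact dD dE) (ptensor epD epE) (tcoact dV dW).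
Proof.
have lT := lin_tcoact lV lW; have lTD := lin_tcoact lD lE.
split=> //; last first.
  move=> t; have lp := lin_ptensor leD leE.
  rewrite -[LHS]/(act (tcoact dV dW) (ptensor epD epE) t).
  apply: (tensor_lin_ext (h := fun x => x) _ (lin_act lp lT)) => // v w.
  by rewrite act_ptensor // (act_counit cV) (act_counit cW).
move=> U F tF; have [F1 F2 F3] := tF.
pose L t := \sw_(x, v0 <- tcoact dV dW t) \sw_(a, b <- tcoact dD dE x) F a b v0.
pose R t := \sw_(a, y <- tcoact dV dW t) \sw_(b, v0 <- tcoact dV dW y) F a b v0.
move=> t; apply: (@tensor_lin_ext _ _ _ _ L R).
- by rewrite /L; lintac.
- by rewrite /R; lintac.
move=> v w; rewrite /L /R !tcoactE //; [|by lintac|by lintac].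
have [_ caV _] := cV; have [_ caW _] := cW.
transitivity (\sw_(x, v0 <- dV v) \sw_(a, b <- dD x)
  \sw_(y, w0 <- dW w) \sw_(c, d <- dE y) F (a ⊗ c) (b ⊗ d) (v0 ⊗ w0)).
  apply: eq_tlift => x v0; rewrite tlift_swap; apply: eq_tlift => y w0.
  by rewrite tcoactE //; lintac.
rewrite (caV _ (fun a b v0 => \sw_(y, w0 <- dW w) \sw_(c, d <- dE y) F (a ⊗ c) (b ⊗ d) (v0 ⊗ w0))); last by lintac.
apply: eq_tlift => a y.
transitivity (\sw_(b, v0 <- dV y) \sw_(c, z <- dW w)
  \sw_(d, w0 <- dW z) F (a ⊗ c) (b ⊗ d) (v0 ⊗ w0)).
  by apply: eq_tlift => b v0; rewrite caW //; lintac.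
rewrite tlift_swap; apply: eq_tlift => c z.
by rewrite tcoactE //; lintac.
Qed.
End Tensor.

Section TensorCoalgebra.
Variables (D E : lmodType C) (dD : D -> tensor D D) (dE : E -> tensor E E)
  (epD : D -> C^o) (epE : E -> C^o).
Hypotheses (cD : coalg dD epD) (cE : coalg dE epE).
Let lD : lin dD. Proof. by case: cD => _ []. Qed.
Let lE : lin dE. Proof. by case: cE => _ []. Qed.
Let leD : lin epD. Proof. by case: cD. Qed.
Let leE : lin epE. Proof. by case: cE. Qed.

(** The tensor product of coalgebras commutes with taking co-opposites, so right
    actions on tensors are computed factor by factor as well. *)
Lemma cop_tcoact t : cop (tcoact dD dE) t = tcoact (cop dD) (cop dE) t.
Proof.
have lT := lin_tcoact lD lE.
have lT' := lin_tcoact (lin_cop lD) (lin_cop lE).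
apply: (tensor_lin_ext _ (lin_cop lT) lT') => d e.
rewrite {1}/cop tcoactE //; last by lintac.
rewrite /tcoact tliftE; last by split=> *; rewrite /cop; lintac.
rewrite copE; last by rewrite /cop; lintac.
by apply: eq_tlift => a b; rewrite copE //; lintac.
Qed.

Lemma coalg_tensor : coalg (tcoact dD dE) (ptensor epD epE).
Proof.
have cD' : comod dD epD dD by case: cD.
have cE' : comod dE epE dE by case: cE.
have lp := lin_ptensor leD leE.
have lT := lin_tcoact lD lE.
split=> //; first exact: tcoact_comod.
move=> t; transitivity (act (cop (tcoact dD dE)) (ptensor epD epE) t).
  by rewrite /act copE //; lintac.
rewrite /act cop_tcoact -/(act _ _ _).
have [_ coD _] := coalg_cop cD; have [_ coE _] := coalg_cop cE.
apply: (tensor_lin_ext (h := fun x => x) _ (lin_act lp (lin_tcoact (lin_cop lD) (lin_cop lE)))) => // d e.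
by rewrite (act_ptensor coD coE) // (act_counit coD) (act_counit coE).
Qed.
End TensorCoalgebra.

End Coalgebra.

(** * Maps between tensor comodules *)

Section TensorMaps.
Variable C : numClosedFieldType.

Definition tmap (V W V' W' : lmodType C) (f : V -> V') (h : W -> W') :
  tensor V W -> tensor V' W' := tlift (fun v w => f v ⊗ h w).

Definition tassoc (V W Z : lmodType C) :
  tensor (tensor V W) Z -> tensor V (tensor W Z) :=
  tlift (fun t z => \sw_(v, w <- t) (v ⊗ (w ⊗ z))).

Lemma lin_tmap (V W V' W' : lmodType C) (f : V -> V') (h : W -> W') :
  lin f -> lin h -> lin (tmap f h).
Proof. by move=> *; rewrite /tmap; lintac. Qed.

Lemma tmapE (V W V' W' : lmodType C) (f : V -> V') (h : W -> W') v w :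
  lin f -> lin h -> tmap f h (v ⊗ w) = f v ⊗ h w.
Proof. by move=> *; rewrite /tmap tliftE //; lintac. Qed.

Lemma lin_tassoc (V W Z : lmodType C) : lin (@tassoc V W Z).
Proof. by rewrite /tassoc; lintac. Qed.

Lemma tassocE (V W Z : lmodType C) (v : V) (w : W) (z : Z) :
  tassoc ((v ⊗ w) ⊗ z) = v ⊗ (w ⊗ z).
Proof. by rewrite /tassoc tliftE ?tliftE //; lintac. Qed.

Lemma tensor3_ext (V W Z U : lmodType C) (f h : tensor (tensor V W) Z -> U) t :
  lin f -> lin h -> (forall v w z, f ((v ⊗ w) ⊗ z) = h ((v ⊗ w) ⊗ z)) -> f t = h t.
Proof.
move=> lf lh e; apply: tensor_lin_ext => // s z.
apply: (tensor_lin_ext (f := fun s => f (s ⊗ z)) (h := fun s => h (s ⊗ z))) => //; lintac.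
Qed.

Lemma cmorph_id (D V : lmodType C) (dV : V -> tensor D V) : cmorph id id dV dV.
Proof. by move=> v; rewrite tlift_eta. Qed.

Section TmapMorph.
Variables (D D' V V' E E' W W' : lmodType C) (f : D -> D') (f' : E -> E')
  (h : V -> V') (h' : W -> W') (dV : V -> tensor D V) (dV' : V' -> tensor D' V')
  (dW : W -> tensor E W) (dW' : W' -> tensor E' W').
Hypotheses (lf : lin f) (lf' : lin f') (lh : lin h) (lh' : lin h').
Hypotheses (lV : lin dV) (lV' : lin dV') (lW : lin dW) (lW' : lin dW').

Lemma cmorph_tmap : cmorph f h dV dV' -> cmorph f' h' dW dW' ->
  cmorph (tmap f f') (tmap h h') (tcoact dV dW) (tcoact dV' dW').
Proof.
move=> m m'.
have lt := lin_tcoact lV lW; have lt' := lin_tcoact lV' lW'.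
have lm := lin_tmap lf lf'; have lm' := lin_tmap lh lh'.
move=> t; apply: (tensor_lin_ext (f := fun t => tcoact dV' dW' (tmap h h' t))
  (h := fun t => \sw_(a, v0 <- tcoact dV dW t) (tmap f f' a ⊗ tmap h h' v0))) => [||v w].
- by lintac.
- by lintac.
rewrite tmapE // tcoactE //; last by lintac.
rewrite /tcoact tliftE; last by lintac.
rewrite m tlift_tlift; last by lintac.
apply: eq_tlift => a v0; rewrite tliftE; last by lintac.
rewrite m' tlift_tlift; last by lintac.
by apply: eq_tlift => b w0; rewrite tliftE ?tmapE //; lintac.
Qed.
End TmapMorph.

Lemma cmorph_tassoc (D V E W F Z : lmodType C)
  (dV : V -> tensor D V) (dW : W -> tensor E W) (dZ : Z -> tensor F Z) :
  lin dV -> lin dW -> lin dZ ->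
  cmorph (@tassoc D E F) (@tassoc V W Z)
    (tcoact (tcoact dV dW) dZ) (tcoact dV (tcoact dW dZ)).
Proof.
move=> lV lW lZ.
have lt := lin_tcoact lV lW; have lt' := lin_tcoact lW lZ.
have lt2 := lin_tcoact lt lZ; have lt2' := lin_tcoact lV lt'.
have la := @lin_tassoc; move=> t.
apply: (tensor3_ext (f := fun t => tcoact dV (tcoact dW dZ) (tassoc t))
  (h := fun t => \sw_(a, v0 <- tcoact (tcoact dV dW) dZ t) (tassoc a ⊗ tassoc v0))) => [||v w z].
- by lintac.
- by lintac.
rewrite tassocE tcoactE //; last by lintac.
rewrite tcoactE //; last by lintac.
rewrite /tcoact tliftE; last by lintac.
apply: eq_tlift => a v0; rewrite tliftE; last by lintac.
rewrite tlift_tlift; last by lintac.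
apply: eq_tlift => b w0; rewrite tlift_tlift; last by lintac.
by apply: eq_tlift => c z0; rewrite tliftE ?tassocE //; lintac.
Qed.

Lemma conv_ptensor (D E : lmodType C) (dD : D -> tensor D D) (dE : E -> tensor E E)
    (a c : D -> C^o) (b d : E -> C^o) :
  lin dD -> lin dE -> lin a -> lin b -> lin c -> lin d ->
  conv (tcoact dD dE) (ptensor a b) (ptensor c d)
  = ptensor (conv dD a c) (conv dE b d).
Proof.
move=> lD lE la lb lc ld; apply/funext => t.
have lt := lin_tcoact lD lE.
have [lab lcd] := (lin_ptensor la lb, lin_ptensor lc ld).
have [lac lbd] := (lin_conv lD la lc, lin_conv lE lb ld).
apply: (tensor_lin_ext (U := C^o)) => [||x y]; [exact: lin_conv|exact: lin_ptensor|].
rewrite /conv (tcoactE (U := C^o)) //; last by lintac.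
rewrite ptensorE // /conv (tlift_lin (U:=C^o) _ _ (lin_mull _)).
apply: eq_tlift => x1 x2; rewrite (tlift_lin (U:=C^o) _ _ (lin_mulr _)).
by apply: eq_tlift => y1 y2; rewrite !ptensorE // mulrACA.
Qed.

End TensorMaps.

#[export] Hint Resolve lin_tassoc : lindb.

(** * Two-sided twists of a coalgebra *)

Section Twist.
Variable C : numClosedFieldType.

(** The twist phi ▷ d ◁ psi, that is phi(d1) d2 psi(d3). *)
Definition tw (D : lmodType C) (dl : D -> tensor D D) (phi psi : D -> C^o) (d : D) : D :=
  act dl phi (act (cop dl) psi d).

Section TwistCoalgebra.
Variables (D : lmodType C) (dl : D -> tensor D D) (ep : D -> C^o).
Hypothesis cD : coalg dl ep.
Let lD : lin dl. Proof. by case: cD => _ []. Qed.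
Let lep : lin ep. Proof. by case: cD. Qed.
Let lc : lin (cop dl). Proof. exact: lin_cop. Qed.
Let mD : comod dl ep dl. Proof. by case: cD. Qed.
Let mc : comod (cop dl) ep (cop dl). Proof. by case: (coalg_cop cD). Qed.

Lemma lin_tw phi psi : lin phi -> lin psi -> lin (tw dl phi psi).
Proof.
move=> l1 l2; have [h1 h2] := (lin_act l1 lD, lin_act l2 lc).
by rewrite /tw; lintac.
Qed.

Lemma twE phi psi d : lin phi -> lin psi ->
  tw dl phi psi d = \sw_(d1, d' <- dl d) \sw_(d2, d3 <- dl d') ((phi d1 * psi d3 : C) *: d2).
Proof.
move=> l1 l2; have h := lin_act l2 lc.
rewrite /tw -(act_cop cD) // [act dl phi d]/act (tlift_lin _ _ h).
apply: eq_tlift => d1 d'; rewrite (linZ h) /act copE; last by lintac.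
rewrite (tlift_lin _ _ (@lin_scaler _ _ _)); apply: eq_tlift => d2 d3.
by rewrite scalerA.
Qed.

Lemma ract_conv phi psi d : lin phi -> lin psi ->
  act (cop dl) phi (act (cop dl) psi d) = act (cop dl) (conv dl phi psi) d.
Proof. by move=> l1 l2; rewrite (act_act mc) // (conv_cop dl). Qed.

(** Left functionals multiply in one order and right ones in the other. *)
Lemma tw_tw phi psi phi' psi' d : lin phi -> lin psi -> lin phi' -> lin psi' ->
  tw dl phi psi (tw dl phi' psi' d) = tw dl (conv dl phi' phi) (conv dl psi psi') d.
Proof.
move=> l1 l2 l3 l4; rewrite /tw (act_cop cD) // (act_act mD) //.
by rewrite ract_conv.
Qed.

Lemma tw1 d : tw dl ep ep d = d.
Proof. by rewrite /tw (act_counit mc) (act_counit mD). Qed.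

Lemma eps_act phi d : lin phi -> ep (act dl phi d) = phi d.
Proof.
move=> lp; have [_ _ h] := cD; rewrite -[in RHS](h d) /act.
rewrite (tlift_lin _ _ lep) (tlift_lin _ _ lp); apply: eq_tlift => a b.
by rewrite (linZ lep) (linZ lp) /GRing.scale /= mulrC.
Qed.

Lemma ract_eval phi psi d : lin phi -> lin psi ->
  phi (act (cop dl) psi d) = conv dl phi psi d.
Proof.
move=> l1 l2; rewrite /act copE; last by lintac.
rewrite (tlift_lin _ _ l1); apply: eq_tlift => a b.
by rewrite (linZ l1) /GRing.scale /= mulrC.
Qed.

Lemma eps_tw phi psi d : lin phi -> lin psi -> ep (tw dl phi psi d) = conv dl phi psi d.
Proof. by move=> l1 l2; rewrite /tw eps_act // ract_eval. Qed.

Lemma coact_ract (U : lmodType C) (F : D -> D -> U) phi d : lin phi -> bil F ->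
  tlift F (dl (act (cop dl) phi d)) = \sw_(a, b <- dl d) F a (act (cop dl) phi b).
Proof.
move=> l1 [b1 b2]; have h := lin_act l1 lc.
have := coact_actl mc d l1 (F := fun a b => F b a).
rewrite copE; last by lintac.
by move=> ->; [rewrite copE //; lintac | lintac].
Qed.

(** Between the two halves of the coproduct psi and phi may be inserted, since
    their product is the counit. *)
Lemma tw_coprod (U : lmodType C) (F : D -> D -> U) phi psi d :
  lin phi -> lin psi -> conv dl psi phi = ep -> bil F ->
  tlift F (dl (tw dl phi psi d))
  = \sw_(a, b <- dl d) F (tw dl phi psi a) (tw dl phi psi b).
Proof.
move=> l1 l2 e [b1 b2].
have [h1 h2] := (lin_act l1 lD, lin_act l2 lc); have ht := lin_tw l1 l2.
rewrite /tw (coact_actl mD) //.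
rewrite (coact_ract (F := fun a b => F (act dl phi a) b)) //; last by lintac.
pose G a b := F (tw dl phi psi a) (act (cop dl) psi b).
have e1 := coact_actr mD (F := G) d l1.
transitivity (\sw_(a, b <- dl d) G (act (cop dl) phi a) b).
  by apply: eq_tlift => a b; rewrite /G /tw ract_conv // e (act_counit mc).
rewrite e1; last by rewrite /G; lintac.
by apply: eq_tlift => a b; rewrite /G (act_cop cD).
Qed.

End TwistCoalgebra.

Lemma tw_morph (D E : lmodType C) (dD : D -> tensor D D) (dE : E -> tensor E E) (f : D -> E) phi psi d :
  lin dD -> lin dE -> lin f -> lin phi -> lin psi -> cmorph f f dD dE ->
  tw dE phi psi (f d) = f (tw dD (fun d => phi (f d)) (fun d => psi (f d)) d).
Proof.
move=> lD lE lf l1 l2 m; rewrite /tw (act_morph lf _ l2 (cmorph_cop lf m)).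
by rewrite (act_morph lf _ l1 m).
Qed.

Lemma tw_ptensor (D E : lmodType C) (dD : D -> tensor D D) (dE : E -> tensor E E)
    (epD : D -> C^o) (epE : E -> C^o) (a c : D -> C^o) (b d : E -> C^o) x y :
  coalg dD epD -> coalg dE epE -> lin a -> lin b -> lin c -> lin d ->
  tw (tcoact dD dE) (ptensor a b) (ptensor c d) (x ⊗ y) = tw dD a c x ⊗ tw dE b d y.
Proof.
move=> cD cE la lb lc ld; rewrite /tw.
have [_ mcD _] := coalg_cop cD; have [_ mcE _] := coalg_cop cE.
have [_ mD _] := cD; have [_ mE _] := cE.
rewrite [act (cop _) _ _](_ : _ = act (tcoact (cop dD) (cop dE)) (ptensor c d) (x ⊗ y)); last first.
  by rewrite /act (cop_tcoact cD cE).
by rewrite (act_ptensor mcD mcE) // (act_ptensor mD mE).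
Qed.
End Twist.

(** * Iterated coproducts *)

Section Sweedler.
Variables (C : numClosedFieldType) (A : lmodType C).
Variables (dl : A -> tensor A A) (ep : A -> C^o).
Hypothesis cA : coalg dl ep.
Let lA : lin dl. Proof. by case: cA => _ []. Qed.
Let lep : lin ep. Proof. by case: cA. Qed.
Let coassoc := let: And3 _ (And3 _ h _) _ := cA in h.

(** The Sweedler sum of F [:: a_(1); ...; a_(n)].  Inside F the leg a_(i+1) is
    written l`_i; for n = 0 the sum is the counit. *)
Fixpoint sw (U : lmodType C) (n : nat) (a : A) (F : seq A -> U) : U :=
  if n is n'.+1
  then \sw_(x, y <- dl a) sw n' y (fun l => F (x :: l))
  else (ep a : C) *: F [::].

(** Linearity in each of the first n entries.  The tail l is arbitrary because
    only finitely many entries of it are ever read. *)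
Fixpoint mlin (U : lmodType C) (n : nat) (F : seq A -> U) : Prop :=
  if n is n'.+1
  then (forall l, lin (fun x => F (x :: l))) /\ forall x, mlin n' (fun l => F (x :: l))
  else True.

Arguments sw {U} n%_N a F.
Arguments mlin {U} n%_N F.

Lemma lin_sw_body (V U : lmodType C) n a (F : V -> seq A -> U) :
  (forall l, size l = n -> lin (fun x => F x l)) -> lin (fun x => sw n a (F x)).
Proof.
elim: n a F => [|n IH] a F h /=; first by apply: lin_comp (lin_scaler _) (h _ _).
by apply: lin_tlift_body => v w; apply: IH => l sl; apply: h; rewrite /= sl.
Qed.

Lemma lin_sw (U : lmodType C) n (F : seq A -> U) :
  mlin n F -> lin (fun a => sw n a F).
Proof.
elim: n F => [|n IH] F /=; first by move=> _; lintac.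
case=> h1 h2; apply: (lin_comp (h := tlift _)) => //; apply: lin_tlift; split=> x.
  exact: IH.
by apply: lin_sw_body => l _.
Qed.

Lemma eq_sw (U : lmodType C) n a (F G : seq A -> U) :
  (forall l, size l = n -> F l = G l) -> sw n a F = sw n a G.
Proof.
elim: n a F G => [|n IH] a F G h /=; first by rewrite h.
by apply: eq_tlift => x y; apply: IH => l sl; apply: h; rewrite /= sl.
Qed.

Lemma sw_map (U U' : lmodType C) (h : U -> U') n a (F : seq A -> U) :
  lin h -> h (sw n a F) = sw n a (fun l => h (F l)).
Proof.
move=> lh; elim: n a F => [|n IH] a F /=; first by rewrite (linZ lh).
by rewrite (tlift_lin _ _ lh); apply: eq_tlift => x y; rewrite IH.
Qed.

Lemma sw_tlift (V W U : lmodType C) n a (t : tensor V W) (F : seq A -> V -> W -> U) :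
  sw n a (fun l => tlift (F l) t) = tlift (fun v w => sw n a (fun l => F l v w)) t.
Proof.
elim: n a F => [|n IH] a F /=; first by rewrite (tlift_lin _ _ (@lin_scaler _ _ _)).
by under eq_tlift => x y do rewrite IH; rewrite tlift_swap.
Qed.

Lemma sw_swap (U : lmodType C) n m a b (F : seq A -> seq A -> U) :
  sw n a (fun l => sw m b (F l)) = sw m b (fun l' => sw n a (fun l => F l l')).
Proof.
elim: n a F => [|n IH] a F /=; first by rewrite (sw_map _ _ _ (@lin_scaler _ _ _)).
by under eq_tlift => x y do rewrite IH; rewrite sw_tlift.
Qed.

Lemma mlin_catl (U : lmodType C) k j (F : seq A -> U) m :
  mlin (k + j) F -> size m = k -> mlin j (fun l => F (m ++ l)).
Proof.
elim: k F m => [|k IH] F [|x m] //= [_ h] [sm].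
exact: (IH (fun l => F (x :: l))).
Qed.

Lemma mlin_catr (U : lmodType C) k j (F : seq A -> U) y :
  mlin (k + j) F -> mlin k (fun m => sw j y (fun l => F (m ++ l))).
Proof.
elim: k F => [|k IH] F //= [h1 h2]; split=> [l|x]; first by apply: lin_sw_body => l' _; exact: h1.
exact: (IH (fun l => F (x :: l))).
Qed.

Lemma sw_cat (U : lmodType C) k j a (F : seq A -> U) : mlin (k + j) F ->
  sw (k + j) a F = \sw_(x, y <- dl a) sw k x (fun m => sw j y (fun l => F (m ++ l))).
Proof.
elim: k a F => [|k IH] a F mF /=.
  by rewrite -[in LHS](act_counit (let: And3 _ h _ := cA in h) a) /act
    (tlift_lin _ _ (lin_sw mF)); apply: eq_tlift => x y; rewrite (linZ (lin_sw mF)).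
case: mF => h1 h2.
under eq_tlift => x y do rewrite (IH _ _ (h2 _)).
rewrite -coassoc //; split=> x y.
- by apply: lin_sw_body => l _; apply: lin_sw_body => l' _; apply: h1.
- by apply: lin_sw; apply: (mlin_catr (F := fun l => F (x :: l))); apply: h2.
by apply: lin_sw_body => l sl; apply: lin_sw; apply: (mlin_catl (F := fun l => F (x :: l))) sl; apply: h2.
Qed.

(** This is how a Sweedler computation proceeds: an identity with a block of k
    adjacent legs on one side and k' on the other may be applied to that block,
    with i legs before it and j after it left alone. *)
Lemma sw_local (U : lmodType C) i k k' j a (F G : seq A -> U) :
  mlin (i + (k + j)) F -> mlin (i + (k' + j)) G ->
  (forall l m x, size l = i -> size m = j ->
     sw k x (fun z => F (l ++ z ++ m)) = sw k' x (fun z => G (l ++ z ++ m))) ->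
  sw (i + (k + j)) a F = sw (i + (k' + j)) a G.
Proof.
move=> mF mG h; rewrite !sw_cat //; apply: eq_tlift => x y.
apply: eq_sw => l sl.
rewrite !sw_cat; [|exact: mlin_catl sl|exact: mlin_catl sl].
apply: eq_tlift => x' y'; rewrite sw_swap [RHS]sw_swap.
by apply: eq_sw => m sm; apply: h.
Qed.

Lemma sw0E (U : lmodType C) a (F : seq A -> U) : sw 0 a F = (ep a : C) *: F [::].
Proof. by []. Qed.

Lemma sw1E (U : lmodType C) a (F : seq A -> U) : mlin 1 F -> sw 1 a F = F [:: a].
Proof.
case=> h _ /=; case: cA => _ _ /(_ a) {2}<-; rewrite (tlift_lin _ _ (h [::])).
by apply: eq_tlift => x y; rewrite (linZ (h [::])).
Qed.

Lemma sw2E (U : lmodType C) a (F : seq A -> U) : mlin 2 F ->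
  sw 2 a F = \sw_(x, y <- dl a) F [:: x; y].
Proof. by case=> h1 h2 /=; apply: eq_tlift => x y; rewrite -[LHS]/(sw 1 y (fun l => F (x :: l))) sw1E. Qed.

Lemma sw3E (U : lmodType C) a (F : seq A -> U) : mlin 3 F ->
  sw 3 a F = \sw_(x, z <- dl a) \sw_(y, x' <- dl x) F [:: y; x'; z].
Proof.
move=> mF; rewrite (sw_cat (k := 2) (j := 1)) //; apply: eq_tlift => x z.
rewrite sw2E; last exact: (mlin_catr (k := 2) (j := 1)).
by apply: eq_tlift => y x'; rewrite sw1E //; exact: (mlin_catl (k := 2) (j := 1)).
Qed.

Lemma sw3rE (U : lmodType C) a (F : seq A -> U) : mlin 3 F ->
  sw 3 a F = \sw_(x, y <- dl a) \sw_(z, x' <- dl y) F [:: x; z; x'].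
Proof.
by case=> _ m; apply: eq_tlift => x y; rewrite -[LHS]/(sw 2 y (fun l => F (x :: l))) sw2E.
Qed.

(** Three consecutive blocks are the iterated coproducts of three legs; used to
    recognize an identity in three variables inside a longer sum. *)
Lemma sw_cat3 (U : lmodType C) i j k a (F : seq A -> U) : mlin (i + (j + k)) F ->
  sw (i + (j + k)) a F
  = sw 3 a (fun l => sw i l`_0 (fun l0 => sw j l`_1 (fun l1 => sw k l`_2 (fun l2 =>
      F (l0 ++ (l1 ++ l2)))))).
Proof.
move=> mF; rewrite sw_cat //; apply: eq_tlift => x y.
transitivity (sw i x (fun l0 => \sw_(x', z <- dl y) sw j x' (fun l1 => sw k z (fun l2 =>
  F (l0 ++ (l1 ++ l2)))))).
  by apply: eq_sw => l sl; rewrite sw_cat //; exact: mlin_catl sl.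
rewrite sw_tlift; apply: eq_tlift => x' z.
rewrite -[RHS]/(sw 1 z (fun l => sw i x (fun l0 => sw j x' (fun l1 => sw k l`_0 (fun l2 =>
  F (l0 ++ (l1 ++ l2))))))) sw1E //; split=> // l /=.
apply: lin_sw_body => l0 s0; apply: lin_sw_body => l1 s1; apply: lin_sw.
by apply: (mlin_catl (F := fun l => F (l0 ++ l))) s1; apply: mlin_catl s0.
Qed.

End Sweedler.

Arguments sw {C A} dl ep {U} n%_N a F.
Arguments mlin {C A U} n%_N F.

(* [lintac], extended to multilinearity in the legs and to iterated coproducts,
   which are linear in their argument and in any parameter of the summand. *)
Ltac swlin :=
  cbn [nth cat];
  repeat first
  [ match goal with
    | |- @mlin ?C ?A ?U ?n ?F =>
        let m := eval compute in n in
        change (@mlin C A U m F); cbn [mlin nth cat]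
    | |- @lin ?C ?V ?U (fun x => sw ?d ?e ?n x ?F) =>
        eapply lin_sw; [eassumption|]
    | |- @lin ?C ?V ?U (fun x => sw ?d ?e ?n ?b (fun l => @?F x l)) =>
        apply: (@lin_sw_body _ _ d e V U n b F) => ? _; cbn [nth cat]
    | |- @lin ?C ?V ?U (fun x => sw ?d ?e ?n (@?f x) ?F) =>
        refine (@lin_comp C V _ U (fun b => sw d e n b F) f _ _)
    end
  | linstep ].

(* Names the entries of a list l of known length e. *)
Ltac deseq l e :=
  let u := fresh "u" in
  destruct l as [|u l];
  [try discriminate e | try discriminate e; try deseq l e].

(* Applies [sw_local] with the block sizes (i, k, k', j), names the legs u, u0 ...
   outside the block and x the leg whose coproduct is the block. *)
Ltac swlocal cA p :=
  lazymatch p with (?i, ?k, ?k', ?j) =>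
    apply: (@sw_local _ _ _ _ cA _ i k k' j) end;
  [ try by swlin | try by swlin
  | let l := fresh "l" in let m := fresh "m" in let sl := fresh "sl" in
    let sm := fresh "sm" in
    let x := fresh "x" in move=> l m x sl sm; deseq l sl; deseq m sm; clear sl sm;
    cbn [cat nth]; rewrite ?(sw2E cA) ?(sw1E cA) ?sw0E; try by swlin;
    cbn [cat nth] ].

(** * Subcomodules *)

Lemma subspace_sum (C : numClosedFieldType) (U : lmodType C) (T : set U)
    (I : eqType) (s : seq I) (F : I -> U) :
  subspace T -> (forall i, i \in s -> T (F i)) -> T (\sum_(i <- s) F i).
Proof.
move=> [T0 TD] h; rewrite big_seq; elim/big_rec: _ => // i x si Tx.
by rewrite -[F i]scale1r; apply: TD => //; apply: h.
Qed.

Lemma subspaceZ (C : numClosedFieldType) (U : lmodType C) (T : set U) c u :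
  subspace T -> T u -> T (c *: u).
Proof. by move=> [T0 TD] Tu; rewrite -[_ *: _]addr0; apply: TD. Qed.

Section TensorIn.
Variables (C : numClosedFieldType) (A V : lmodType C) (P : set V).

(** The image of A ⊗ P in A ⊗ V. *)
Definition tensor_in (t : tensor A V) : Prop :=
  exists s : seq (A * V), (forall x, x \in s -> P x.2) /\ t = \sum_(x <- s) x.1 ⊗ x.2.

Lemma tlift_tensor_in t : tensor_in t -> exists s : seq (A * V),
  (forall x, x \in s -> P x.2)
  /\ forall (U : lmodType C) (F : A -> V -> U), bil F ->
       tlift F t = \sum_(x <- s) F x.1 x.2.
Proof.
move=> [s [h e]]; exists s; split=> // U F bF.
rewrite e (lin_sum (lin_tlift bF)); apply: eq_bigr => x _.
by rewrite tliftE.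
Qed.

Lemma eq_tensor_in (U : lmodType C) (F G : A -> V -> U) t : bil F -> bil G ->
  tensor_in t -> (forall a v0, P v0 -> F a v0 = G a v0) -> tlift F t = tlift G t.
Proof.
move=> bF bG Pt h; have [s [hs e]] := tlift_tensor_in Pt.
by rewrite !e //; apply: eq_big_seq => x xs; apply: h; apply: hs.
Qed.

Lemma mem_tensor_in (U : lmodType C) (T : set U) (F : A -> V -> U) t :
  subspace T -> bil F -> tensor_in t -> (forall a v0, P v0 -> T (F a v0)) -> T (tlift F t).
Proof.
move=> sT bF Pt h; have [s [hs e]] := tlift_tensor_in Pt.
by rewrite e //; apply: subspace_sum => // x xs; apply: h; apply: hs.
Qed.

Lemma pure_tensor_in a v : P v -> tensor_in (a ⊗ v).
Proof.
by move=> Pv; exists [:: (a, v)]; split=> [x|]; rewrite ?big_seq1 // inE => /eqP ->.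
Qed.

Lemma subspace_tensor_in : subspace tensor_in.
Proof.
split; first by exists [::]; rewrite big_nil.
move=> c u v [s [hs ->]] [r [hr ->]].
exists ([seq (c *: x.1, x.2) | x <- s] ++ r); split=> [x|].
  by rewrite mem_cat => /orP [/mapP [y ys ->]|/hr //]; apply: (hs y).
rewrite big_cat big_map scaler_sumr; congr (_ + _).
by apply: eq_bigr => x _; rewrite (linZ (lin_tpurel _)).
Qed.
End TensorIn.

Lemma stable_setT (C : numClosedFieldType) (A V : lmodType C) (dV : V -> tensor A V) :
  coaction_stable dV setT.
Proof. by move=> v _; exists (repr (dV v)); split=> //; exact: tensor_sum. Qed.

(** * Deformed products on subcomodules *)

Section DeformMulStable.
Variables (C : numClosedFieldType) (A V W U : lmodType C) (g : tensor A A -> C^o).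
Variables (dV : V -> tensor A V) (dW : W -> tensor A W) (P : set V) (Q : set W).
Hypothesis lg : lin g.
Hypotheses (sP : coaction_stable dV P) (sQ : coaction_stable dW Q).

(** Coaction legs of P lie in A ⊗ P, so a deformed product on P and Q only
    depends on the values of the old one there. *)
Lemma eq_deform_mul (m n : V -> W -> U) v w : bil m -> bil n -> P v -> Q w ->
  (forall v w, P v -> Q w -> m v w = n v w) ->
  deform_mul g dV dW m v w = deform_mul g dV dW n v w.
Proof.
move=> [m1 m2] [n1 n2] Pv Qw h.
apply: (eq_tensor_in _ _ (sP Pv)); [by lintac|by lintac|] => a v0 Pv0.
apply: (eq_tensor_in _ _ (sQ Qw)); [by lintac|by lintac|] => b w0 Qw0.
by rewrite h.
Qed.

Lemma mem_deform_mul (T : set U) (m : V -> W -> U) v w : subspace T -> bil m ->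
  P v -> Q w -> (forall v w, P v -> Q w -> T (m v w)) ->
  T (deform_mul g dV dW m v w).
Proof.
move=> sT [m1 m2] Pv Qw h.
apply: (mem_tensor_in _ _ (sP Pv)) => //; [by lintac|] => a v0 Pv0.
apply: (mem_tensor_in _ _ (sQ Qw)) => //; [by lintac|] => b w0 Qw0.
by apply: subspaceZ => //; apply: h.
Qed.
End DeformMulStable.

Section DeformMulMaps.
Variables (C : numClosedFieldType) (A V W U : lmodType C) (g : tensor A A -> C^o).
Variables (dV : V -> tensor A V) (dW : W -> tensor A W).
Hypothesis lg : lin g.

Lemma deform_mulD (m n : V -> W -> U) c v w :
  deform_mul g dV dW (fun v w => m v w + c *: n v w) v w
  = deform_mul g dV dW m v w + c *: deform_mul g dV dW n v w.
Proof.
rewrite /deform_mul (tlift_lin _ _ (@lin_scaler _ _ _)) /tlift /sum_pairs -big_split.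
apply: eq_bigr => i _ /=; rewrite scaler_sumr -big_split.
by apply: eq_bigr => j _ /=; rewrite scalerDr !scalerA mulrC.
Qed.

Lemma lin_deform_mul (U' : lmodType C) (f : U -> U') (m : V -> W -> U) v w : lin f ->
  f (deform_mul g dV dW m v w) = deform_mul g dV dW (fun v w => f (m v w)) v w.
Proof.
move=> lf; rewrite /deform_mul (tlift_lin _ _ lf); apply: eq_tlift => a v0.
by rewrite (tlift_lin _ _ lf); apply: eq_tlift => b w0; rewrite (linZ lf).
Qed.

(** The coefficients of a deformed product depend on coaction legs only, and
    colinear maps do not change these. *)
Lemma deform_mul_colin (V' W' : lmodType C) (dV' : V' -> tensor A V') (dW' : W' -> tensor A W')
    (e : V -> V') (f : W -> W') (m : V' -> W' -> U) v w :
  cmorph id e dV dV' -> cmorph id f dW dW' -> bil m ->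
  deform_mul g dV' dW' m (e v) (f w)
  = deform_mul g dV dW (fun v w => m (e v) (f w)) v w.
Proof.
move=> ce cf [m1 m2]; rewrite /deform_mul ce tlift_tlift; last by lintac.
apply: eq_tlift => a v0; rewrite tliftE; last by lintac.
rewrite cf tlift_tlift; last by lintac.
by apply: eq_tlift => b w0; rewrite tliftE //; lintac.
Qed.
End DeformMulMaps.

(** * Conjugate-linear maps *)

Section ConjLinear.
Variables (C : numClosedFieldType) (W : lmodType C) (f : W -> W).
Hypothesis cf : conj_linear f.

Lemma cjD u v : f (u + v) = f u + f v.
Proof. by have := cf 1 u v; rewrite conjC1 !scale1r. Qed.
Lemma cj0 : f 0 = 0.
Proof. by apply: (addrI (f 0)); rewrite -cjD !addr0. Qed.
Lemma cjZ c u : f (c *: u) = c^* *: f u.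
Proof. by have := cf c u 0; rewrite cj0 !addr0. Qed.
Lemma cj_tlift (V1 V2 : lmodType C) (F : V1 -> V2 -> W) t :
  f (tlift F t) = tlift (fun x y => f (F x y)) t.
Proof.
rewrite /tlift /sum_pairs; elim/big_rec2: _ => [|i x y _ <-]; first exact: cj0.
by rewrite cjD.
Qed.
End ConjLinear.

Section CoassocTensor.
Variable C : numClosedFieldType.

(** Applies a trilinear map to the tensor identity that expresses
    coassociativity. *)
Lemma comod_of (A V : lmodType C) (H : hopf_data A) (dV : V -> tensor A V) :
  linear (coprod H) -> is_comodule H dV -> comod (coprod H) (counit H) dV.
Proof.
move=> l0 [l1 h1 h2]; split=> // U F tF v; have [f1 f2 f3] := tF.
have := h1 v; move/(congr1 (tlift (fun a t => tlift (fun b v0 => F a b v0) t))).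
have lH : lin (coprod H) by [].
have lV : lin dV by [].
rewrite !tlift_tlift; [|by lintac|by lintac].
have bF : bil (fun a t => tlift (fun b v0 => F a b v0) t) by lintac.
move=> e; transitivity (\sw_(x, v0 <- dV v)
  tlift (fun a t => tlift (fun b v0 => F a b v0) t) (\sw_(a, b <- coprod H x) a ⊗ (b ⊗ v0))).
  apply: eq_tlift => x v0; rewrite tlift_tlift //; apply: eq_tlift => a b.
  by rewrite tliftE // tliftE //; lintac.
by rewrite e; apply: eq_tlift => a y; rewrite tliftE.
Qed.
End CoassocTensor.

(** * Hopf algebras *)

Section Deformation.
Variables (C : numClosedFieldType) (A : lmodType C) (H : hopf_data A).
Hypothesis hH : is_hopf_algebra H.

Local Notation "x · y" := (amul H x y) (at level 40, left associativity).
Local Notation "1A" := (aone H).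
Local Notation Δ := (coprod H).
Local Notation ε := (counit H : A -> C^o).
Local Notation S := (antipode H).
Local Notation swA n := (sw Δ ε n%N).

Lemma hopf_coalg : coalg Δ ε.
Proof.
have [[_ [l1 l2 h1 h2 h3] _ _] _ _ _] := hH.
split=> //; apply: comod_of => //.
Qed.

Lemma lin_hmulr a : lin (amul H a).
Proof. by have [[[[h _] _ _ _] _ _ _] _ _ _] := hH; exact: h. Qed.
Lemma lin_hmull b : lin (fun a => a · b).
Proof. by have [[[[_ h] _ _ _] _ _ _] _ _ _] := hH; exact: h. Qed.
Lemma lin_antipode : lin S.
Proof. by have [_ [h _] _ _] := hH. Qed.
Lemma lin_coprod : lin Δ.
Proof. by case: hopf_coalg => _ []. Qed.
Lemma lin_counit : lin ε.
Proof. by case: hopf_coalg. Qed.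
Hint Resolve lin_hmulr lin_hmull lin_antipode lin_coprod lin_counit : lindb.

Lemma hmulA : associative (amul H).
Proof. by have [[[_ h _ _] _ _ _] _ _ _] := hH. Qed.
Lemma hmul1l : left_id 1A (amul H).
Proof. by have [[[_ _ h _] _ _ _] _ _ _] := hH. Qed.
Lemma hmul1r : right_id 1A (amul H).
Proof. by have [[[_ _ _ h] _ _ _] _ _ _] := hH. Qed.
Lemma coprod1 : Δ 1A = 1A ⊗ 1A.
Proof. by have [[_ _ [h _] _] _ _ _] := hH. Qed.
Lemma coprodM a b : Δ (a · b) = \sw_(a1, a2 <- Δ a) \sw_(b1, b2 <- Δ b) ((a1 · b1) ⊗ (a2 · b2)).
Proof. by have [[_ _ [_ h] _] _ _ _] := hH; exact: h. Qed.
Lemma counit1 : counit H 1A = 1.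
Proof. by have [[_ _ _ [h _]] _ _ _] := hH. Qed.
Lemma counitM a b : counit H (a · b) = counit H a * counit H b.
Proof. by have [[_ _ _ [_ h]] _ _ _] := hH; exact: h. Qed.
Lemma antipode_mul a : \sw_(a1, a2 <- Δ a) (S a1 · a2) = counit H a *: 1A.
Proof. by have [_ _ h _] := hH. Qed.
Lemma mul_antipode a : \sw_(a1, a2 <- Δ a) (a1 · S a2) = counit H a *: 1A.
Proof. by have [_ _ _ h] := hH. Qed.

(** * The antipode of a Hopf algebra *)

Lemma antipode1 : S 1A = 1A.
Proof.
have := antipode_mul 1A; rewrite coprod1 tliftE ?counit1 ?scale1r ?hmul1r //; last by lintac.
Qed.

Lemma counit_antipode a : counit H (S a) = counit H a.
Proof.
have := congr1 ε (antipode_mul a).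
rewrite (linZ lin_counit) (tlift_lin _ _ lin_counit) counit1 /GRing.scale /= mulr1 => <-.
have [_ [_ _ cl] cr] := hopf_coalg.
rewrite -[in LHS](cr a) (tlift_lin _ _ lin_antipode) (tlift_lin (U':=C^o) _ _ lin_counit).
by apply: eq_tlift => x y; rewrite counitM (linZ lin_antipode) (linZ lin_counit) mulrC.
Qed.

Lemma coprodMF (U : lmodType C) (F : A -> A -> U) a b : bil F ->
  tlift F (Δ (a · b)) = \sw_(a1, a2 <- Δ a) \sw_(b1, b2 <- Δ b) F (a1 · b1) (a2 · b2).
Proof.
move=> bF; rewrite coprodM tlift_tlift //; apply: eq_tlift => a1 a2.
by rewrite tlift_tlift //; apply: eq_tlift => b1 b2; rewrite tliftE.
Qed.

Lemma antipode_mulF (U : lmodType C) (F : A -> U) a : lin F ->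
  \sw_(a1, a2 <- Δ a) F (S a1 · a2) = counit H a *: F 1A.
Proof. by move=> lF; rewrite -(tlift_lin _ _ lF) antipode_mul (linZ lF). Qed.

Lemma mul_antipodeF (U : lmodType C) (F : A -> U) a : lin F ->
  \sw_(a1, a2 <- Δ a) F (a1 · S a2) = counit H a *: F 1A.
Proof. by move=> lF; rewrite -(tlift_lin _ _ lF) mul_antipode (linZ lF). Qed.

Lemma coassocF (U : lmodType C) (F : A -> A -> A -> U) a : trilin F ->
  \sw_(x, c <- Δ a) \sw_(y, z <- Δ x) F y z c
  = \sw_(y, x <- Δ a) \sw_(z, c <- Δ x) F y z c.
Proof. by have [_ [_ h _] _] := hopf_coalg; move=> tF; exact: h. Qed.

Lemma counitrF (U : lmodType C) (F : A -> U) a : lin F ->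
  \sw_(x, y <- Δ a) ((counit H y) *: F x) = F a.
Proof.
have [_ _ h] := hopf_coalg => lF; rewrite -[in RHS](h a) (tlift_lin _ _ lF).
by apply: eq_tlift => x y; rewrite (linZ lF).
Qed.

Lemma counitlF (U : lmodType C) (F : A -> U) a : lin F ->
  \sw_(x, y <- Δ a) ((counit H x) *: F y) = F a.
Proof.
have [_ [_ _ h] _] := hopf_coalg => lF; rewrite -[in RHS](h a) (tlift_lin _ _ lF).
by apply: eq_tlift => x y; rewrite (linZ lF).
Qed.

(** Both sides are inverse to the product of A, in the convolution algebra of maps
    from A ⊗ A to A; the sum below contains both inverses with the product in
    between. *)
Lemma antipodeM a b : S (a · b) = S b · S a.
Proof.
transitivity (\sw_(x, a3 <- Δ a) \sw_(a1, a2 <- Δ x) \sw_(x', b3 <- Δ b) \sw_(b1, b2 <- Δ x')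
  (S (a1 · b1) · (a2 · (b2 · (S b3 · S a3))))).
  apply: esym; transitivity (\sw_(a1, y <- Δ a) (counit H y *: S (a1 · b))); last first.
    by rewrite (counitrF (F := fun x => S (x · b))) //; lintac.
  rewrite coassocF; last by lintac.
  apply: eq_tlift => a1 y.
  transitivity (\sw_(a2, a3 <- Δ y) (S (a1 · b) · (a2 · S a3))); last first.
    by rewrite (mul_antipodeF (F := fun z => S (a1 · b) · z)) ?hmul1r //; lintac.
  apply: eq_tlift => a2 a3; rewrite coassocF; last by lintac.
  rewrite -[RHS](counitrF (F := fun b1 => S (a1 · b1) · (a2 · S a3))); last by lintac.
  apply: eq_tlift => b1 z.
  transitivity (\sw_(b2, b3 <- Δ z) (S (a1 · b1) · (a2 · ((b2 · S b3) · S a3)))).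
    by apply: eq_tlift => b2 b3; rewrite !hmulA.
  by rewrite (mul_antipodeF (F := fun z => S (a1 · b1) · (a2 · (z · S a3)))) ?hmul1l //; lintac.
rewrite -[RHS](counitlF (F := fun z => S b · S z)); last by lintac.
apply: eq_tlift => x a3.
rewrite tlift_swap -(counitlF (F := fun z => S z · S a3)); last by lintac.
rewrite (tlift_lin _ _ (@lin_scaler _ _ _)); apply: eq_tlift => x' b3.
transitivity (\sw_(z1, z2 <- Δ (x · x')) (S z1 · (z2 · (S b3 · S a3)))).
  rewrite coprodMF; last by lintac.
  by apply: eq_tlift => a1 a2; apply: eq_tlift => b1 b2; rewrite !hmulA.
transitivity (\sw_(z1, z2 <- Δ (x · x')) ((S z1 · z2) · (S b3 · S a3))).
  by apply: eq_tlift => z1 z2; rewrite !hmulA.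
by rewrite (antipode_mulF (F := fun z => z · (S b3 · S a3))) ?hmul1l ?counitM ?scalerA //; lintac.
Qed.

(** The product of the algebra A ⊗ A. *)
Definition tmul (s t : tensor A A) : tensor A A :=
  \sw_(x, y <- s) \sw_(x', y' <- t) ((x · x') ⊗ (y · y')).

Lemma lin_tmull t : lin (tmul^~ t). Proof. by rewrite /tmul; lintac. Qed.
Lemma lin_tmulr s : lin (tmul s). Proof. by rewrite /tmul; lintac. Qed.
Hint Resolve lin_tmull lin_tmulr : lindb.

Lemma tmulE x y x' y' : tmul (x ⊗ y) (x' ⊗ y') = (x · x') ⊗ (y · y').
Proof. by rewrite /tmul tliftE ?tliftE //; lintac. Qed.

Lemma tmulA r s t : tmul r (tmul s t) = tmul (tmul r s) t.
Proof.
apply: (tensor_lin_ext (f := fun r => tmul r (tmul s t)) (h := fun r => tmul (tmul r s) t)) => [||x y]; [by lintac|by lintac|].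
apply: (tensor_lin_ext (f := fun s => tmul _ (tmul s t)) (h := fun s => tmul (tmul _ s) t)) => [||x' y']; [by lintac|by lintac|].
apply: (tensor_lin_ext (f := fun t => tmul _ (tmul _ t)) (h := fun t => tmul _ t)) => [||x2 y2]; [by lintac|by lintac|].
by rewrite !tmulE !hmulA.
Qed.

Lemma tmul1 t : tmul t (1A ⊗ 1A) = t.
Proof.
by apply: (tensor_lin_ext (f := tmul^~ _) (h := fun t => t)) => [||x y]; rewrite ?tmulE ?hmul1r //; lintac.
Qed.
Lemma tmul1l t : tmul (1A ⊗ 1A) t = t.
Proof.
by apply: (tensor_lin_ext (f := tmul _) (h := fun t => t)) => [||x y]; rewrite ?tmulE ?hmul1l //; lintac.
Qed.

(** Both sides are inverse to the coproduct of A, in the convolution algebra of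
    maps from A to A ⊗ A. *)
Lemma coprod_antipode a : Δ (S a) = \sw_(a1, a2 <- Δ a) (S a2 ⊗ S a1).
Proof.
have cA := hopf_coalg.
pose N a := \sw_(a1, a2 <- Δ a) (S a2 ⊗ S a1).
have lN : lin N by rewrite /N; lintac.
rewrite -/(N a); transitivity (\sw_(x, a3 <- Δ a) \sw_(a1, a2 <- Δ x) tmul (tmul (Δ (S a1)) (Δ a2)) (N a3)).
  rewrite coassocF; last by lintac.
  rewrite -[LHS](counitrF (F := fun z => Δ (S z))); last by lintac.
  apply: eq_tlift => a1 y; rewrite -{1}[Δ (S a1)]tmul1.
  transitivity (tmul (Δ (S a1)) (\sw_(a2, a3 <- Δ y) tmul (Δ a2) (N a3))); last first.
    by rewrite (tlift_lin _ _ (lin_tmulr _)); apply: eq_tlift => a2 a3; rewrite tmulA.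
  rewrite -(linZ (lin_tmulr _)); congr tmul.
  transitivity (swA 4 y (fun l : seq A => (l`_0 · S l`_3) ⊗ (l`_1 · S l`_2))).
    transitivity (swA 2 y (fun l : seq A => (l`_0 · S l`_1) ⊗ 1A)).
      by rewrite (sw2E cA) ?(mul_antipodeF (F := fun z => z ⊗ 1A)) //; swlin.
    apply: esym; swlocal cA (1, 2, 0, 1)%N.
    by rewrite (mul_antipodeF (F := fun z => (u · S u0) ⊗ z)) //; lintac.
  rewrite (sw_cat cA (k := 2) (j := 2)); last by swlin.
  apply: eq_tlift => a2 a3; rewrite (sw2E cA); last by swlin.
  rewrite /tmul; apply: eq_tlift => x1 x2; rewrite (sw2E cA); last by swlin.
  by rewrite /N tlift_tlift /=; [apply: eq_tlift => y1 y2; rewrite tliftE //; lintac|lintac].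
rewrite -[RHS](counitlF (F := N)) //; apply: eq_tlift => x a3.
transitivity (\sw_(a1, a2 <- Δ x) tmul (Δ (S a1 · a2)) (N a3)).
  apply: eq_tlift => a1 a2; congr tmul.
  by rewrite coprodM.
rewrite (antipode_mulF (F := fun z => tmul (Δ z) (N a3))); last by lintac.
by rewrite coprod1 tmul1l.
Qed.

Lemma coprod_antipodeF (U : lmodType C) (F : A -> A -> U) a : bil F ->
  tlift F (Δ (S a)) = \sw_(a1, a2 <- Δ a) F (S a2) (S a1).
Proof. by move=> bF; rewrite coprod_antipode tlift_tlift //; apply: eq_tlift => x y; rewrite tliftE. Qed.

Lemma antipodeK : cancel S (antipode_inv H).
Proof.
have [_ [_ bS] _ _] := hH; move=> a; rewrite /antipode_inv.
by case: xgetP => [x _ /=|/(_ a)] //; [apply: bij_inj | case].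
Qed.
Lemma antipode_invK : cancel (antipode_inv H) S.
Proof.
have [_ [_ [T h1 h2]] _ _] := hH; move=> a; rewrite /antipode_inv.
by case: xgetP => [x _ /=|/(_ (T a))] //; case.
Qed.

(** * Two-cocycles *)

Variables g gb : tensor A A -> C^o.
Hypothesis hg : is_two_cocycle H g gb.

Local Notation s := (antipode_inv H).
Local Notation Δ2 := (tcoact Δ Δ).
Local Notation ε2 := (ptensor ε ε).
Local Notation M := (tlift (amul H)).

Let cA := hopf_coalg.
Let lΔ := lin_coprod.
Let lε := lin_counit.
Let lS := lin_antipode.
Let lmr := lin_hmulr.
Let lml := lin_hmull.
Let c2 := coalg_tensor cA cA.

Lemma lin_g : lin g. Proof. by case: hg. Qed.
Lemma lin_gb : lin gb. Proof. by case: hg. Qed.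
Let lg := lin_g.
Let lgb := lin_gb.

Lemma lin_hmul : lin M. Proof. by lintac. Qed.
Let lM := lin_hmul.
Lemma lin_coprod2 : lin Δ2. Proof. exact: lin_tcoact. Qed.
Let lΔ2 := lin_coprod2.
Lemma lin_counit2 : lin ε2. Proof. exact: lin_ptensor. Qed.
Let lε2 := lin_counit2.

Lemma hmulE x y : M (x ⊗ y) = x · y.
Proof. by rewrite tliftE //; lintac. Qed.

Lemma cmorph_hmul : cmorph M M Δ2 Δ.
Proof.
move=> t; apply: (tensor_lin_ext (f := fun t => Δ (M t))
  (h := fun t => \sw_(a, b <- Δ2 t) (M a ⊗ M b))) => [||x y]; [by lintac|by lintac|].
rewrite hmulE coprodM // tcoactE //; last by lintac.
by apply: eq_tlift => a v; apply: eq_tlift => b w; rewrite !hmulE.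
Qed.

Lemma conv2E (phi psi : tensor A A -> C^o) x y : lin phi -> lin psi ->
  conv Δ2 phi psi (x ⊗ y)
  = \sw_(x1, x2 <- Δ x) \sw_(y1, y2 <- Δ y) (phi (x1 ⊗ y1) * psi (x2 ⊗ y2)).
Proof. by move=> l1 l2; rewrite /conv (tcoactE (U := C^o)) //; lintac. Qed.

Lemma conv_ggb : conv Δ2 g gb = ε2.
Proof.
apply/funext => t; apply: (tensor_lin_ext (U := C^o)) => // [|x y]; first exact: lin_conv.
by rewrite conv2E // ptensorE //; case: hg => _ _ [].
Qed.
Lemma conv_gbg : conv Δ2 gb g = ε2.
Proof.
apply/funext => t; apply: (tensor_lin_ext (U := C^o)) => // [|x y]; first exact: lin_conv.
by rewrite conv2E // ptensorE //; case: hg => _ _ [].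
Qed.

Lemma g1r x : g (x ⊗ 1A) = counit H x.
Proof. by case: hg => _ _ _ _ /(_ x) []. Qed.
Lemma g1l x : g (1A ⊗ x) = counit H x.
Proof. by case: hg => _ _ _ _ /(_ x) []. Qed.

Lemma gb1r x : gb (x ⊗ 1A) = counit H x.
Proof.
have := congr1 (fun f => f (x ⊗ 1A)) conv_ggb.
rewrite /= conv2E // ptensorE // counit1 // mulr1 => <-.
rewrite -[LHS](counitlF (U := C^o) (F := fun z => gb (z ⊗ 1A))); last by lintac.
by apply: eq_tlift => a b; rewrite coprod1 // (tliftE (U:=C^o)) ?g1r //; lintac.
Qed.
Lemma gb1l x : gb (1A ⊗ x) = counit H x.
Proof.
have := congr1 (fun f => f (1A ⊗ x)) conv_ggb.
rewrite /= conv2E // ptensorE // counit1 // mul1r => <-.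
rewrite -[LHS](counitlF (U := C^o) (F := fun z => gb (1A ⊗ z))); last by lintac.
rewrite coprod1 // (tliftE (U:=C^o)); last by lintac.
by apply: eq_tlift => a b; rewrite g1l.
Qed.

Lemma cocycle x y z :
  \sw_(x1, x2 <- Δ x) \sw_(y1, y2 <- Δ y) (g (x1 ⊗ y1) * g ((x2 · y2) ⊗ z))
  = \sw_(y1, y2 <- Δ y) \sw_(z1, z2 <- Δ z) (g (y1 ⊗ z1) * g (x ⊗ (y2 · z2))).
Proof. by case: hg. Qed.

(** Solves a product with γ on the left for the other factor. *)
Lemma conv_solve chi y z : lin chi ->
  chi (y ⊗ z) = \sw_(y1, y2 <- Δ y) \sw_(z1, z2 <- Δ z) (gb (y1 ⊗ z1) * conv Δ2 g chi (y2 ⊗ z2)).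
Proof.
move=> lc; rewrite -conv2E //; last exact: lin_conv.
by rewrite -(convA c2) // conv_gbg (conv1l c2).
Qed.

(** The cocycle identity solved for its term with a product in the second
    argument: put x = k1, y = S k2, z = k3 and the left side collapses. *)
Lemma g_mulr x y z : g (x ⊗ (y · z)) =
  \sw_(x1, x2 <- Δ x) \sw_(y1, y' <- Δ y) \sw_(y2, y3 <- Δ y') \sw_(z1, z2 <- Δ z)
     (gb (y1 ⊗ z1) * g (x1 ⊗ y2) * g ((x2 · y3) ⊗ z2)).
Proof.
have lc : lin (fun t => g (x ⊗ M t)) by lintac.
have := conv_solve y z lc; rewrite hmulE => ->.
rewrite [RHS]tlift_swap; apply: eq_tlift => y1 y'.
under [RHS]eq_tlift => x1 x2 do rewrite tlift_swap.
rewrite [RHS]tlift_swap; apply: eq_tlift => z1 z2.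
rewrite conv2E //; under eq_tlift => a b do under eq_tlift => c d do rewrite hmulE.
rewrite -cocycle (tlift_lin (U:=C^o) _ _ (lin_mulr _)).
apply: eq_tlift => x1 x2; rewrite (tlift_lin (U:=C^o) _ _ (lin_mulr _)).
by apply: eq_tlift => y2 y3; rewrite mulrA.
Qed.

(** As above for a product in the first argument; used at S k1, k2, S k3. *)
Lemma g_mull x y z : g ((x · y) ⊗ z) =
  \sw_(x1, x2 <- Δ x) \sw_(y1, y' <- Δ y) \sw_(y2, y3 <- Δ y') \sw_(z1, z2 <- Δ z)
     (gb (x1 ⊗ y1) * g (y2 ⊗ z1) * g (x2 ⊗ (y3 · z2))).
Proof.
have lc : lin (fun t => g (M t ⊗ z)) by lintac.
have := conv_solve x y lc; rewrite hmulE => ->.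
apply: eq_tlift => x1 x2; apply: eq_tlift => y1 y'.
rewrite conv2E //; under eq_tlift => a b do under eq_tlift => c d do rewrite hmulE.
rewrite cocycle (tlift_lin (U:=C^o) _ _ (lin_mulr _)).
apply: eq_tlift => y2 y3; rewrite (tlift_lin (U:=C^o) _ _ (lin_mulr _)).
by apply: eq_tlift => z1 z2; rewrite mulrA.
Qed.

Local Notation U := (Ucoc H g : A -> C^o).
Local Notation Ub := (Ubar H gb : A -> C^o).

Lemma lin_Ucoc : lin U. Proof. by rewrite /Ucoc; lintac. Qed.
Lemma lin_Ubar : lin Ub. Proof. by rewrite /Ubar; lintac. Qed.
Let lU := lin_Ucoc.
Let lUb := lin_Ubar.

(** The value γ(k1 ⊗ S(k2) k3) is trivially ε(k).  Expanded by [g_mulr] it is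
    γbar(S k5 ⊗ k6) γ(k1 ⊗ S k4) γ(k2 S k3 ⊗ k7), and k2 S k3 cancels. *)
Lemma conv_Ucoc_Ubar : conv Δ U Ub = ε.
Proof.
apply/funext => k.
transitivity (swA 4 k (fun l : seq A => (g (l`_0 ⊗ S l`_1) * gb (S l`_2 ⊗ l`_3) : C^o))).
  rewrite (sw_cat cA (k := 2) (j := 2)); last by swlin.
  apply: eq_tlift => a b; rewrite (sw2E cA); last by swlin.
  rewrite [LHS](tlift_lin (U:=C^o) _ _ (lin_mull _)).
  apply: eq_tlift => a1 a2; rewrite (sw2E cA); last by swlin.
  by rewrite [LHS](tlift_lin (U:=C^o) _ _ (lin_mulr _)).
transitivity (swA 5 k (fun l : seq A => (gb (S l`_2 ⊗ l`_3) * g (l`_0 ⊗ S l`_1) * counit H l`_4 : C^o))).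
  apply: esym; swlocal cA (3, 2, 1, 0)%N.
  transitivity (\sw_(y, z <- Δ x) ((counit H z : C) *: (g (u ⊗ S u0) * gb (S u1 ⊗ y) : C^o))).
    by apply: eq_tlift => y z; rewrite mulrC [gb _ * _]mulrC.
  by rewrite (counitrF (F := fun z => (g (u ⊗ S u0) * gb (S u1 ⊗ z) : C^o))) //; lintac.
transitivity (swA 7 k (fun l : seq A =>
    (gb (S l`_4 ⊗ l`_5) * g (l`_0 ⊗ S l`_3) * g ((l`_1 · S l`_2) ⊗ l`_6) : C^o))).
  apply: esym; swlocal cA (1, 2, 0, 4)%N.
  by rewrite (mul_antipodeF (F := fun w => (gb (S u1 ⊗ u2) * g (u ⊗ S u0) * g (w ⊗ u3) : C^o))) ?g1l //; lintac.
rewrite (sw_cat3 cA (i := 2) (j := 3) (k := 2)); last by swlin.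
transitivity (swA 3 k (fun l : seq A => (g (l`_0 ⊗ (S l`_1 · l`_2)) : C^o))).
  apply: eq_sw => l sl; deseq l sl; cbn [nth].
  rewrite g_mulr (sw2E cA); last by swlin.
  apply: eq_tlift => x1 x2; rewrite (coprod_antipodeF (U := C^o)); last by swlin.
  rewrite (sw3E cA); last by swlin.
  apply: eq_tlift => p q; rewrite (coprod_antipodeF (U := C^o)); last by lintac.
  by apply: eq_tlift => p1 p2; rewrite (sw2E cA) //; swlin.
transitivity (swA 1 k (fun l : seq A => (counit H l`_0 : C^o))); last by rewrite (sw1E cA) //; swlin.
swlocal cA (1, 2, 0, 0)%N.
by rewrite (antipode_mulF (F := fun w => (g (u ⊗ w) : C^o))) ?g1r //; lintac.
Qed.

(** The value γ(S(k1) k2 ⊗ S k3) is trivially ε(k).  Expanded by [g_mull] it is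
    γbar(S k2 ⊗ k3) γ(k4 ⊗ S k7) γ(S k1 ⊗ k5 S k6), and k5 S k6 cancels. *)
Lemma conv_Ubar_Ucoc : conv Δ Ub U = ε.
Proof.
apply/funext => k.
transitivity (swA 4 k (fun l : seq A => (gb (S l`_0 ⊗ l`_1) * g (l`_2 ⊗ S l`_3) : C^o))).
  rewrite (sw_cat cA (k := 2) (j := 2)); last by swlin.
  apply: eq_tlift => a b; rewrite (sw2E cA); last by swlin.
  rewrite [LHS](tlift_lin (U:=C^o) _ _ (lin_mull _)).
  apply: eq_tlift => a1 a2; rewrite (sw2E cA); last by swlin.
  by rewrite [LHS](tlift_lin (U:=C^o) _ _ (lin_mulr _)).
transitivity (swA 5 k (fun l : seq A => (gb (S l`_1 ⊗ l`_2) * g (l`_3 ⊗ S l`_4) * counit H (S l`_0) : C^o))).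
  apply: esym; swlocal cA (0, 2, 1, 3)%N.
  transitivity (\sw_(y, z <- Δ x) ((counit H y : C) *: (gb (S z ⊗ u) * g (u0 ⊗ S u1) : C^o))).
    by apply: eq_tlift => y z; rewrite counit_antipode // mulrC.
  by rewrite (counitlF (F := fun z => (gb (S z ⊗ u) * g (u0 ⊗ S u1) : C^o))) //; lintac.
transitivity (swA 7 k (fun l : seq A =>
    (gb (S l`_1 ⊗ l`_2) * g (l`_3 ⊗ S l`_6) * g (S l`_0 ⊗ (l`_4 · S l`_5)) : C^o))).
  apply: esym; swlocal cA (4, 2, 0, 1)%N.
  by rewrite (mul_antipodeF (F := fun w => (gb (S u0 ⊗ u1) * g (u2 ⊗ S u3) * g (S u ⊗ w) : C^o))) ?g1r //; lintac.
rewrite (sw_cat3 cA (i := 2) (j := 3) (k := 2)); last by swlin.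
transitivity (swA 3 k (fun l : seq A => (g ((S l`_0 · l`_1) ⊗ S l`_2) : C^o))).
  apply: eq_sw => l sl; deseq l sl; cbn [nth].
  rewrite g_mull (coprod_antipodeF (U := C^o)); last by lintac.
  rewrite (sw2E cA); last by swlin.
  apply: eq_tlift => x1 x2.
  rewrite (sw3rE cA); last by swlin.
  apply: eq_tlift => y1 y'; apply: eq_tlift => y2 y3.
  by rewrite (coprod_antipodeF (U := C^o)) ?(sw2E cA) //; swlin.
transitivity (swA 1 k (fun l : seq A => (counit H (S l`_0) : C^o))).
  swlocal cA (0, 2, 0, 1)%N.
  by rewrite (antipode_mulF (F := fun w => (g (w ⊗ S u) : C^o))) ?g1l //; lintac.
by rewrite (sw1E cA) ?counit_antipode //; swlin.
Qed.

(** For T the antipode or its inverse this is a coalgebra map from A ⊗ A with the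
    co-opposite coproduct to A ⊗ A ([cmorph_aflip]); followed by the product of A it
    is T of the product. *)
Definition aflip (T : A -> A) : tensor A A -> tensor A A :=
  tlift (fun q p => T p ⊗ T q).

Lemma lin_aflip T : lin T -> lin (aflip T).
Proof. by move=> lT; rewrite /aflip; lintac. Qed.

Lemma aflipE T q p : lin T -> aflip T (q ⊗ p) = T p ⊗ T q.
Proof. by move=> lT; rewrite /aflip tliftE //; lintac. Qed.

Lemma cmorph_aflip T : lin T ->
  (forall a, Δ (T a) = \sw_(a1, a2 <- Δ a) (T a2 ⊗ T a1)) ->
  cmorph (aflip T) (aflip T) (cop Δ2) Δ2.
Proof.
move=> lT aT; have lF := lin_aflip lT; have lc := lin_cop lΔ2.
move=> t; apply: (tensor_lin_ext (f := fun t => Δ2 (aflip T t))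
  (h := fun t => \sw_(a, b <- cop Δ2 t) (aflip T a ⊗ aflip T b))) => [||q p]; [by lintac|by lintac|].
rewrite aflipE // copE; last by lintac.
rewrite tcoactE //; last by lintac.
rewrite /tcoact tliftE; last by lintac.
have aTF (F : A -> A -> tensor (tensor A A) (tensor A A)) a : bil F ->
    tlift F (Δ (T a)) = \sw_(a1, a2 <- Δ a) F (T a2) (T a1).
  move=> bF; rewrite aT tlift_tlift //.
  by apply: eq_tlift => x y; rewrite tliftE.
rewrite aTF; last by lintac.
rewrite [RHS]tlift_swap; apply: eq_tlift => p1 p2.
rewrite aTF; last by lintac.
by apply: eq_tlift => q1 q2; rewrite !aflipE.
Qed.

Let gS := fun t : tensor A A => (g (aflip S t) : C^o).
Let gbS := fun t : tensor A A => (gb (aflip S t) : C^o).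
Let lSS : lin (aflip S). Proof. exact: lin_aflip. Qed.
Let lgS : lin gS. Proof. by rewrite /gS; lintac. Qed.
Let lgbS : lin gbS. Proof. by rewrite /gbS; lintac. Qed.

Lemma conv_aflip T phi psi : lin T ->
  (forall a, Δ (T a) = \sw_(a1, a2 <- Δ a) (T a2 ⊗ T a1)) -> lin phi -> lin psi ->
  (fun t => conv Δ2 phi psi (aflip T t))
  = conv Δ2 (fun t => psi (aflip T t)) (fun t => phi (aflip T t)).
Proof.
move=> lT aT l1 l2; have lF := lin_aflip lT.
rewrite -[RHS](conv_cop (D := tensor A A)) //; [|by lintac|by lintac].
by rewrite -(conv_morph (dD := cop Δ2) (dE := Δ2)) //; exact: cmorph_aflip.
Qed.

Lemma counit2_aflip T : lin T -> (forall a, counit H (T a) = counit H a) ->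
  (fun t => ε2 (aflip T t)) = ε2.
Proof.
move=> lT eT; have lF := lin_aflip lT; apply/funext => t.
apply: (tensor_lin_ext (U := C^o) (f := fun t => ε2 (aflip T t)) (h := ε2)) => //; first by lintac.
by move=> x y; rewrite aflipE // !ptensorE // !eT mulrC.
Qed.

Lemma conv_gS_gbS : conv Δ2 gS gbS = ε2.
Proof.
rewrite -[LHS](conv_aflip lS coprod_antipode lgb lg) conv_gbg counit2_aflip //.
exact: counit_antipode.
Qed.

Lemma conv_gbS_gS : conv Δ2 gbS gS = ε2.
Proof.
rewrite -[LHS](conv_aflip lS coprod_antipode lg lgb) conv_ggb counit2_aflip //.
exact: counit_antipode.
Qed.

(** The sum of γ(p1 ⊗ S(p2) S(q)), the intermediate term between U on a product
    and the product of the values of U. *)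
Let phiU (q p : A) : C^o := \sw_(p1, p2 <- Δ p) g (p1 ⊗ (S p2 · S q)).
Let bphi : bil phiU. Proof. by rewrite /phiU; lintac. Qed.
Let PhiU := tlift phiU.
Let lPhi : lin PhiU. Proof. exact: lin_tlift. Qed.

(** The cocycle identity at p1, S p2, S q, after which p2 S p3 cancels. *)
Lemma conv_PhiU_gS : conv Δ2 PhiU gS = ptensor ε U.
Proof.
have lp := lin_ptensor lε lU.
apply/funext => t; apply: (tensor_lin_ext (U := C^o)) => // [|q p]; first exact: lin_conv.
rewrite conv2E // ptensorE //.
transitivity (\sw_(q1, q2 <- Δ q) \sw_(p', p3 <- Δ p) \sw_(p1, p2 <- Δ p')
   (g (p1 ⊗ (S p2 · S q1)) * g (S p3 ⊗ S q2) : C^o)).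
  apply: eq_tlift => q1 q2; apply: eq_tlift => p' p3.
  rewrite /PhiU (tliftE (U := C^o)) // /gS aflipE // /phiU.
  by rewrite [LHS](tlift_lin (U:=C^o) _ _ (lin_mull _)).
transitivity (\sw_(p1, p' <- Δ p) \sw_(p2, p3 <- Δ p') \sw_(q1, q2 <- Δ q)
   (g (p1 ⊗ (S p2 · S q1)) * g (S p3 ⊗ S q2) : C^o)).
  rewrite tlift_swap; under eq_tlift => p' p3 do rewrite tlift_swap.
  by rewrite (coassocF (U := C^o)) //; lintac.
transitivity (\sw_(p1, p' <- Δ p) \sw_(x1, x2 <- Δ p1) \sw_(y1, y2 <- Δ (S p'))
   (g (x1 ⊗ y1) * g ((x2 · y2) ⊗ S q) : C^o)).
  apply: eq_tlift => p1 p'; rewrite cocycle (coprod_antipodeF (U := C^o)); last by lintac.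
  apply: eq_tlift => p2 p3; rewrite (coprod_antipodeF (U := C^o)); last by lintac.
  by apply: eq_tlift => q1 q2; rewrite mulrC.
transitivity (swA 4 p (fun l : seq A => (g (l`_0 ⊗ S l`_3) * g ((l`_1 · S l`_2) ⊗ S q) : C^o))).
  rewrite (sw_cat cA (k := 2) (j := 2)); last by swlin.
  apply: eq_tlift => a b; rewrite (sw2E cA); last by swlin.
  apply: eq_tlift => x1 x2; rewrite (coprod_antipodeF (U := C^o)); last by lintac.
  by rewrite (sw2E cA) //; swlin.
transitivity (swA 2 p (fun l : seq A => (counit H q * g (l`_0 ⊗ S l`_1) : C^o))).
  swlocal cA (1, 2, 0, 1)%N.
  rewrite (mul_antipodeF (F := fun w => (g (u ⊗ S u0) * g (w ⊗ S q) : C^o))); last by lintac.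
  by rewrite g1l counit_antipode // [g _ * _]mulrC.
rewrite (sw2E cA); last by swlin.
by rewrite [RHS](tlift_lin (U:=C^o) _ _ (lin_mulr _)).
Qed.

(** U(q2 p2) = γ(q2 p2 ⊗ S(p3) S(q3)); the cocycle identity for q1, p1 against
    this last argument brings p2 next to S p3. *)
Lemma conv_g_Ucoc : conv Δ2 g (fun t => U (M t)) = conv Δ2 (ptensor U ε) PhiU.
Proof.
have lp := lin_ptensor lU lε.
have lUM : lin (fun t => U (M t) : C^o) by lintac.
apply/funext => t; apply: (tensor_lin_ext (U := C^o)) => // [||q p]; [exact: lin_conv|exact: lin_conv|].
rewrite !conv2E //.
transitivity (\sw_(q', q3 <- Δ q) \sw_(p', p3 <- Δ p)
   \sw_(q1, q2 <- Δ q') \sw_(p1, p2 <- Δ p')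
     (g (q1 ⊗ p1) * g ((q2 · p2) ⊗ (S p3 · S q3)) : C^o)).
  pose F q1 p1 q2 p2 q3 p3 : C^o := g (q1 ⊗ p1) * g ((q2 · p2) ⊗ (S p3 · S q3)).
  transitivity (\sw_(q1, q' <- Δ q) \sw_(q2, q3 <- Δ q')
    \sw_(p1, p' <- Δ p) \sw_(p2, p3 <- Δ p') F q1 p1 q2 p2 q3 p3).
    apply: eq_tlift => q1 q'; rewrite tlift_swap; apply: eq_tlift => p1 p'.
    rewrite hmulE /Ucoc (coprodMF (U := C^o)); last by lintac.
    rewrite [LHS](tlift_lin (U:=C^o) _ _ (lin_mulr _)); apply: eq_tlift => q2 q3.
    rewrite [LHS](tlift_lin (U:=C^o) _ _ (lin_mulr _)); apply: eq_tlift => p2 p3.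
    by rewrite antipodeM.
  rewrite -(coassocF (U := C^o)); last by rewrite /F; lintac.
  apply: eq_tlift => q' q3; rewrite [RHS]tlift_swap; apply: eq_tlift => q1 q2.
  by rewrite -(coassocF (U := C^o)) //; rewrite /F; lintac.
transitivity (\sw_(q', q3 <- Δ q) \sw_(c, d <- Δ q3) \sw_(p', p3 <- Δ p)
    \sw_(p1, p2 <- Δ p') \sw_(p3', p4 <- Δ p3)
    (g (p1 ⊗ (S p4 · S d)) * g (q' ⊗ (p2 · (S p3' · S c))) : C^o)).
  apply: eq_tlift => q' q3; rewrite [RHS]tlift_swap; apply: eq_tlift => p' p3.
  rewrite cocycle [RHS]tlift_swap; apply: eq_tlift => p1 p2.
  rewrite (coprodMF (U := C^o)); last by lintac.
  rewrite (coprod_antipodeF (U := C^o)); last by lintac.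
  rewrite [RHS]tlift_swap; apply: eq_tlift => p3' p4.
  by rewrite (coprod_antipodeF (U := C^o)) //; lintac.
transitivity (\sw_(q', q3 <- Δ q) \sw_(c, d <- Δ q3) (g (q' ⊗ S c) * phiU d p : C^o)).
  apply: eq_tlift => q' q3; apply: eq_tlift => c d.
  transitivity (swA 4 p (fun l : seq A => (g (l`_0 ⊗ (S l`_3 · S d)) * g (q' ⊗ ((l`_1 · S l`_2) · S c)) : C^o))).
    rewrite (sw_cat cA (k := 2) (j := 2)); last by swlin.
    apply: eq_tlift => p' p3; rewrite (sw2E cA); last by swlin.
    apply: eq_tlift => p1 p2; rewrite (sw2E cA) //; last by swlin.
    by apply: eq_tlift => p3' p4; rewrite /= hmulA.
  transitivity (swA 2 p (fun l : seq A => (g (q' ⊗ S c) * g (l`_0 ⊗ (S l`_1 · S d)) : C^o))).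
    swlocal cA (1, 2, 0, 1)%N.
    rewrite (mul_antipodeF (F := fun w => (g (u ⊗ (S u0 · S d)) * g (q' ⊗ (w · S c)) : C^o))); last by lintac.
    by rewrite hmul1l // mulrC.
  rewrite (sw2E cA); last by swlin.
  by rewrite [RHS](tlift_lin (U:=C^o) _ _ (lin_mulr _)).
have [phiU1 phiU2] := bphi; rewrite -(coassocF (U := C^o)); last by lintac.
apply: eq_tlift => x d.
rewrite -[LHS](tlift_lin (U:=C^o) _ _ (lin_mull _)) -/(Ucoc H g x).
rewrite -(counitlF (U := C^o) (F := fun p => phiU d p)); last by lintac.
rewrite [LHS](tlift_lin (U:=C^o) _ _ (lin_mulr _)).
by apply: eq_tlift => p1 p2; rewrite ptensorE // /PhiU (tliftE (U := C^o)) // mulrA.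
Qed.

Lemma Ucoc_hmul : conv Δ2 g (fun t => U (M t)) = conv Δ2 (ptensor U U) gbS.
Proof.
have lp := lin_ptensor lU lε; have lp' := lin_ptensor lε lU.
rewrite conv_g_Ucoc -[PhiU](conv1r c2) // -conv_gS_gbS.
rewrite -(convA c2 lPhi lgS lgbS) conv_PhiU_gS -(convA c2) //.
by rewrite conv_ptensor // (conv1r cA) // (conv1l cA).
Qed.

(** The inverse of [Ucoc_hmul] in the dual algebra of A ⊗ A. *)
Lemma Ubar_hmul : conv Δ2 (fun t => Ub (M t)) gb = conv Δ2 gS (ptensor Ub Ub).
Proof.
have lp := lin_ptensor lU lU; have lp' := lin_ptensor lUb lUb.
have lUM : lin (fun t => U (M t) : C^o) by lintac.
have lUbM : lin (fun t => Ub (M t) : C^o) by lintac.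
apply: (conv_inv_uniq c2 (phi := conv Δ2 g (fun t => U (M t)))
  (phi' := conv Δ2 (ptensor U U) gbS)); try exact: lin_conv; last exact: Ucoc_hmul.
  rewrite (convA c2) //; last exact: lin_conv.
  rewrite -(convA c2 lgb) // conv_gbg (conv1l c2) //.
  rewrite -(conv_morph lUb lU cmorph_hmul) conv_Ubar_Ucoc.
  apply/funext => t.
  apply: (tensor_lin_ext (U := C^o) (f := fun t => ε (M t)) (h := ε2)) => //; first by lintac.
  by move=> x y; rewrite hmulE ptensorE // counitM.
rewrite (convA c2) //; last exact: lin_conv.
rewrite -(convA c2 lgbS) // conv_gbS_gS (conv1l c2) //.
by rewrite conv_ptensor // conv_Ucoc_Ubar.
Qed.

Local Notation V := (Vcoc H g : A -> C^o).
Local Notation Vb := (Vbar H gb : A -> C^o).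

Lemma lin_antipode_inv : lin s.
Proof.
move=> c x y; apply: (can_inj antipodeK).
by rewrite antipode_invK lS !antipode_invK.
Qed.
Let ls := lin_antipode_inv.

Lemma lin_Vcoc : lin V. Proof. by rewrite /Vcoc; lintac. Qed.
Lemma lin_Vbar : lin Vb. Proof. by rewrite /Vbar; lintac. Qed.
Let lV := lin_Vcoc.
Let lVb := lin_Vbar.

Lemma antipode_invM a b : s (a · b) = s b · s a.
Proof. by apply: (can_inj antipodeK); rewrite antipodeM !antipode_invK. Qed.

Lemma counit_antipode_inv a : counit H (s a) = counit H a.
Proof. by rewrite -counit_antipode antipode_invK. Qed.

Lemma coprod_antipode_inv a : Δ (s a) = \sw_(a1, a2 <- Δ a) (s a2 ⊗ s a1).
Proof.
rewrite -[in RHS](antipode_invK a) coprod_antipodeF; last by lintac.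
by under eq_tlift => x y do rewrite !antipodeK; rewrite tlift_eta.
Qed.

Lemma conv_Vcoc_Vbar : conv Δ V Vb = ε.
Proof.
apply/funext => a; rewrite -counit_antipode_inv -conv_Ubar_Ucoc /conv coprod_antipode_inv tlift_tlift; last by lintac.
apply: eq_tlift => x y; rewrite (tliftE (U := C^o)); last by lintac.
by rewrite mulrC.
Qed.

Lemma VbarE k : Vb k = \sw_(k1, k2 <- Δ k) (gb (k2 ⊗ s k1) : C^o).
Proof.
rewrite /Vbar /Ubar coprod_antipode_inv (tlift_tlift (U := C^o)); last by lintac.
apply: eq_tlift => x y; rewrite (tliftE (U := C^o)); last by lintac.
by rewrite antipode_invK.
Qed.

Lemma VcocE k : V k = \sw_(k1, k2 <- Δ k) (g (s k2 ⊗ k1) : C^o).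
Proof.
rewrite /Vcoc /Ucoc coprod_antipode_inv (tlift_tlift (U := C^o)); last by lintac.
apply: eq_tlift => x y; rewrite (tliftE (U := C^o)); last by lintac.
by rewrite antipode_invK.
Qed.

(** The functionals x ⊗ y |-> γ(S^-1 y ⊗ S^-1 x), and likewise for γbar: by
    unitarity they are γbar and γ conjugated by the involution, see [conj_g]. *)
Definition gs (t : tensor A A) : C^o := g (aflip s t).
Definition gbs (t : tensor A A) : C^o := gb (aflip s t).

(** [Ubar_hmul] composed with the flipped inverse antipode. *)
Lemma Vbar_hmul : conv Δ2 gbs (fun t => Vb (M t)) = conv Δ2 (ptensor Vb Vb) g.
Proof.
have lp := lin_ptensor lVb lVb; have lp' := lin_ptensor lUb lUb.
have lUbM : lin (fun t => Ub (M t) : C^o) by lintac.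
have lF := lin_aflip ls.
have := congr1 (fun f t => f (aflip s t)) Ubar_hmul.
rewrite !(conv_aflip ls coprod_antipode_inv) // => e; rewrite -[LHS]/(conv Δ2 gbs _).
have -> : (fun t => Vb (M t)) = (fun t => Ub (M (aflip s t))) :> (_ -> C^o).
  apply/funext => t; apply: (tensor_lin_ext (U := C^o) (f := fun t => Vb (M t)) (h := fun t => Ub (M (aflip s t)))); [by lintac|by lintac|].
  by move=> x y; rewrite aflipE // !hmulE /Vbar antipode_invM.
rewrite e; congr conv; apply/funext => t.
  apply: (tensor_lin_ext (U := C^o) (f := fun t => ptensor Ub Ub (aflip s t))) => //; first by lintac.
  by move=> x y; rewrite aflipE // !ptensorE // mulrC.
rewrite /gS; apply: (tensor_lin_ext (U := C^o) (f := fun t => g (aflip S (aflip s t)))) => //; first by lintac.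
by move=> x y; rewrite !aflipE // !antipode_invK.
Qed.

Lemma Vcoc_hmul : conv Δ2 (fun t => V (M t)) gs = conv Δ2 gb (ptensor V V).
Proof.
have lp := lin_ptensor lV lV; have lp' := lin_ptensor lU lU.
have lUM : lin (fun t => U (M t) : C^o) by lintac.
have lF := lin_aflip ls.
have := congr1 (fun f t => f (aflip s t)) Ucoc_hmul.
rewrite !(conv_aflip ls coprod_antipode_inv) // => e.
have -> : (fun t => V (M t)) = (fun t => U (M (aflip s t))) :> (_ -> C^o).
  apply/funext => t; apply: (tensor_lin_ext (U := C^o) (f := fun t => V (M t)) (h := fun t => U (M (aflip s t)))); [by lintac|by lintac|].
  by move=> x y; rewrite aflipE // !hmulE /Vcoc antipode_invM.
rewrite [LHS]e; congr conv; apply/funext => t.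
  rewrite /gbS; apply: (tensor_lin_ext (U := C^o) (f := fun t => gb (aflip S (aflip s t)))) => //; first by lintac.
  by move=> x y; rewrite !aflipE // !antipode_invK.
apply: (tensor_lin_ext (U := C^o) (f := fun t => ptensor U U (aflip s t))) => //; first by lintac.
by move=> x y; rewrite aflipE // !ptensorE // mulrC.
Qed.

(** * The cocycle identity on threefold tensors *)

Let ggb := conv_ggb.
Let gbg := conv_gbg.

Local Notation Δ3 := (tcoact Δ2 Δ).
Local Notation Δ3' := (tcoact Δ Δ2).
Let c3 := coalg_tensor c2 cA.
Let c3' := coalg_tensor cA c2.
Let lΔ3 : lin Δ3. Proof. exact: lin_tcoact. Qed.
Let lΔ3' : lin Δ3'. Proof. exact: lin_tcoact. Qed.

(** The two sides of the cocycle identity as elements of the dual algebras of the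
    two bracketings of A ⊗ A ⊗ A, and their inverses. *)
Definition cocl : tensor (tensor A A) A -> C^o :=
  conv Δ3 (ptensor g ε) (fun t => g (tmap M id t)).
Definition cocr : tensor A (tensor A A) -> C^o :=
  conv Δ3' (ptensor ε g) (fun t => g (tmap id M t)).
Definition coclb : tensor (tensor A A) A -> C^o :=
  conv Δ3 (fun t => gb (tmap M id t)) (ptensor gb ε).
Definition cocrb : tensor A (tensor A A) -> C^o :=
  conv Δ3' (fun t => gb (tmap id M t)) (ptensor ε gb).

Let lMi : lin (tmap M (@id A)). Proof. exact: lin_tmap. Qed.
Let liM : lin (tmap (@id A) M). Proof. exact: lin_tmap. Qed.
Let lgε : lin (ptensor g ε). Proof. exact: lin_ptensor. Qed.
Let lεg : lin (ptensor ε g). Proof. exact: lin_ptensor. Qed.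
Let lgbε : lin (ptensor gb ε). Proof. exact: lin_ptensor. Qed.
Let lεgb : lin (ptensor ε gb). Proof. exact: lin_ptensor. Qed.
Let lgMi : lin (fun t => g (tmap M (@id A) t)). Proof. by lintac. Qed.
Let lgiM : lin (fun t => g (tmap (@id A) M t)). Proof. by lintac. Qed.
Let lgbMi : lin (fun t => gb (tmap M (@id A) t)). Proof. by lintac. Qed.
Let lgbiM : lin (fun t => gb (tmap (@id A) M t)). Proof. by lintac. Qed.
Lemma lin_cocl : lin cocl. Proof. exact: lin_conv. Qed.
Lemma lin_cocr : lin cocr. Proof. exact: lin_conv. Qed.
Lemma lin_coclb : lin coclb. Proof. exact: lin_conv. Qed.
Lemma lin_cocrb : lin cocrb. Proof. exact: lin_conv. Qed.
Let lcl := lin_cocl.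
Let lcr := lin_cocr.
Let lclb := lin_coclb.
Let lcrb := lin_cocrb.
Let lta := @lin_tassoc C.

Lemma coclE : cocl = fun t => cocr (tassoc t).
Proof.
apply/funext => t.
apply: (tensor3_ext (U := C^o) (f := cocl) (h := fun t => cocr (tassoc t))) => // [|x y z]; first by lintac.
rewrite tassocE /cocl /cocr /conv !(tcoactE (U := C^o)) //; try by lintac.
transitivity (\sw_(x1, x2 <- Δ x) \sw_(y1, y2 <- Δ y) (g (x1 ⊗ y1) * g ((x2 · y2) ⊗ z) : C^o)).
  apply: eq_tlift => x1 x2; apply: eq_tlift => y1 y2.
  rewrite -[RHS](counitlF (F := fun z => (g (x1 ⊗ y1) * g ((x2 · y2) ⊗ z) : C^o))); last by lintac.
  apply: eq_tlift => z1 z2; rewrite ptensorE // tmapE // hmulE.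
  by rewrite [_ * counit H z1]mulrC -mulrA.
rewrite cocycle.
rewrite -[LHS](counitlF (U := C^o) (F := fun x => \sw_(y1, y2 <- Δ y) \sw_(z1, z2 <- Δ z) (g (y1 ⊗ z1) * g (x ⊗ (y2 · z2)) : C^o))); last by lintac.
apply: eq_tlift => x1 x2; rewrite (tcoactE (U := C^o)) //; last by lintac.
rewrite [LHS](tlift_lin _ _ (@lin_scaler _ _ _)); apply: eq_tlift => y1 y2.
rewrite [LHS](tlift_lin _ _ (@lin_scaler _ _ _)); apply: eq_tlift => z1 z2.
by rewrite ptensorE // tmapE // hmulE -mulrA.
Qed.

Let conv_gbε : conv Δ3 (ptensor gb ε) (ptensor g ε) = ptensor ε2 ε.
Proof. by rewrite conv_ptensor // gbg (conv1l cA). Qed.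
Let conv_εg : conv Δ3' (ptensor ε g) (ptensor ε gb) = ptensor ε ε2.
Proof. by rewrite conv_ptensor // ggb (conv1l cA). Qed.

Lemma counit_hmul : (fun t => ε (M t)) = ε2 :> (_ -> C^o).
Proof.
apply/funext => t; apply: (tensor_lin_ext (U := C^o) (f := fun t => ε (M t))) => //; first by lintac.
by move=> x y; rewrite hmulE ptensorE // counitM.
Qed.

Let idlin (W : lmodType C) : lin (@id W). Proof. by []. Qed.

Lemma cmorph_Mid : cmorph (tmap M (@id A)) (tmap M id) Δ3 Δ2.
Proof. by apply: cmorph_tmap => //; [exact: cmorph_hmul | exact: cmorph_id]. Qed.
Lemma cmorph_idM : cmorph (tmap (@id A) M) (tmap id M) Δ3' Δ2.
Proof. by apply: cmorph_tmap => //; [exact: cmorph_id | exact: cmorph_hmul]. Qed.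

Let conv_gM : conv Δ3 (fun t => gb (tmap M id t)) (fun t => g (tmap M id t)) = ptensor ε2 ε.
Proof.
rewrite -[LHS](conv_morph lgb lg cmorph_Mid) gbg; apply/funext => t.
have le := lin_ptensor lε2 lε.
apply: (tensor_lin_ext (U := C^o) (f := fun t => ε2 (tmap M id t))) => //; first by lintac.
by move=> x y; rewrite tmapE // !ptensorE // -counit_hmul.
Qed.
Let conv_gM' : conv Δ3' (fun t => g (tmap id M t)) (fun t => gb (tmap id M t)) = ptensor ε ε2.
Proof.
rewrite -[LHS](conv_morph lg lgb cmorph_idM) ggb; apply/funext => t.
have le := lin_ptensor lε lε2.
apply: (tensor_lin_ext (U := C^o) (f := fun t => ε2 (tmap id M t))) => //; first by lintac.
by move=> x y; rewrite tmapE // !ptensorE // -counit_hmul.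
Qed.

(** Inverses of the two sides of [coclE]. *)
Lemma coclbE : coclb = fun t => cocrb (tassoc t).
Proof.
apply: (conv_inv_uniq c3 (phi := cocl) (phi' := fun t => cocr (tassoc t))) => //; [by lintac|by lintac|..|exact: coclE].
  rewrite /coclb /cocl (convA c3) // -(convA c3 lgbε) // conv_gbε (conv1l c3) //.
rewrite -[LHS](conv_morph lcr lcrb (@cmorph_tassoc _ _ _ _ _ _ _ _ _ _ lΔ lΔ lΔ)).
rewrite /cocrb /cocr (convA c3') // -(convA c3' lgiM) // conv_gM' (conv1l c3') // conv_εg.
apply/funext => t; have le := lin_ptensor lε2 lε; have le' := lin_ptensor lε lε2.
apply: (tensor3_ext (U := C^o) (f := fun t => ptensor ε ε2 (tassoc t))) => //; first by lintac.
by move=> x y z; rewrite tassocE !ptensorE // mulrA.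
Qed.

(** * The deformed Hopf algebra *)

Local Notation Hg := (deform_hopf H g gb).
Local Notation T2 := (tw Δ2 g gb).
Let lT2 : lin T2. Proof. exact: (lin_tw c2). Qed.

Lemma mulgE x y : amul Hg x y = M (T2 (x ⊗ y)).
Proof.
rewrite (twE c2) // (tlift_lin _ _ lM).
transitivity (\sw_(x1, x' <- Δ x) \sw_(y1, y' <- Δ y) \sw_(x2, x3 <- Δ x') \sw_(y2, y3 <- Δ y')
   ((g (x1 ⊗ y1) * gb (x3 ⊗ y3) : C) *: (x2 · y2))).
  apply: eq_tlift => x1 x'; rewrite [RHS]tlift_swap; apply: eq_tlift => x2 x3.
  by [].
rewrite tcoactE //; last by lintac.
apply: eq_tlift => x1 x'; apply: eq_tlift => y1 y'.
rewrite (tlift_lin _ _ lM) tcoactE //; last by lintac.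
apply: eq_tlift => x2 x3; apply: eq_tlift => y2 y3.
by rewrite (linZ lM) hmulE.
Qed.

Local Notation mul := (amul Hg).

Lemma mulg_linr x : lin (mul x).
Proof. by rewrite (_ : mul x = fun y => M (T2 (x ⊗ y))); [lintac|apply/funext => y; rewrite mulgE]. Qed.
Lemma mulg_linl y : lin (mul^~ y).
Proof. by rewrite (_ : mul^~ y = fun x => M (T2 (x ⊗ y))); [lintac|apply/funext => x; rewrite mulgE]. Qed.

(** Bringing all functionals to the innermost place leaves the old associativity
    and the twists by the two sides of the cocycle identity. *)
Lemma mulgA : associative mul.
Proof.
move=> x y z.
transitivity (M (tmap M id (tw Δ3 cocl coclb ((x ⊗ y) ⊗ z)))); last first.
  rewrite mulgE (mulgE x y) -[M (T2 (x ⊗ y)) ⊗ z](tmapE (h := id)) //.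
  rewrite (tw_morph _ _ _ _ _ _ cmorph_Mid) // -[in RHS](tw1 cA z).
  by rewrite -(tw_ptensor _ _ c2 cA) // (tw_tw c3).
transitivity (M (tmap id M (tw Δ3' cocr cocrb (x ⊗ (y ⊗ z))))).
  rewrite mulgE (mulgE y z) -[x ⊗ M _](tmapE (f := id)) //.
  rewrite (tw_morph _ _ _ _ _ _ cmorph_idM) // -[in LHS](tw1 cA x).
  by rewrite -(tw_ptensor _ _ cA c2) // (tw_tw c3').
rewrite -tassocE (tw_morph _ _ _ _ _ _ (@cmorph_tassoc _ _ _ _ _ _ _ _ _ _ lΔ lΔ lΔ)) //.
rewrite -coclE -coclbE.
apply: (tensor3_ext (f := fun t => M (tmap id M (tassoc t))) (h := fun t => M (tmap M id t))); [by lintac|by lintac|].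
by move=> a b c; rewrite tassocE !tmapE // !hmulE hmulA.
Qed.

Lemma mulg1l : left_id 1A mul.
Proof.
move=> x; rewrite -[RHS](tw1 cA) (twE cA) //= coprod1 // tliftE; last by lintac.
rewrite coprod1 // tliftE; last by lintac.
apply: eq_tlift => x1 x'; apply: eq_tlift => x2 x3.
by rewrite g1l gb1l hmul1l.
Qed.

Lemma mulg1r : right_id 1A mul.
Proof.
move=> x; rewrite -[RHS](tw1 cA) (twE cA) //=.
apply: eq_tlift => x1 x'; apply: eq_tlift => x2 x3.
rewrite coprod1 // tliftE; last by lintac.
rewrite coprod1 // tliftE; last by lintac.
by rewrite g1r gb1r hmul1r.
Qed.

Lemma coprod_mulg x y : Δ (mul x y) =
  \sw_(a1, a2 <- Δ x) \sw_(b1, b2 <- Δ y) (mul a1 b1 ⊗ mul a2 b2).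
Proof.
rewrite mulgE cmorph_hmul (tw_coprod c2) //; last by lintac.
rewrite tcoactE //; last by lintac.
by apply: eq_tlift => a1 a2; apply: eq_tlift => b1 b2; rewrite !mulgE.
Qed.

Lemma counit_mulg x y : counit H (mul x y) = counit H x * counit H y.
Proof.
rewrite mulgE -[LHS]/((fun t => ε (M t)) _) counit_hmul (eps_tw c2) // ggb.
by rewrite ptensorE.
Qed.

Lemma antipodegE h : antipode Hg h = S (tw Δ U Ub h).
Proof.
rewrite (twE cA) // (tlift_lin _ _ lS); apply: eq_tlift => h1 h'.
by rewrite (tlift_lin _ _ lS); apply: eq_tlift => h2 h3; rewrite (linZ lS).
Qed.

Lemma lin_antipodeg : lin (antipode Hg).
Proof.
have h := lin_tw cA lU lUb.
by rewrite (_ : antipode Hg = fun h => S (tw Δ U Ub h)); [lintac|apply/funext => x; rewrite antipodegE].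
Qed.

(** S_γ is S after a twist by U and Ubar, which is undone by the twist by Ubar
    and U. *)
Lemma bij_antipodeg : bijective (antipode Hg).
Proof.
exists (fun h => tw Δ Ub U (s h)) => h; rewrite antipodegE.
  by rewrite antipodeK (tw_tw cA) // conv_Ucoc_Ubar (tw1 cA).
by rewrite (tw_tw cA) // conv_Ubar_Ucoc (tw1 cA) antipode_invK.
Qed.

Let lmg1 := mulg_linr.
Let lmg2 := mulg_linl.

(** Ubar(k2) is γbar(S k2 ⊗ k3), which cancels against γ since S reverses the
    coproduct; this is the first cancellation in the antipode axiom of A_γ. *)
Lemma contract_g_Ubar k : swA 3 k (fun m : seq A => (g (S m`_0 ⊗ m`_2) * Ub m`_1 : C^o)) = counit H k.
Proof.
transitivity (swA 4 k (fun m : seq A => (g (S m`_0 ⊗ m`_3) * gb (S m`_1 ⊗ m`_2) : C^o))).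
  apply: esym; swlocal cA (1, 2, 1, 1)%N.
  by rewrite [RHS](tlift_lin (U:=C^o) _ _ (lin_mulr _)).
rewrite (sw_cat cA (k := 2) (j := 2)); last by swlin.
rewrite -[RHS](counitlF (U := C^o) (F := fun z => counit H z)) //.
apply: eq_tlift => p q; rewrite (sw2E cA); last by swlin.
transitivity (conv Δ2 gb g (S p ⊗ q)); last by rewrite gbg ptensorE // counit_antipode.
rewrite conv2E // (coprod_antipodeF (U := C^o)); last by lintac.
apply: eq_tlift => p1 p2; rewrite (sw2E cA); last by swlin.
by apply: eq_tlift => q1 q2; rewrite mulrC.
Qed.

Lemma contract_gb_Ucoc k : swA 3 k (fun m : seq A => (gb (m`_0 ⊗ S m`_2) * U m`_1 : C^o)) = counit H k.
Proof.
transitivity (swA 4 k (fun m : seq A => (gb (m`_0 ⊗ S m`_3) * g (m`_1 ⊗ S m`_2) : C^o))).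
  apply: esym; swlocal cA (1, 2, 1, 1)%N.
  by rewrite [RHS](tlift_lin (U:=C^o) _ _ (lin_mulr _)).
rewrite (sw_cat cA (k := 2) (j := 2)); last by swlin.
rewrite -[RHS](counitlF (U := C^o) (F := fun z => counit H z)) //.
apply: eq_tlift => p q; rewrite (sw2E cA); last by swlin.
transitivity (conv Δ2 gb g (p ⊗ S q)); last by rewrite gbg ptensorE // counit_antipode.
rewrite conv2E //; apply: eq_tlift => p1 p2.
rewrite (coprod_antipodeF (U := C^o)); last by lintac.
by rewrite (sw2E cA) //; swlin.
Qed.

Lemma mulg_S x y : mul (S x) y = swA 3 x (fun m : seq A => swA 3 y (fun n : seq A =>
  ((g (S m`_2 ⊗ n`_0) * gb (S m`_0 ⊗ n`_2) : C) *: (S m`_1 · n`_1)))).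
Proof.
rewrite [LHS]/= (sw3E cA); last by swlin.
rewrite coprod_antipodeF; last by lintac.
apply: eq_tlift => p q; rewrite coprod_antipodeF; last by lintac.
by apply: eq_tlift => p1 p2; rewrite (sw3rE cA) //; swlin.
Qed.

Lemma mulgS x y : mul x (S y) = swA 3 x (fun m : seq A => swA 3 y (fun n : seq A =>
  ((g (m`_0 ⊗ S n`_2) * gb (m`_2 ⊗ S n`_0) : C) *: (m`_1 · S n`_1)))).
Proof.
rewrite [LHS]/= (sw3rE cA); last by swlin.
apply: eq_tlift => x1 x'; apply: eq_tlift => x2 x3.
rewrite (sw3E cA); last by swlin.
rewrite coprod_antipodeF; last by lintac.
by apply: eq_tlift => p q; rewrite coprod_antipodeF //; lintac.
Qed.

(** With U, S, Ubar and the three-leg product written out there are eight legs.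
    [contract_g_Ubar] removes three, the antipode axiom of A removes two, and
    what remains is U Ubar = ε. *)
Lemma antipodeg_l h : \sw_(h1, h2 <- Δ h) (mul (antipode Hg h1) h2) = counit H h *: 1A.
Proof.
transitivity (swA 4 h (fun l : seq A => (U l`_0 * Ub l`_2 : C) *: mul (S l`_1) l`_3)).
  rewrite (sw_cat cA (k := 3) (j := 1)); last by swlin.
  apply: eq_tlift => h1 h2; rewrite (sw3rE cA); last by swlin.
  rewrite (tlift_lin _ _ (lmg2 h2)); apply: eq_tlift => d1 d'.
  rewrite (tlift_lin _ _ (lmg2 h2)); apply: eq_tlift => d2 d3.
  by rewrite (linZ (lmg2 h2)) (sw1E cA) //; swlin.
(* Legs: U on 0, S on 1 to 3, Ubar on 4, the second factor on 5 to 7. *)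
pose F8 (l : seq A) := (U l`_0 * Ub l`_4 * g (S l`_3 ⊗ l`_5) * gb (S l`_1 ⊗ l`_7) : C) *: (S l`_2 · l`_6).
transitivity (swA 8 h F8).
  (* The three legs of S are expanded last. *)
  pose F6 (l : seq A) := swA 3 l`_1 (fun m : seq A =>
   (U l`_0 * Ub l`_2 * g (S m`_2 ⊗ l`_3) * gb (S m`_0 ⊗ l`_5) : C) *: (S m`_1 · l`_4)).
  transitivity (swA 6 h F6).
    apply: esym; rewrite /F6; swlocal cA (3, 3, 1, 0)%N.
    rewrite mulg_S sw_swap (sw_map _ _ _ _ _ (@lin_scaler _ _ _)); apply: eq_sw => m sm.
    rewrite (sw_map _ _ _ _ _ (@lin_scaler _ _ _)); apply: eq_sw => n sn.
    by deseq m sm; deseq n sn; rewrite scalerA /= !mulrA.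
  apply: esym; rewrite /F6 /F8; swlocal cA (1, 3, 1, 4)%N.
transitivity (swA 5 h (fun l : seq A => (U l`_0 * gb (S l`_1 ⊗ l`_4) : C) *: (S l`_2 · l`_3))).
  rewrite /F8; swlocal cA (3, 3, 0, 2)%N.
  rewrite -contract_g_Ubar [RHS](sw_map _ _ _ _ _ (lin_scalel _)); apply: eq_sw => m sm; deseq m sm.
  by rewrite scalerA /=; congr (_ *: _); ring.
transitivity (swA 3 h (fun l : seq A => (U l`_0 * gb (S l`_1 ⊗ l`_2) : C) *: 1A)).
  swlocal cA (2, 2, 0, 1)%N.
  by rewrite (antipode_mulF (F := fun w => (U u * gb (S u0 ⊗ u1) : C) *: w)) //; lintac.
rewrite (sw3rE cA); last by swlin.
rewrite -conv_Ucoc_Ubar /conv [RHS](tlift_lin _ _ (lin_scalel _)).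
apply: eq_tlift => a b.
by rewrite /Ubar (tlift_lin (U := C^o) _ _ (lin_mulr _)) (tlift_lin _ _ (lin_scalel _)).
Qed.

Lemma antipodeg_r h : \sw_(h1, h2 <- Δ h) (mul h1 (antipode Hg h2)) = counit H h *: 1A.
Proof.
transitivity (swA 4 h (fun l : seq A => (U l`_1 * Ub l`_3 : C) *: mul l`_0 (S l`_2))).
  rewrite (sw_cat cA (k := 1) (j := 3)); last by swlin.
  apply: eq_tlift => h1 h2; rewrite (sw1E cA); last by swlin.
  rewrite (sw3rE cA); last by swlin.
  rewrite (tlift_lin _ _ (lmg1 h1)); apply: eq_tlift => d1 d'.
  rewrite (tlift_lin _ _ (lmg1 h1)); apply: eq_tlift => d2 d3.
  by rewrite (linZ (lmg1 h1)).
(* Legs: the first factor on 0 to 2, U on 3, S on 4 to 6, Ubar on 7. *)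
pose F8 (l : seq A) := (U l`_3 * Ub l`_7 * g (l`_0 ⊗ S l`_6) * gb (l`_2 ⊗ S l`_4) : C) *: (l`_1 · S l`_5).
transitivity (swA 8 h F8).
  pose F6 (l : seq A) := swA 3 l`_0 (fun m : seq A =>
   (U l`_1 * Ub l`_5 * g (m`_0 ⊗ S l`_4) * gb (m`_2 ⊗ S l`_2) : C) *: (m`_1 · S l`_3)).
  transitivity (swA 6 h F6).
    apply: esym; rewrite /F6; swlocal cA (2, 3, 1, 1)%N.
    rewrite mulgS sw_swap (sw_map _ _ _ _ _ (@lin_scaler _ _ _)); apply: eq_sw => m sm.
    rewrite (sw_map _ _ _ _ _ (@lin_scaler _ _ _)); apply: eq_sw => n sn.
    by deseq m sm; deseq n sn; rewrite scalerA /= !mulrA.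
  apply: esym; rewrite /F6 /F8; swlocal cA (0, 3, 1, 5)%N.
transitivity (swA 5 h (fun l : seq A => (g (l`_0 ⊗ S l`_3) * Ub l`_4 : C) *: (l`_1 · S l`_2))).
  rewrite /F8; swlocal cA (2, 3, 0, 3)%N.
  rewrite -contract_gb_Ucoc [RHS](sw_map _ _ _ _ _ (lin_scalel _)); apply: eq_sw => m sm; deseq m sm.
  by rewrite scalerA /=; congr (_ *: _); ring.
transitivity (swA 3 h (fun l : seq A => (g (l`_0 ⊗ S l`_1) * Ub l`_2 : C) *: 1A)).
  swlocal cA (1, 2, 0, 2)%N.
  by rewrite (mul_antipodeF (F := fun w => (g (u ⊗ S u0) * Ub u1 : C) *: w)) //; lintac.
rewrite (sw3E cA); last by swlin.
rewrite -conv_Ucoc_Ubar /conv [RHS](tlift_lin _ _ (lin_scalel _)).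
apply: eq_tlift => a b.
by rewrite /Ucoc (tlift_lin (U := C^o) _ _ (lin_mull _)) (tlift_lin _ _ (lin_scalel _)).
Qed.

Lemma deform_is_hopf : is_hopf_algebra Hg.
Proof.
have [[_ hc [h1 _] [h2 _]] _ _ _] := hH.
split; [split|split|exact: antipodeg_l|exact: antipodeg_r].
- split; [split; [exact: mulg_linr|exact: mulg_linl]|exact: mulgA|exact: mulg1l|exact: mulg1r].
- exact: hc.
- by split; [exact: h1|exact: coprod_mulg].
- by split; [exact: h2|exact: counit_mulg].
- exact: lin_antipodeg.
- exact: bij_antipodeg.
Qed.

(** * The deformed involution of the Hopf algebra *)

Hypothesis hS : is_hopf_star_algebra H.
Hypothesis hu : is_unitary_cocycle H g gb.

Local Notation st := (hstar H).

Let cst : conj_linear st. Proof. by case: hS => _ []. Qed.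
Lemma starK : involutive st. Proof. by case: hS => _ []. Qed.
Lemma starM a b : st (a · b) = st b · st a. Proof. by case: hS. Qed.

Lemma coprod_starF (W : lmodType C) (F : A -> A -> W) a : bil F ->
  tlift F (Δ (st a)) = \sw_(a1, a2 <- Δ a) F (st a1) (st a2).
Proof.
move=> bF; have [_ _ _ ->] := hS; rewrite tlift_tlift //.
by apply: eq_tlift => x y; rewrite tliftE.
Qed.

Lemma star1 : st 1A = 1A.
Proof. by rewrite -[LHS](hmul1l) -[X in X · _]starK -starM hmul1l // starK. Qed.

Lemma conj_tlift (V1 V2 : lmodType C) (F : V1 -> V2 -> C^o) t :
  (tlift F t : C)^* = tlift (fun x y => (F x y : C)^* : C^o) t.
Proof. exact: rmorph_sum. Qed.

(** The conjugate of ε(a^* ) satisfies the counit axiom. *)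
Lemma counit_star a : counit H (st a) = (counit H a)^*.
Proof.
pose f a : C^o := (counit H (st a))^*.
have lf : lin f.
  move=> c u v; rewrite /f cst lε rmorphD /= rmorphM /=; congr (_ * _ + _); exact: conjCK.
suff : f a = counit H a by rewrite /f => <-; rewrite conjCK.
rewrite -[LHS](counitrF) //.
have {2}<- : \sw_(a1, a2 <- Δ a) ((f a1 : C) *: a2) = a.
  rewrite -[RHS]starK -[st a](act_counit (let: And3 _ h _ := cA in h)) /act.
  rewrite coprod_starF; last by lintac.
  rewrite (cj_tlift cst); apply: eq_tlift => x y.
  by rewrite (cjZ cst) starK.
rewrite (tlift_lin _ _ lε); apply: eq_tlift => x y.
by rewrite (linZ lε) /GRing.scale /= mulrC.
Qed.

(** The map T(a) = S(a^* )^* satisfies T(a2) a1 = ε(a), the axiom of the inverse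
    antipode. *)
Lemma antipode_starK a : S (st (S (st a))) = a.
Proof.
pose T a := st (S (st a)).
have lT : lin T.
  by move=> c u v; rewrite /T cst lS cst conjCK.
have hT x : \sw_(a1, a2 <- Δ x) (T a2 · a1) = counit H x *: 1A.
  transitivity (st (\sw_(y1, y2 <- Δ (st x)) (y1 · S y2))); last first.
    by rewrite mul_antipode (cjZ cst) counit_star conjCK star1.
  rewrite coprod_starF; last by lintac.
  by rewrite (cj_tlift cst); apply: eq_tlift => a1 a2; rewrite starM starK.
have hT' x : \sw_(a1, a2 <- Δ x) (S a1 · S (T a2)) = counit H x *: 1A.
  have := congr1 S (hT x); rewrite (linZ lS) antipode1 (tlift_lin _ _ lS) => <-.
  by apply: eq_tlift => a1 a2; rewrite antipodeM.
rewrite -/(T a); transitivity (\sw_(x, a3 <- Δ a) \sw_(a1, a2 <- Δ x) ((a1 · S a2) · S (T a3))).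
  rewrite -[LHS](counitlF (F := fun z => S (T z))); last by lintac.
  apply: eq_tlift => x a3; rewrite (mul_antipodeF (F := fun z => z · S (T a3))) ?hmul1l //.
rewrite coassocF; last by lintac.
rewrite -[RHS](counitrF (F := fun z => z)) //; apply: eq_tlift => a1 y.
rewrite -[a1 in RHS](hmul1r) -(linZ (lmr _)) -hT' (tlift_lin _ _ (lmr _)).
by apply: eq_tlift => a2 a3; rewrite hmulA.
Qed.

Lemma star_antipode a : st (S a) = s (st a).
Proof. by apply: (can_inj antipodeK); rewrite antipode_invK -{1}[a]starK antipode_starK. Qed.

Lemma antipode_inv_star a : s (st (s a)) = st a.
Proof. by rewrite -star_antipode antipode_invK. Qed.

Lemma conj_g x y : (g (st x ⊗ st y))^* = gb (s x ⊗ s y).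
Proof. by rewrite hu !star_antipode !starK. Qed.

Lemma conj_gb x y : (gb (st x ⊗ st y))^* = g (s x ⊗ s y).
Proof. by rewrite -[RHS]conjCK hu !antipode_invK. Qed.

Lemma conj_Vbar a : (Vb (st a) : C)^* = V a.
Proof.
rewrite VbarE VcocE (coprod_starF (W := C^o)); last by lintac.
rewrite conj_tlift; apply: eq_tlift => x y.
by rewrite -[s (st x)]starK conj_gb antipode_inv_star starK.
Qed.

Lemma conj_Vcoc a : (V (st a) : C)^* = Vb a.
Proof. by rewrite -conj_Vbar starK conjCK. Qed.

Lemma gbsE x y : gb (s y ⊗ s x) = gbs (x ⊗ y).
Proof. by rewrite /gbs aflipE. Qed.

Lemma stargE h : hstar Hg h = tw Δ Vb V (st h).
Proof.
rewrite (twE cA) // coprod_starF; last by lintac.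
by apply: eq_tlift => h1 h'; rewrite coprod_starF //; lintac.
Qed.

Lemma star_starg h : st (hstar Hg h) = tw Δ V Vb h.
Proof.
rewrite (twE cA) // (cj_tlift cst); apply: eq_tlift => h1 h'.
rewrite (cj_tlift cst); apply: eq_tlift => h2 h3.
rewrite (cjZ cst) starK rmorphM /=; congr ((_ * _) *: _); [exact: conj_Vbar|exact: conj_Vcoc].
Qed.

Lemma stargK : involutive (hstar Hg).
Proof.
move=> h; rewrite stargE star_starg (tw_tw cA) //.
by rewrite conv_Vcoc_Vbar (tw1 cA).
Qed.

Lemma conj_linear_starg : conj_linear (hstar Hg).
Proof.
have h := lin_tw cA lVb lV.
by move=> c u v; rewrite !stargE cst h.
Qed.

Let lgs : lin gs.
Proof. by have h := lin_aflip ls; rewrite /gs; lintac. Qed.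
Let lgbs : lin gbs.
Proof. by have h := lin_aflip ls; rewrite /gbs; lintac. Qed.
Let lVbVb : lin (ptensor Vb Vb). Proof. exact: lin_ptensor. Qed.
Let lVV : lin (ptensor V V). Proof. exact: lin_ptensor. Qed.
Let lVbM : lin (fun t => Vb (M t) : C^o). Proof. by lintac. Qed.
Let lVM : lin (fun t => V (M t) : C^o). Proof. by lintac. Qed.

(** The involution turns γ and γbar into [gbs] and [gs] and reverses the product. *)
Lemma star_mulg a b : st (mul a b) = M (tw Δ2 gbs gs (st b ⊗ st a)).
Proof.
transitivity (\sw_(b1, b' <- Δ b) \sw_(a1, a' <- Δ a) \sw_(b2, b3 <- Δ b') \sw_(a2, a3 <- Δ a')
   ((gbs (st b1 ⊗ st a1) * gs (st b3 ⊗ st a3) : C) *: (st b2 · st a2))).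
  rewrite [RHS]tlift_swap (cj_tlift cst); apply: eq_tlift => a1 a'.
  rewrite (cj_tlift cst); under [RHS]eq_tlift => b1 b' do rewrite tlift_swap.
  rewrite [RHS]tlift_swap; apply: eq_tlift => a2 a3.
  rewrite (cj_tlift cst); apply: eq_tlift => b1 b'.
  rewrite (cj_tlift cst); apply: eq_tlift => b2 b3.
  rewrite (cjZ cst) starM rmorphM /=; congr ((_ * _) *: _).
    by rewrite -gbsE -conj_g !starK.
  by rewrite /gs aflipE // -conj_gb !starK.
rewrite (twE c2) // (tlift_lin _ _ lM) tcoactE //; last by lintac.
rewrite coprod_starF; last by lintac.
apply: eq_tlift => b1 b'; rewrite coprod_starF; last by lintac.
apply: eq_tlift => a1 a'; rewrite (tlift_lin _ _ lM) tcoactE //; last by lintac.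
rewrite coprod_starF; last by lintac.
apply: eq_tlift => b2 b3; rewrite coprod_starF; last by lintac.
by apply: eq_tlift => a2 a3; rewrite (linZ lM) hmulE.
Qed.

(** After [star_mulg] both sides are twists of one tensor; the left functionals
    agree by [Vbar_hmul] and the right ones by [Vcoc_hmul]. *)
Lemma stargM a b : hstar Hg (mul a b) = mul (hstar Hg b) (hstar Hg a).
Proof.
rewrite !stargE star_mulg mulgE // (tw_morph _ _ _ _ _ _ cmorph_hmul) //.
by rewrite -(tw_ptensor _ _ cA cA) // !(tw_tw c2) // Vbar_hmul Vcoc_hmul.
Qed.

Lemma coprod_starg a : Δ (hstar Hg a) = \sw_(a1, a2 <- Δ a) (hstar Hg a1 ⊗ hstar Hg a2).
Proof.
have ht := lin_tw cA lVb lV.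
rewrite -[LHS]tlift_eta stargE (tw_coprod cA) //; [|exact: conv_Vcoc_Vbar|by lintac].
rewrite coprod_starF; last by lintac.
by apply: eq_tlift => x y; rewrite !stargE.
Qed.

Lemma deform_is_hopf_star : is_hopf_star_algebra Hg.
Proof.
split; [exact: deform_is_hopf|split|exact: stargM|exact: coprod_starg].
  exact: conj_linear_starg.
exact: stargK.
Qed.

(** * Deformed comodule algebras *)

Section ComoduleAlgebra.
Variables (B : lmodType C) (X : alg_data B) (dB : B -> tensor A B).
Hypothesis cX : is_comodule_algebra H X dB.

Local Notation mB := (tlift (amul X)).
Local Notation δ2 := (tcoact dB dB).
Local Notation δ3 := (tcoact δ2 dB).
Local Notation mg := (deform_mul g dB dB (amul X)).
Local Notation Xg := (AlgData (aone X) mg).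

Let cB : comod Δ ε dB.
Proof. by case: cX => _ h _ _; apply: comod_of. Qed.
Let lB : lin dB. Proof. by case: cB. Qed.
Let ml : forall v, lin (amul X v). Proof. by case: cX => [[[h _] _ _ _] _ _ _]; exact: h. Qed.
Let mr : forall w, lin (fun v => amul X v w). Proof. by case: cX => [[[_ h] _ _ _] _ _ _]; exact: h. Qed.
Let lm : lin mB. Proof. by lintac. Qed.
Let cB2 : comod Δ2 ε2 δ2. Proof. exact: tcoact_comod. Qed.
Let lB2 : lin δ2. Proof. exact: lin_tcoact. Qed.
Let lB3 : lin δ3. Proof. exact: lin_tcoact. Qed.

Lemma cmulE v w : mB (v ⊗ w) = amul X v w.
Proof. by rewrite tliftE //; lintac. Qed.

Lemma cmorph_cmul : cmorph M mB δ2 dB.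
Proof.
move=> t; apply: (tensor_lin_ext (f := fun t => dB (mB t))
  (h := fun t => \sw_(a, b <- δ2 t) (M a ⊗ mB b))) => [||x y]; [by lintac|by lintac|].
have [_ _ _ h] := cX.
rewrite cmulE h tcoactE //; last by lintac.
by apply: eq_tlift => a v; apply: eq_tlift => b w; rewrite hmulE cmulE.
Qed.

Lemma deform_mulE v w : mg v w = mB (act δ2 g (v ⊗ w)).
Proof.
rewrite (act_tensor cB cB) // (tlift_lin _ _ lm); apply: eq_tlift => a v0.
by rewrite (tlift_lin _ _ lm); apply: eq_tlift => b w0; rewrite (linZ lm) cmulE.
Qed.

Let lag : lin (act δ2 g). Proof. exact: lin_act. Qed.

Lemma deform_mul_linr v : lin (mg v).
Proof. by rewrite (_ : mg v = fun w => mB (act δ2 g (v ⊗ w))); [lintac|apply/funext => w; exact: deform_mulE]. Qed.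
Lemma deform_mul_linl w : lin (fun v => mg v w).
Proof. by rewrite (_ : mg^~ w = fun v => mB (act δ2 g (v ⊗ w))); [lintac|apply/funext => v; exact: deform_mulE]. Qed.

Lemma deform_mulA : associative mg.
Proof.
have lmi : lin (tmap mB (@id B)) by exact: lin_tmap.
have lim : lin (tmap (@id B) mB) by exact: lin_tmap.
have cmi : cmorph (tmap M (@id A)) (tmap mB (@id B)) δ3 δ2.
  by apply: cmorph_tmap => //; [exact: cmorph_cmul | exact: cmorph_id].
have cim : cmorph (tmap (@id A) M) (tmap (@id B) mB) (tcoact dB δ2) δ2.
  by apply: cmorph_tmap => //; [exact: cmorph_id | exact: cmorph_cmul].
have cB3 : comod Δ3 (ptensor ε2 ε) δ3 by exact: tcoact_comod.
have cB3' : comod Δ3' (ptensor ε ε2) (tcoact dB δ2) by exact: tcoact_comod.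
move=> v w z.
transitivity (mB (tmap mB id (act δ3 cocl ((v ⊗ w) ⊗ z)))); last first.
  rewrite !deform_mulE; congr (mB _).
  rewrite -[mB _ ⊗ z](tmapE (h := id)) // (act_morph lmi _ lg cmi).
  by rewrite (act_tensorl cA cB2 cB) // (act_act cB3).
transitivity (mB (tmap id mB (act (tcoact dB δ2) cocr (v ⊗ (w ⊗ z))))).
  rewrite !deform_mulE; congr (mB _).
  rewrite -[v ⊗ mB _](tmapE (f := id)) // (act_morph lim _ lg cim).
  by rewrite (act_tensorr cA cB cB2) // (act_act cB3').
rewrite -tassocE (act_morph (@lta B B B) _ lcr (@cmorph_tassoc _ _ _ _ _ _ _ _ _ _ lB lB lB)) -coclE.
have [[_ Xa _ _] _ _ _] := cX.
apply: (tensor3_ext (f := fun t => mB (tmap id mB (tassoc t))) (h := fun t => mB (tmap mB id t))); [by lintac|by lintac|].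
by move=> a b c; rewrite tassocE !tmapE // !cmulE Xa.
Qed.

Lemma deform_mul1 : left_id (aone X) mg.
Proof.
have [[_ _ m1 _] _ d1 _] := cX; move=> v.
rewrite /deform_mul d1 tliftE; last by lintac.
under eq_tlift => a v0 do rewrite g1l m1.
exact: (act_counit cB).
Qed.

Lemma deform_mulr1 : right_id (aone X) mg.
Proof.
have [[_ _ _ m1] _ d1 _] := cX; move=> v.
rewrite -[RHS](act_counit cB) /deform_mul; apply: eq_tlift => a v0.
by rewrite d1 tliftE ?g1r ?m1 //; lintac.
Qed.

Lemma deform_is_algebra : is_algebra (AlgData (aone X) mg).
Proof.
split; [split|exact: deform_mulA|exact: deform_mul1|exact: deform_mulr1].
- exact: deform_mul_linr.
- exact: deform_mul_linl.
Qed.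

Lemma coact_deform_mul v w : dB (mg v w) =
  \sw_(a, v0 <- dB v) \sw_(b, w0 <- dB w) (mul a b ⊗ mg v0 w0).
Proof.
have lr : lin (act (cop Δ2) g) by apply: lin_act => //; exact: lin_cop.
have la' : lin (act Δ2 g) by exact: lin_act.
transitivity (\sw_(d, t <- δ2 (v ⊗ w)) (M (T2 d) ⊗ mB (act δ2 g t))); last first.
  rewrite tcoactE //; last by lintac.
  by apply: eq_tlift => a v0; apply: eq_tlift => b w0; rewrite mulgE deform_mulE.
rewrite -(coact_actr cB2 (F := fun d t => M (T2 d) ⊗ mB t)) //; last by lintac.
rewrite deform_mulE cmorph_cmul (coact_actl cB2) //; last by lintac.
apply: eq_tlift => d t; rewrite /tw (ract_conv c2) // gbg.
by have [_ mc _] := coalg_cop c2; rewrite (act_counit mc).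
Qed.

Lemma deform_is_comodule_algebra : is_comodule_algebra Hg Xg dB.
Proof.
have [_ h1 h2 _] := cX.
split; [exact: deform_is_algebra|exact: h1|exact: h2|exact: coact_deform_mul].
Qed.

Variable bst : B -> B.
Hypotheses (cb : conj_linear bst) (bK : involutive bst).
Hypothesis db : forall b, dB (bst b) = \sw_(a, b0 <- dB b) (st a ⊗ bst b0).
Local Notation dst := (deform_star H gb dB bst).

Lemma coact_starF (U : lmodType C) (F : A -> B -> U) b : bil F ->
  tlift F (dB (bst b)) = \sw_(a, b0 <- dB b) F (st a) (bst b0).
Proof.
move=> bF; rewrite db tlift_tlift //.
by apply: eq_tlift => x y; rewrite tliftE.
Qed.

(** Rewriting the conjugate-linear coefficients as the action on v^* makes the
    linear machinery applicable to the involution. *)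
Lemma deform_starE v : dst v = act dB Vb (bst v).
Proof. by rewrite /act coact_starF //; lintac. Qed.

Lemma star_deform_star v : bst (dst v) = act dB V v.
Proof.
rewrite (cj_tlift cb); apply: eq_tlift => a v0.
by rewrite (cjZ cb) bK conj_Vbar.
Qed.

Lemma deform_starK : involutive dst.
Proof.
by move=> v; rewrite deform_starE star_deform_star (act_act cB) // conv_Vcoc_Vbar (act_counit cB).
Qed.

Lemma conj_linear_deform_star : conj_linear dst.
Proof.
have la : lin (act dB Vb) by exact: lin_act.
by move=> c u v; rewrite !deform_starE cb la.
Qed.

Lemma coact_deform_star v : dB (dst v) = \sw_(a, v0 <- dB v) (hstar Hg a ⊗ dst v0).
Proof.
have la : lin (act dB Vb) by exact: lin_act.
have lt := lin_tw cA lVb lV.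
transitivity (\sw_(a, x <- dB (bst v)) (tw Δ Vb V a ⊗ act dB Vb x)); last first.
  rewrite coact_starF; last by lintac.
  by apply: eq_tlift => a v0; rewrite stargE deform_starE.
rewrite -(coact_actr cB (F := fun a x => tw Δ Vb V a ⊗ x)) //; last by lintac.
rewrite deform_starE -[LHS]tlift_eta (coact_actl cB) //; last exact: bil_tpure.
apply: eq_tlift => a x; rewrite /tw (ract_conv cA) // conv_Vcoc_Vbar.
by have [_ mc _] := coalg_cop cA; rewrite (act_counit mc).
Qed.

(** The scalar c is 1 for B and the sign of the degrees for forms.  As the old
    rule only holds on P and Q, the old product is first replaced by the bilinear
    map n that agrees with it there and obeys the rule everywhere. *)
Lemma deform_star_mul (P Q : set B) (c : C) v w :
  coaction_stable dB P -> coaction_stable dB Q ->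
  (forall v w, P v -> Q w -> bst (amul X v w) = c *: amul X (bst w) (bst v)) ->
  P v -> Q w -> dst (mg v w) = c *: mg (dst w) (dst v).
Proof.
move=> sP sQ h Pv Qw.
(* Conjugate-linear twice, hence bilinear. *)
pose n x y := bst (c *: amul X (bst y) (bst x)).
have bn : bil n.
  split=> x k u u'; rewrite /n cb.
    by rewrite mr scalerDr scalerA mulrC -scalerA cb conjCK.
  by rewrite ml scalerDr scalerA mulrC -scalerA cb conjCK.
have e : mg v w = deform_mul g dB dB n v w.
  apply: (eq_deform_mul lg sP sQ) => // x y Px Qy.
  by rewrite /n -h // bK.
have la : lin (act dB Vb) by exact: lin_act.
(* By unitarity conjugating the coefficient γ gives gbs of the starred legs. *)
have e2 : bst (mg v w) = c *: mB (act δ2 gbs (bst w ⊗ bst v)).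
  rewrite e (act_tensor cB cB) // (tlift_lin _ _ lm) coact_starF; last by lintac.
  rewrite (tlift_lin _ _ (@lin_scaler _ _ _)) (cj_tlift cb).
  under eq_tlift => a v0 do rewrite (cj_tlift cb).
  rewrite tlift_swap; apply: eq_tlift => b w0.
  rewrite (tlift_lin _ _ lm) coact_starF; last by lintac.
  rewrite (tlift_lin _ _ (@lin_scaler _ _ _)); apply: eq_tlift => a v0.
  rewrite (cjZ cb) /n bK (linZ lm) tliftE; last by lintac.
  rewrite !scalerA mulrC; congr (_ * _ *: _).
  by rewrite -gbsE -conj_g !starK.
rewrite deform_starE e2 (linZ la); congr (_ *: _).
rewrite (act_morph lm _ lVb cmorph_cmul) (act_act cB2) // Vbar_hmul.
rewrite -(act_act cB2) // (act_ptensor cB cB) // -!deform_starE.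
by rewrite deform_mulE.
Qed.

End ComoduleAlgebra.

Section ComodStarAlgebra.
Variables (B : lmodType C) (X : comod_alg_data A B).
Hypothesis hX : is_comodule_star_algebra H X.

Lemma deform_is_comodule_star_algebra :
  is_comodule_star_algebra Hg (deform_comod_alg H g gb X).
Proof.
have [cX [cb bK] bM db] := hX.
split; [exact: deform_is_comodule_algebra|split| |].
- exact: (conj_linear_deform_star cX).
- exact: (deform_starK cX).
- move=> a b; rewrite -[RHS]scale1r.
  apply: (deform_star_mul cX cb bK db (P := setT) (Q := setT)) => //; try exact: stable_setT.
  by move=> v w _ _; rewrite scale1r.
- exact: (coact_deform_star cX).
Qed.
End ComodStarAlgebra.

(** * The deformed calculus *)

Variables (B Om : lmodType C) (X : comod_alg_data A B) (O : calculus_data A B Om).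
Hypothesis hX : is_comodule_star_algebra H X.
Hypothesis hO : is_covariant_star_calculus H X O.

Local Notation Xg := (deform_comod_alg H g gb X).
Local Notation Og := (deform_calculus H g gb X O).
Local Notation δ := (mcoact (omod O)).
Local Notation mO := (amul O).
Local Notation mg := (amul Og).
Local Notation inc := (oinc O).
Local Notation d := (odiff O).

Let cO : is_comodule_algebra H O δ. Proof. by case: hO => [[]]. Qed.
Let cX : is_comodule_algebra H X (bcoact X). Proof. by case: hX. Qed.
Let cδ : comod Δ ε δ. Proof. by case: cO => _ h _ _; apply: comod_of. Qed.
Let cB : comod Δ ε (bcoact X). Proof. by case: cX => _ h _ _; apply: comod_of. Qed.
Let lδ : lin δ. Proof. by case: cδ. Qed.
Let lB : lin (bcoact X). Proof. by case: cB. Qed.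
Let linc : lin inc. Proof. by case: hO => [[[_ [h _ _ _ _] _] _ _ _ _]]. Qed.
Let ld : lin d. Proof. by case: hO => [[[[_ _ _ [h _] _] _ _] _ _ _ _]]. Qed.
Let inc_coact : cmorph id inc (bcoact X) δ.
Proof. by case: hO => [[_ _ h _ _]]. Qed.
Let d_coact : cmorph id d δ δ.
Proof. by case: hO => [[_ _ _ _ h]]. Qed.
Let id_coact : cmorph id id δ δ. Proof. exact: cmorph_id. Qed.
Let ml : forall v, lin (mO v). Proof. by case: cO => [[[h _] _ _ _] _ _ _]; exact: h. Qed.
Let mr : forall w, lin (fun v => mO v w). Proof. by case: cO => [[[_ h] _ _ _] _ _ _]; exact: h. Qed.
Let bm : bil mO. Proof. by split. Qed.
Let sub_deg k : is_subcomodule δ (odeg O k).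
Proof. by case: hO => [[_ _ _ [_ _ /(_ k) [[_ h] _ _ _ _]] _]]. Qed.
Let algO := deform_is_algebra cO.
Let lgl v : lin (mg v). Proof. exact: (deform_mul_linr cO). Qed.
Let lgr w : lin (fun v => mg v w). Proof. exact: (deform_mul_linl cO). Qed.
Let lgl' v : lin (deform_mul g δ δ mO v) := @lgl v.
Let lgr' w : lin (fun v => deform_mul g δ δ mO v w) := @lgr w.

Lemma mem_wedgeg (P Q T : set Om) v w : coaction_stable δ P -> coaction_stable δ Q ->
  subspace T -> P v -> Q w -> (forall v w, P v -> Q w -> T (mO v w)) -> T (mg v w).
Proof. by move=> sP sQ sT Pv Qw h; exact: (mem_deform_mul lg sP sQ). Qed.

Lemma oinc_mulg a b : inc (amul Xg a b) = mg (inc a) (inc b).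
Proof.
have [[[_ [_ _ _ _ h] _] _ _ _ _] _ _ _ _] := hO.
rewrite (lin_deform_mul _ _ _ _ _ _ linc) [RHS](deform_mul_colin lg _ _ inc_coact inc_coact) //.
by congr deform_mul; apply/funext => x; apply/funext => y; exact: h.
Qed.

(** The bimodule structure of forms is multiplication by elements of degree 0, so
    its axioms are those of the deformed algebra of forms. *)
Lemma lactgE b w : lact (omod Og) b w = mg (inc b) w.
Proof.
have [[_ _ _ [h _ _] _] _ _ _ _] := hO.
rewrite [RHS](deform_mul_colin lg _ _ inc_coact id_coact) //.
by congr deform_mul; apply/funext => x; apply/funext => y; exact: h.
Qed.

Lemma ractgE w b : ract (omod Og) w b = mg w (inc b).
Proof.
have [[_ _ _ [_ h _] _] _ _ _ _] := hO.
rewrite [RHS](deform_mul_colin lg _ _ id_coact inc_coact) //.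
by congr deform_mul; apply/funext => x; apply/funext => y; exact: h.
Qed.

Lemma coact_incF (U' : lmodType C) (F : A -> Om -> U') b : bil F ->
  tlift F (δ (inc b)) = \sw_(a, b0 <- bcoact X b) F a (inc b0).
Proof.
by move=> bF; rewrite inc_coact tlift_tlift //; apply: eq_tlift => x y; rewrite tliftE.
Qed.

Lemma deform_bimodule k : is_hopf_bimodule Hg Xg (omod Og) (odeg O k).
Proof.
have [[[_ [_ _ _ i1 _] _] _ _ [e1 e2 hk] _] _ _ _ _] := hO.
have [[hc hs] [_ l2 _ _] [_ r2 _ _] _ _] := hk k.
have [_ sk] := sub_deg k; have [sbk _] := sub_deg k.
have [_ mA m1l m1r] := algO.
have sB := stable_setT (bcoact X).
have bl : bil (lact (omod O)).
  by split=> b c u v; rewrite !e1 ?ml // linc mr.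
have br : bil (ract (omod O)).
  by split=> b c u v; rewrite !e2 ?mr // linc ml.
split.
- by split; [exact: hc|exact: hs].
- split; [split=> [b|m] c u v|..].
  + by rewrite !lactgE lgl.
  + by rewrite !lactgE linc lgr.
  + by move=> b m Pm; apply: (mem_deform_mul lg sB sk) => // x y _; exact: l2.
  + by move=> m _; rewrite lactgE i1; exact: m1l.
  + by move=> a b m _; rewrite !lactgE oinc_mulg; exact: esym (mA _ _ _).
- split; [split=> [m|b] c u v|..].
  + by rewrite !ractgE linc lgl.
  + by rewrite !ractgE lgr.
  + by move=> m b Pm; apply: (mem_deform_mul lg sk sB) => // x y Px _; exact: r2.
  + by move=> m _; rewrite ractgE i1; exact: m1r.
  + by move=> m a b _; rewrite !ractgE oinc_mulg; exact: mA.
- by move=> a m b _; rewrite !lactgE !ractgE; exact: esym (mA _ _ _).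
- split=> [b m _|m b _].
    rewrite lactgE [LHS](coact_deform_mul cO) coact_incF; last by lintac.
    by apply: eq_tlift => x b0; apply: eq_tlift => y m0; rewrite lactgE.
  rewrite ractgE [LHS](coact_deform_mul cO); apply: eq_tlift => y m0.
  rewrite coact_incF; last by lintac.
  by apply: eq_tlift => x b0; rewrite ractgE.
Qed.

(** The old product is the twist of the new one by γbar.  So if P is closed under
    the new product, the forms whose coaction lies in A ⊗ P are closed under the
    old one; they contain the old generators, hence are everything, and the counit
    shows that they lie in P. *)
Lemma deform_generated (P : set Om) : is_subalgebra Og P ->
  (forall b, P (inc b)) -> (forall b, P (d (inc b))) -> forall w, P w.
Proof.
move=> [sP P1 PM] PB Pd.
have [[[_ _ gen] _ _ _ _] _ _ _ _] := hO.
have [_ _ o1 _] := cO.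
have sT := @subspace_tensor_in C A Om P.
have [T0 TD] := sT.
pose Q : set Om := fun w => tensor_in P (δ w).
have QP w : Q w -> P w.
  move=> Qw; rewrite -[w](act_counit cδ); apply: (mem_tensor_in _ _ Qw) => //; first by lintac.
  by move=> a v0 Pv0; exact: subspaceZ.
move=> w; apply: QP; apply: (gen Q) => [|b|b].
- split; first split.
  + by rewrite /Q (lin0 lδ).
  + by move=> c u v Qu Qv; rewrite /Q lδ; exact: TD.
  + by rewrite /Q o1; exact: pure_tensor_in.
  + move=> v z Qv Qz.
    have la : lin (act (tcoact δ δ) g) by apply: lin_act => //; exact: lin_tcoact.
    have lr : lin (act (cop Δ2) gb) by apply: lin_act => //; exact: lin_cop.
    have c2O := tcoact_comod cA cA cδ cδ.
    have lmO : lin (tlift mO) by lintac.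
    (* γ ▷ (γbar ▷ (v ⊗ z)) = v ⊗ z, with γbar moved to the coaction leg. *)
    rewrite /Q; have -> : δ (mO v z) = \sw_(a, v0 <- δ v) \sw_(b, z0 <- δ z)
        (M (act (cop Δ2) gb (a ⊗ b)) ⊗ mg v0 z0).
      transitivity (\sw_(a, t <- tcoact δ δ (v ⊗ z)) (M (act (cop Δ2) gb a) ⊗ tlift mO (act (tcoact δ δ) g t))); last first.
        rewrite tcoactE //; last by lintac.
        by apply: eq_tlift => a v0; apply: eq_tlift => b z0; rewrite -(deform_mulE cO).
      rewrite (coact_actr c2O (F := fun a t => M a ⊗ tlift mO (act (tcoact δ δ) g t))) //; last by lintac.
      rewrite -(cmulE cO) (cmorph_cmul cO); apply: eq_tlift => a t.
      by rewrite (act_act c2O) // gbg (act_counit c2O).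
    apply: (mem_tensor_in _ _ Qv) => //; first by lintac.
    move=> a v0 Pv0; apply: (mem_tensor_in _ _ Qz) => //; first by lintac.
    by move=> b z0 Pz0; apply: pure_tensor_in; exact: PM.
- rewrite /Q inc_coact; apply: subspace_sum => // x _; exact: pure_tensor_in.
- rewrite /Q d_coact coact_incF; last by lintac.
  by apply: subspace_sum => // x _; exact: pure_tensor_in.
Qed.

Lemma deform_dga : is_dga Og.
Proof.
have [[[[_ hd [d1 dM] [_ dl] [dd dL]] _ _] _ _ _ _] _ _ _ _] := hO.
split.
- exact: algO.
- exact: hd.
- split; first exact: d1.
  move=> k l w h Pw Ph.
  have [[_ sk] [_ sl] [sT _]] := And3 (sub_deg k) (sub_deg l) (sub_deg (k + l)).
  by apply: (mem_wedgeg sk sl) => // x y; exact: dM.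
- by split; [exact: ld|exact: dl].
- split; first exact: dd.
  move=> k w h Pw; have [_ sk] := sub_deg k.
  rewrite (lin_deform_mul _ _ _ _ _ _ ld).
  pose n v z := mO (d v) z + (-1) ^+ k *: mO v (d z).
  rewrite (eq_deform_mul lg sk (stable_setT δ) (n := n)) //; last first.
    by move=> v z Pv _; exact: dL.
  - by rewrite /n; split=> x c u v; rewrite ?ld ?(ml, mr) ?ld ?(ml, mr) !scalerDr !scalerA [c * _]mulrC addrACA.
  - by lintac.
  rewrite deform_mulD; congr (_ + _ *: _).
    by rewrite [RHS](deform_mul_colin lg _ _ d_coact id_coact).
  by rewrite [RHS](deform_mul_colin lg _ _ id_coact d_coact).
Qed.

Lemma deform_covariant_calculus : is_covariant_calculus Hg Xg Og.
Proof.
have [[[_ [i1 i2 i3 i4 _] _] _ ci _ cd] _ _ _ _] := hO.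
split; [split|..].
- exact: deform_dga.
- by split=> //; exact: oinc_mulg.
- exact: deform_generated.
- exact: (deform_is_comodule_algebra cO).
- exact: ci.
- by split; [exact: lactgE|exact: ractgE|exact: deform_bimodule].
- exact: cd.
Qed.

Let cs : conj_linear (ostar O). Proof. by case: hO => _ []. Qed.
Let sK : involutive (ostar O). Proof. by case: hO => _ []. Qed.
Let sco : forall w, δ (ostar O w) = \sw_(a, w0 <- δ w) (st a ⊗ ostar O w0).
Proof. by case: hO. Qed.

Lemma ostargE w : ostar Og w = act δ Vb (ostar O w).
Proof. exact: (deform_starE sco). Qed.

Lemma mem_ostarg (P Q : set Om) w : is_subcomodule δ Q -> (forall v, P v -> Q (ostar O v)) ->
  P w -> Q (ostar Og w).
Proof.
move=> [sQ cQ] h Pw; rewrite ostargE; apply: (mem_tensor_in _ _ (cQ _ (h _ Pw))) => //; first by lintac.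
by move=> a v0 Qv0; exact: subspaceZ.
Qed.

Lemma ostargK : involutive (ostar Og).
Proof. exact: (deform_starK cO). Qed.

Lemma deform_covariant_star_calculus : is_covariant_star_calculus Hg Xg Og.
Proof.
have [_ [_ _ si sd] scd sMul _] := hO.
split.
- exact: deform_covariant_calculus.
- split.
  + exact: (conj_linear_deform_star cO).
  + exact: ostargK.
  + move=> b; rewrite ostargE si (act_morph linc _ lVb inc_coact).
    have [_ _ _ db] := hX.
    by rewrite [bstar Xg b](deform_starE db).
  + by move=> k w; apply: (mem_ostarg (sub_deg k)) => v; exact: sd.
- by move=> w; rewrite !ostargE scd (act_morph ld _ lVb d_coact).
- move=> k l w h Pw Ph; have [[_ sk] [_ sl]] := (sub_deg k, sub_deg l).
  by apply: (deform_star_mul cO cs sK sco sk sl) => // x y; exact: sMul.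
- exact: (coact_deform_star cO).
Qed.

(** * The deformed complex structure *)

Variable K : complex_data Om.
Hypothesis hK : is_complex_structure O K.
Hypothesis cK : forall p q, is_subcomodule δ (bideg K (p, q)).

(** Only products and the involution have changed, and both preserve the
    subcomodules in question; that the involution maps onto follows from its being
    its own inverse. *)
Lemma deform_complex_structure : is_complex_structure Og (deform_complex K).
Proof.
have [h1 [h2 h3] h4 h5 h6] := hK.
split; [exact: h1|split| |exact: h5|exact: h6].
- exact: h2.
- move=> p q p' q' w h Pw Ph.
  have [[_ s1'] [_ s2]] := (cK p q, cK p' q'); have [s3 _] := cK (p + p') (q + q').
  by apply: (mem_wedgeg s1' s2) => // x y; exact: h3.
- have h4' p q v : bideg K (p, q) v -> bideg K (q, p) (ostar O v).
    by move=> Pv; rewrite -h4; exists v.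
  move=> p q; apply/seteqP; split=> [w [v Pv <-]|w Pw] /=.
    by apply: (mem_ostarg (cK q p) _ Pv) => x; exact: h4'.
  exists (ostar Og w); last exact: ostargK.
  by apply: (mem_ostarg (cK p q) _ Pw) => x; exact: h4'.
Qed.
End Deformation.

Theorem proposition5p4 (R : realType) (A B Om : lmodType (complex R))
    (H : hopf_data A) (X : comod_alg_data A B) (O : calculus_data A B Om)
    (K : complex_data Om) (g gbar : tensor A A -> complex R) :
  is_covariant_complex_structure H X O K ->
  is_two_cocycle H g gbar ->
  is_unitary_cocycle H g gbar ->
  is_covariant_complex_structure (deform_hopf H g gbar)
    (deform_comod_alg H g gbar X) (deform_calculus H g gbar X O)
    (deform_complex K).
Proof.
move=> [hS hX hO hK cK] hg hu; have [hH _ _ _] := hS; split.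
- exact: deform_is_hopf_star.
- exact: deform_is_comodule_star_algebra.
- exact: deform_covariant_star_calculus.
- exact: deform_complex_structure.
- exact: cK.
Qed.
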